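(* Let $i:X\hookrightarrow(M,L)$ be a coregular submanifold of a Dirac manifold. Choose a complement $L|_X=\mathrm{pr}_T^{-1}(TX)\oplus C$ and denote by $j:C\hookrightarrow L|_X$ the inclusion. The local Dirac saturation $(P,L_P)$ of $X$ is diffeomorphic with $$\big(C\cap\Sigma,\ (\mathbf{s}^!(i^!L))^{-j^*\omega|_X}\big).$$ In particular, $(P,L_P)$ is determined by the pullback Dirac structure $i^!L$, up to diffeomorphisms and exact gauge transformations.
   Context: $\mathrm{pr}_T:L\to TM$ and $\mathrm{pr}_{T^*}:L\to T^*M$ are the projections of a Dirac structure $L\subset TM\oplus T^*M$. An embedded submanifold $X\subset(M,L)$ is coregular if $\overline{\mathrm{pr}_T}:L|_X\to TM|_X/TX$ ($\mathrm{pr}_T$ composed with the projection to the normal bundle) has constant rank; then $\mathrm{pr}_T^{-1}(TX)\subset L|_X$ is a vector subbundle and $i^!L$ is a smooth Dirac structure on $X$. Here $\varphi^!L=\{v+(\mathrm{d}\varphi)^*\beta:\mathrm{d}\varphi(v)+\beta\in L\}$ and $L^\eta=\{v+\alpha+\iota_v\eta:v+\alpha\in L\}$ is the gauge transform by a closed two-form $\eta$; an exact gauge transformation is one with $\eta$ exact. Dirac manifolds are called diffeomorphic if there is a diffeomorphism identifying the Dirac structures. Let $\mathbf{s}:L\to M$ be the bundle projection (its restrictions to $L|_X$ and $C$ map to $X$ and are also denoted $\mathbf{s}$). A spray for $L$ is a vector field $\mathcal{V}$ on $L$ with $\mathrm{d}\mathbf{s}(\mathcal{V}_a)=\mathrm{pr}_T(a)$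 for $a\in L$ and $m_t^*\mathcal{V}=t\mathcal{V}$ for $t\neq0$, where $m_t$ is fiberwise multiplication by $t$. Fix one. On a neighborhood $\Sigma\subset L$ of the zero section its flow $\varphi_\epsilon$ is defined for $\epsilon\in[0,1]$; set $\exp_{\mathcal{V}}(a)=\mathbf{s}(\varphi_1(a))$ and $\omega=\int_0^1\varphi_\epsilon^*\big((\mathrm{pr}_{T^*})^*\omega_{can}\big)\mathrm{d}\epsilon$, with $\omega_{can}=\sum_i\mathrm{d}q^i\wedge\mathrm{d}p_i$ the canonical symplectic form on $T^*M$. Write $\Sigma|_X=\Sigma\cap L|_X$ and let $\omega|_X$ be the pullback of $\omega$ to $\Sigma|_X$. For $\Sigma$ small, $(M,L)\xleftarrow{\mathbf{s}}(\Sigma,\mathrm{Gr}(\omega))\xrightarrow{\exp_{\mathcal{V}}}(M,-L)$ is a Dirac dual pair: both maps are surjective forward Dirac submersions, and with $V=\ker\mathrm{d}\mathbf{s}$, $W=\ker\mathrm{d}\exp_{\mathcal{V}}$, $K=\ker\omega$ one has $\omega(V,W)=0$ and $V\cap K\cap W=0$. Here $\mathrm{Gr}(\omega)=\{v+\iota_v\omega\}$ and $-L=\{v-\alpha:v+\alpha\in L\}$. Local Dirac saturation. Shrinking $\Sigma$ if necessary, $\exp_{\mathcal{V}}$ restricts to an embedding of $C\cap\Sigma$ into $M$ whose image $P:=\exp_{\mathcal{V}}(C\cap\Sigma)$ contains $X$, equals $\exp_{\mathcal{V}}(\Sigma|_X)$ and is invariant ($\mathrm{pr}_T(L|_P)\subset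 TP$), with pullback Dirac structure $L_P$. $(P,L_P)$ is called the local Dirac saturation of $X$.
   Formalization: ''Determined by i^!L'' is false literally (a point in a symplectic plane versus a point with zero Poisson structure); the formal comparison also assumes an isomorphism of the complements C over the diffeomorphism of X, and compares neighborhoods of X in P, since P depends on the choice of Σ. *)

(* Defs.v *)
From HB Require Import structures.
From mathcomp Require Import all_boot all_order all_algebra.
From mathcomp Require Import all_classical all_reals all_analysis.

Set Implicit Arguments.
Unset Strict Implicit.
Unset Printing Implicit Defensive.

Import Order.TTheory GRing.Theory Num.Theory.
Import numFieldNormedType.Exports.

Local Open Scope classical_set_scope.
Local Open Scope ring_scope.

Section Smoothness.
Context {R : realType}.

(* Meant for open [U] and finite-dimensional [V]. *)
Fixpoint Ck {V W : normedModType R} (k : nat) (U : set V) (f : V -> W) : Prop :=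
  match k with
  | 0%N => forall x, U x -> {for x, continuous f}
  | k'.+1 => (forall x, U x -> differentiable f x) /\
             forall v, Ck k' U (fun x => 'd f x v)
  end.

Definition smooth {V W : normedModType R} (U : set V) (f : V -> W) : Prop :=
  forall k, Ck k U f.

End Smoothness.

(* A type of points with one chart around each point [x]: [coord x] is the chart
   map, meaningful on [dom x], and [param x] its inverse. The laws are in
   [is_manifold]. A tangent vector at [x] is represented by its components in
   the chart chosen at [x], hence by an element of [V]. *)
Record atlas (R : realType) (V : normedModType R) := Atlas {
  point :> Type;
  dom : point -> set point;
  coord : point -> point -> V;
  param : point -> V -> point }.

Section Atlas.
Context {R : realType}.

Definition flat (V : normedModType R) : atlas V :=
  @Atlas R V V (fun _ => setT) (fun _ v => v) (fun _ v => v).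

Definition prod_atlas {V W : normedModType R} (A : atlas V) (B : atlas W) :
    atlas (V * W)%type :=
  @Atlas R (V * W)%type (A * B)%type
    (fun z => [set y | dom z.1 y.1 /\ dom z.2 y.2])
    (fun z y => (coord z.1 y.1, coord z.2 y.2))
    (fun z q => (param z.1 q.1, param z.2 q.2)).

Section OneAtlas.
Context {V : normedModType R} (A : atlas V).

(* The topology generated by the charts. *)
Definition mopen (U : set A) : Prop :=
  forall x, open (coord x @` (U `&` dom x)).

Definition transition (x y : A) : V -> V := coord y \o param x.

(* Tangent vectors at [z]: from components in chart [x] to those in chart [y]. *)
Definition move_vec (x y z : A) : V -> V := 'd (transition x y) (coord x z).

Definition is_manifold : Prop :=
  [/\ forall x : A, dom x x,
      forall x y : A, dom x y -> param x (coord x y) = y,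
      forall x y : A, open (coord x @` (dom x `&` dom y)) /\
        smooth (coord x @` (dom x `&` dom y)) (transition x y),
      forall x y : A, x <> y -> exists U U' : set A,
        [/\ mopen U, mopen U', U x, U' y & U `&` U' = set0]
    & exists B : nat -> set A, (forall k, mopen (B k)) /\
        forall U x, mopen U -> U x -> exists k, B k x /\ B k `<=` U].

Definition has_velocity (g : R -> A) (t : R) (v : V) : Prop :=
  (\forall s \near t, dom (g t) (g s)) /\
  is_derive (t : R^o) (1 : R^o) (fun s : R^o => coord (g t) (g s)) v.

End OneAtlas.

Definition smooth_at {V W : normedModType R} {A : atlas V} {B : atlas W}
    (f : A -> B) (x : A) : Prop :=
  exists O : set V,
    [/\ open O, O (coord x x), O `<=` coord x @` dom x,
        forall q, O q -> dom (f x) (f (param x q))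
      & smooth O (fun q => coord (f x) (f (param x q)))].

(* Smooth on an arbitrary subset: smooth local extensions exist. *)
Definition smooth_map {V W : normedModType R} {A : atlas V} {B : atlas W}
    (S : set A) (f : A -> B) : Prop :=
  forall x, S x -> exists U (g : A -> B),
    [/\ mopen U, U x, smooth_at g x & forall y, (U `&` S) y -> f y = g y].

Definition diffeo {V W : normedModType R} {A : atlas V} {B : atlas W}
    (S : set A) (S' : set B) (f : A -> B) : Prop :=
  exists g : B -> A,
    [/\ smooth_map S f, smooth_map S' g,
        forall x, S x -> S' (f x) /\ g (f x) = x
      & forall y, S' y -> S (g y) /\ f (g y) = y].

End Atlas.

Section Submanifolds.
Context {R : realType} {V : normedModType R} {A : atlas V}.

(* [psi : W -> S] is a local parametrization of [S], with image open in [S];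
   its inverse extends to a smooth map [rho] on an open set of [A]. *)
Definition local_param (S : set A) (k : nat) (W : set 'rV[R]_k) (U : set A)
    (psi : 'rV[R]_k -> A) (rho : A -> 'rV[R]_k) : Prop :=
  [/\ open W /\ mopen U,
      @smooth_map R _ _ (flat 'rV[R]_k) A W psi,
      @smooth_map R _ _ A (flat 'rV[R]_k) U rho,
      psi @` W = S `&` U
    & forall w, W w -> rho (psi w) = w].

Definition is_submanifold (k : nat) (S : set A) : Prop :=
  forall x, S x -> exists W U psi rho, U x /\ @local_param S k W U psi rho.

Definition curve_at (S : set A) (x : A) (v : V) (g : R -> A) : Prop :=
  [/\ g 0 = x, \forall t \near (0 : R), S (g t),
      @smooth_at R _ _ (flat R^o) A g 0 & has_velocity g 0 v].

Definition tangent (S : set A) (x : A) : set V :=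
  [set v | exists g, curve_at S x v g].

(* Differential at [x] of [f : S -> B]; arbitrary off [tangent S x]. *)
Definition Tmap {W : normedModType R} {B : atlas W} (S : set A) (f : A -> B)
    (x : A) (v : V) : W :=
  xget 0 [set w | exists g, curve_at S x v g /\ has_velocity (f \o g) 0 w].


End Submanifolds.

Section Forms.
Context {R : realType} {V : normedModType R} {A : atlas V}.

(* Forms on [S] are only used at points of [S], on vectors tangent to [S]. *)
Definition form1 := A -> V -> R.
Definition form2 := A -> V -> V -> R.

Definition smooth_form1 (S : set A) (th : form1) : Prop :=
  (forall x a u v, S x -> tangent S x u -> tangent S x v ->
     th x (a *: u + v) = a * th x u + th x v) /\
  forall k W U (psi : 'rV[R]_k -> A) rho, local_param S W U psi rho ->
    forall v, @smooth R 'rV[R]_k R^o W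
      (fun q => th (psi q) (@Tmap R _ (flat 'rV[R]_k) _ A W psi q v)).

(* [eta = d th] on [S], in local parametrizations, where
   (d th)(v, w) = v(th w) - w(th v) for constant vector fields v, w. *)
Definition is_ext_deriv (S : set A) (th : form1) (eta : form2) : Prop :=
  forall k W U (psi : 'rV[R]_k -> A) rho, local_param S W U psi rho ->
  let T q v := @Tmap R _ (flat 'rV[R]_k) _ A W psi q v in
  forall q v w, W q ->
    eta (psi q) (T q v) (T q w) =
      'D_v (fun q' => th (psi q') (T q' w) : R^o) q -
      'D_w (fun q' => th (psi q') (T q' v) : R^o) q.

Definition exact_form (S : set A) (eta : form2) : Prop :=
  exists th, smooth_form1 S th /\ is_ext_deriv S th eta.

Definition vector_field (S : set A) (X : A -> V) : Prop :=
  (forall a, S a -> tangent S a (X a)) /\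
  forall a, S a -> @smooth_map R _ _ A (flat V) (S `&` dom a)
    (fun b => move_vec b a b (X b)).

(* [phi] is a local flow of the vector field [X] on [S], on the open set [O]
   of [R * S]. *)
Definition local_flow (S : set A) (X : A -> V) (O : set (R * A))
    (phi : R -> A -> A) : Prop :=
  [/\ exists U, @mopen R _ (prod_atlas (flat R^o) A) U /\
        O = U `&` (setT `*` S),
      forall a, S a -> O (0, a) /\ phi 0 a = a,
      forall t a, O (t, a) -> forall c, 0 <= c <= 1 -> O (c * t, a),
      forall s t a, O (t, a) -> O (s, phi t a) -> O (s + t, a) ->
        phi s (phi t a) = phi (s + t) a
    & (forall t a, O (t, a) ->
         S (phi t a) /\ has_velocity (phi ^~ a) t (X (phi t a))) /\
      @smooth_map R _ _ (prod_atlas (flat R^o) A) A O (fun z => phi z.1 z.2)].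

(* A family of subspaces of T_x S + T*_x S, x in S. A covector at x is given by
   a function on [V], of which only the restriction to [tangent S x] matters;
   all families below are closed under changing it elsewhere. *)
Definition dirac_family := A -> set (V * (V -> R)).

(* {v + alpha + i_v eta : v + alpha in D} *)
Definition gauge (S : set A) (D : dirac_family) (eta : form2) : dirac_family :=
  fun x => [set z | exists al, D x (z.1, al) /\
    forall u, tangent S x u -> z.2 u = al u + eta x z.1 u].

(* {v + i_v eta} *)
Definition graph_form (S : set A) (eta : form2) : dirac_family :=
  fun x => [set z | tangent S x z.1 /\
    forall u, tangent S x u -> z.2 u = eta x z.1 u].

End Forms.

Section Pullbacks.
Context {R : realType} {V W : normedModType R} {A : atlas V} {B : atlas W}.

Definition embedding {W : normedModType R} {B : atlas W} (S : set A)
    (f : A -> B) : Prop :=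
  (exists k, is_submanifold k (f @` S)) /\ diffeo S (f @` S) f.

Definition pull_form2 (S : set A) (f : A -> B) (eta : @form2 R W B) :
    @form2 R V A :=
  fun x u v => eta (f x) (Tmap S f x u) (Tmap S f x v).

(* f^! D = {v + f^* beta : df(v) + beta in D} *)
Definition pull_dirac (S : set A) (f : A -> B) (D : @dirac_family R W B) :
    @dirac_family R V A :=
  fun x => [set z | tangent S x z.1 /\ exists be, D (f x) (Tmap S f x z.1, be) /\
    forall u, tangent S x u -> z.2 u = be (Tmap S f x u)].

Definition dirac_diffeo (S : set A) (D : @dirac_family R V A)
    (S' : set B) (D' : @dirac_family R W B) (f : A -> B) : Prop :=
  diffeo S S' f /\ forall x, S x -> pull_dirac S f D' x = D x.

Definition dirac_diffeomorphic (S : set A) (D : @dirac_family R V A)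
    (S' : set B) (D' : @dirac_family R W B) : Prop :=
  exists f, dirac_diffeo S D S' D' f.

End Pullbacks.

Section LinearAlgebra.
Context {R : realType} {V : lmodType R}.

Definition is_basis (r : nat) (F : set V) (e : 'I_r -> V) : Prop :=
  (forall w, F w <-> exists c : 'I_r -> R, w = \sum_i c i *: e i) /\
  forall c : 'I_r -> R, \sum_i c i *: e i = 0 -> forall i, c i = 0.

(* For subspaces [F] and [G], the image of [F] in the quotient by [G] has
   dimension [r]. *)
Definition quotient_rank (r : nat) (F G : set V) : Prop :=
  exists e : 'I_r -> V,
    [/\ forall i, F (e i),
        forall w, F w -> exists c : 'I_r -> R, G (w - \sum_i c i *: e i)
      & forall c : 'I_r -> R, G (\sum_i c i *: e i) -> forall i, c i = 0].

End LinearAlgebra.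

Definition dot (R : realType) (n : nat) (p v : 'rV[R]_n) : R :=
  \sum_i p 0 i * v 0 i.

Structure manifold (R : realType) (n : nat) := Manifold {
  manifold_atlas :> atlas 'rV[R]_n;
  manifoldP : is_manifold manifold_atlas }.

Section Bundles.
Context {R : realType} {n : nat} (M : manifold R n).
Local Notation E := 'rV[R]_n.

(* Covectors at [z]: from components in chart [x] to those in chart [y]. *)
Definition move_cov (x y z : M) (p : E) : E :=
  \row_i dot p (move_vec y x z (delta_mx 0 i)).

(* T*M, with the charts induced from M; a point is (x, p) with p the components
   of a covector in the chart chosen at x. *)
Definition cotangent : atlas (E * E)%type :=
  @Atlas R (E * E)%type (M * E)%type
    (fun a => [set b | dom a.1 b.1])
    (fun a b => (coord a.1 b.1, move_cov b.1 a.1 b.1 b.2))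
    (fun a z => let y := param a.1 z.1 in (y, move_cov a.1 y y z.2)).

(* TM + T*M, with the charts induced from M; a point is (x, v, p). *)
Definition pontryagin : atlas (E * E * E)%type :=
  @Atlas R (E * E * E)%type (M * E * E)%type
    (fun a => [set b | dom a.1.1 b.1.1])
    (fun a b => (coord a.1.1 b.1.1, move_vec b.1.1 a.1.1 b.1.1 b.1.2,
                 move_cov b.1.1 a.1.1 b.1.1 b.2))
    (fun a z => let y := param a.1.1 z.1.1 in
                (y, move_vec a.1.1 y y z.1.2, move_cov a.1.1 y y z.2)).

Definition base (a : pontryagin) : M := a.1.1.
Definition prT (a : pontryagin) : E := a.1.2.
Definition prTs (a : pontryagin) : cotangent := (a.1.1, a.2).

Definition fiber (F : set pontryagin) (x : M) : set (E * E)%type :=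
  [set w | F (x, w.1, w.2)].

Definition scale (t : R) (a : pontryagin) : pontryagin :=
  (a.1.1, t *: a.1.2, t *: a.2).

(* omega_can = sum_i dq^i /\ dp_i in the chart of T*M chosen at the point. *)
Definition omega_can : @form2 R _ cotangent :=
  fun _ u v => dot v.2 u.1 - dot u.2 v.1.

(* Smooth vector subbundles of rank [r] of (TM + T*M)|_X. *)
Definition subbundle (r : nat) (X : set M) (F : set pontryagin) : Prop :=
  (forall a, F a -> X (base a)) /\
  forall x, X x -> exists (U : set M) (e : 'I_r -> M -> E * E),
    [/\ mopen U, U x,
        forall i, @smooth_map R _ _ M pontryagin (X `&` U)
          (fun y => (y, (e i y).1, (e i y).2))
      & forall y, (X `&` U) y -> is_basis (fiber F y) (e ^~ y)].

Definition lagrangian (L : set pontryagin) : Prop :=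
  forall x w, fiber L x w <->
    forall w', fiber L x w' -> dot w.2 w'.1 + dot w'.2 w.1 = 0.

(* [v + al, w + be] = [v, w] + L_v be - i_w (d al), in coordinates. *)
Definition dorfman (v al w be : E -> E) (q : E) : E * E :=
  ('d w q (v q) - 'd v q (w q),
   'd be q (v q) - 'd al q (w q)
   + \row_i (dot (be q) ('d v q (delta_mx 0 i))
             + dot (w q) ('d al q (delta_mx 0 i)))).

Definition involutive (L : set pontryagin) : Prop :=
  forall (x : M) (O : set E) (v al w be : E -> E),
    let in_L q z := L (@param R _ pontryagin (x, 0, 0) (q, z.1, z.2)) in
    open O -> O `<=` coord x @` dom x ->
    smooth O v -> smooth O al -> smooth O w -> smooth O be ->
    (forall q, O q -> in_L q (v q, al q) /\ in_L q (w q, be q)) ->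
    forall q, O q -> in_L q (dorfman v al w be q).

Definition dirac_structure (L : set pontryagin) : Prop :=
  [/\ subbundle n setT L, lagrangian L & involutive L].

Definition family_of (L : set pontryagin) : @dirac_family R _ M :=
  fun x => [set z | exists p, L (x, z.1, p) /\ forall u, z.2 u = dot p u].

Definition opp_dirac (L : set pontryagin) : set pontryagin :=
  [set a | L (a.1.1, a.1.2, - a.2)].

Definition coregular (L : set pontryagin) (X : set M) : Prop :=
  (exists k, is_submanifold k X) /\
  exists r, forall x, X x ->
    quotient_rank r [set prT a | a in [set a | L a /\ base a = x]] (tangent X x).

Definition complement (L : set pontryagin) (X : set M) (C : set pontryagin) :
    Prop :=
  [/\ exists r, subbundle r X C,
      C `<=` L,
      forall a, C a -> tangent X (base a) (prT a) ->
        prT a = 0 /\ a.2 = 0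
    & forall x w, X x -> fiber L x w -> exists w1 w2,
        [/\ fiber L x w1, tangent X x w1.1, fiber C x w2 & w = w1 + w2]].

Definition spray (L : set pontryagin) (X : pontryagin -> E * E * E) : Prop :=
  [/\ vector_field L X,
      forall a, L a -> Tmap L base a (X a) = prT a
    & forall t a, t != 0 -> L a ->
        Tmap L (scale t^-1) (scale t a) (X (scale t a)) = t *: X a].

(* [S] is a neighborhood in [L] of the zero section on which the flow is
   defined up to time 1. *)
Definition spray_domain (L : set pontryagin) (O : set (R * pontryagin))
    (S : set pontryagin) : Prop :=
  [/\ exists U, mopen U /\ S = L `&` U,
      forall x : M, S (x, 0, 0)
    & forall t a, 0 <= t <= 1 -> S a -> O (t, a)].

Definition spray_exp (phi : R -> pontryagin -> pontryagin) (a : pontryagin) : M :=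
  base (phi 1 a).

Definition spray_form (L S : set pontryagin)
    (phi : R -> pontryagin -> pontryagin) : @form2 R _ pontryagin :=
  fun a u v => \int[@lebesgue_measure R]_(t in `[0, 1])
    pull_form2 S (phi t) (pull_form2 L prTs omega_can) a u v.

Section ForwardMaps.
Context {V : normedModType R} {A : atlas V}.

Definition forward_dirac (S : set A) (D : @dirac_family R V A) (f : A -> M)
    (L : set pontryagin) : Prop :=
  forall x, S x -> forall w p, L (f x, w, p) <->
    exists v, [/\ tangent S x v, Tmap S f x v = w
                & D x (v, fun u => dot p (Tmap S f x u))].

Definition surjective_submersion (S : set A) (f : A -> M) : Prop :=
  [/\ smooth_map S f, f @` S = setT
    & forall x, S x -> forall w, exists v, tangent S x v /\ Tmap S f x v = w].

End ForwardMaps.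

(* (M, L) <-s- (S, Gr(om)) -e-> (M, -L) *)
Definition dirac_dual_pair (L S : set pontryagin) (om : @form2 R _ pontryagin)
    (e : pontryagin -> M) : Prop :=
  [/\ surjective_submersion S base /\ surjective_submersion S e,
      forward_dirac S (graph_form S om) base L,
      forward_dirac S (graph_form S om) e (opp_dirac L),
      forall a v w, S a -> tangent S a v -> tangent S a w ->
        Tmap S base a v = 0 -> Tmap S e a w = 0 -> om a v w = 0
    & forall a v, S a -> tangent S a v ->
        Tmap S base a v = 0 -> (forall u, tangent S a u -> om a v u = 0) ->
        Tmap S e a v = 0 -> v = 0].

Definition invariant (L : set pontryagin) (P : set M) : Prop :=
  forall a, L a -> P (base a) -> tangent P (base a) (prT a).

End Bundles.

(* A coregular submanifold [sX] of a Dirac manifold [(sM, sL)], the choices of a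
   complement [sC], a spray [sV] and a sufficiently small neighborhood [sSig], and
   the resulting local Dirac saturation [sP]. *)
Structure saturation (R : realType) := Saturation {
  sdim : nat;
  sM : manifold R sdim;
  sL : set (pontryagin sM);
  sX : set sM;
  sC : set (pontryagin sM);
  sV : pontryagin sM -> 'rV[R]_sdim * 'rV[R]_sdim * 'rV[R]_sdim;
  sO : set (R * pontryagin sM);
  sphi : R -> pontryagin sM -> pontryagin sM;
  sSig : set (pontryagin sM);
  sP : set sM;
  L_dirac : dirac_structure sL;
  X_coregular : coregular sL sX;
  C_complement : complement sL sX sC;
  V_spray : spray sL sV;
  phi_flow : local_flow sL sV sO sphi;
  Sig_domain : spray_domain sL sO sSig;
  Sig_dual_pair :
    dirac_dual_pair sL sSig (spray_form sL sSig sphi) (spray_exp sphi);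
  exp_embedding : embedding (sC `&` sSig) (spray_exp sphi);
  P_image : sP = spray_exp sphi @` (sC `&` sSig);
  X_sub_P : sX `<=` sP;
  P_image_X : sP = spray_exp sphi @` (sSig `&` [set a | sX (base a)]);
  P_invariant : invariant sL sP }.

Arguments sL {R} s _.
Arguments sX {R} s _.
Arguments sC {R} s _.
Arguments sSig {R} s _.
Arguments sP {R} s _.
Arguments sphi {R} s _ _.

Section Saturation.
Context {R : realType} (S : saturation R).

Definition CSig : set (pontryagin (sM S)) := sC S `&` sSig S.

(* i^! L *)
Definition L_X : dirac_family := pull_dirac (sX S) idfun (family_of (sL S)).

Definition L_P : dirac_family := pull_dirac (sP S) idfun (family_of (sL S)).

Definition SigX : set (pontryagin (sM S)) := sSig S `&` [set a | sX S (base a)].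

Definition omega_X : form2 :=
  pull_form2 SigX idfun (spray_form (sL S) (sSig S) (sphi S)).

(* - j^* omega|_X *)
Definition opp_j_omega : form2 :=
  fun a u v => - pull_form2 CSig idfun omega_X a u v.

End Saturation.

Arguments CSig {R} S _.
Arguments L_X {R} S _ _.
Arguments L_P {R} S _ _.
Arguments opp_j_omega {R} S _ _ _.

(* A diffeomorphism [f : X -> X'] identifying the pullback Dirac structures,
   together with an isomorphism [F : C -> C'] of vector bundles over it. *)
Definition same_pullback (R : realType) (S S' : saturation R)
    (f : sM S -> sM S') (F : pontryagin (sM S) -> pontryagin (sM S')) : Prop :=
  [/\ dirac_diffeo (sX S) (L_X S) (sX S') (L_X S') f,
      diffeo (sC S) (sC S') F,
      forall a, sC S a -> base (F a) = f (base a)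
    & forall x w w' c, fiber (sC S) x w -> fiber (sC S) x w' ->
        let Fx z := let b := F (x, z.1, z.2) in (prT b, b.2) in
        Fx (c *: w + w') = c *: Fx w + Fx w'].

(* Open neighborhoods of [X] in [P] and of [X'] in [P'] are related by a
   diffeomorphism and an exact gauge transformation. *)
Definition germ_gauge_equivalent (R : realType) (S S' : saturation R) : Prop :=
  exists (U : set (sM S)) (U' : set (sM S')) (eta : form2) (g : sM S -> sM S'),
    [/\ mopen U /\ mopen U',
        sX S `<=` U /\ sX S' `<=` U',
        exact_form (sP S `&` U) eta
      & dirac_diffeo (sP S `&` U) (gauge (sP S `&` U) (L_P S) eta)
          (sP S' `&` U') (L_P S') g].

(* Main.v *)
(* In the 2n-dimensional Sigma, with V = ker ds, W = ker d(exp) and K = ker omega,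
   the dual pair conditions omega(V, W) = 0 and V /\ K /\ W = 0 and a dimension
   count give V^omega = W + K. Hence, for every v tangent to Sigma at a, the
   covectors b with ds(v) + b in L and the covectors g with d exp(v) + g in L
   correspond to each other by s^* b = exp^* g + i_v omega. Restricted to C /\ Sigma,
   which exp maps diffeomorphically onto P, this correspondence is the identity
   exp^! L_P = (s^! (i^! L))^(- j^* omega).

   The form - omega is exact, a primitive being the average over t in [0, 1] of the
   pullbacks of the Liouville form p dq by pr_T* o phi_t. If f : X -> X' identifies
   the pullback structures and F : C -> C' is a bundle isomorphism over f, then
   exp' o F o exp^-1 is a diffeomorphism between neighborhoods of X and X' in P and
   P', and it identifies L_P with L_P' up to the difference of the two exact gauge
   forms. The neighborhoods contain X and X' because the spray vanishes on the zero
   section, so that exp is the identity there. *)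

From Pilot Require Import Defs.
From HB Require Import structures.
From mathcomp Require Import all_boot all_order all_algebra.
From mathcomp Require Import all_classical all_reals all_analysis.
From mathcomp Require Import zify ring lra.
Import Pilot.Defs.

Set Implicit Arguments.
Unset Strict Implicit.
Unset Printing Implicit Defensive.

Import Order.TTheory GRing.Theory Num.Theory.
Import numFieldNormedType.Exports.

Local Open Scope classical_set_scope.
Local Open Scope ring_scope.

(** * Calculus on finite-dimensional normed modules *)

(** Tangent vectors are velocities of curves and [Tmap] picks a value by choice, so it is not
    immediate that the tangent vectors of Sigma at a point form a vector space of dimension 2n, on
    which the dimension count and all linear algebra rest. A frame of [L] yields a parametrization
    of Sigma by an open set of R^(n + n). That its differential reaches every velocity needs
    equations for [L], and these come from maximal isotropy: [L] is the zero set of the pairings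
    with its own frame. Forms are treated along arbitrary smooth maps from open sets of vector
    spaces into Sigma. There omega becomes an integral over [0, 1] with a parameter, and its
    exactness is the symmetry of second derivatives combined with differentiation under the integral
    sign. Covectors of [i^! L] are known only on TX. This suffices, because [base] sends the whole
    of C /\ Sigma into X, so that on C /\ Sigma a covector over X is paired only with vectors
    tangent to X. *)

Record findim {R : realType} (V : normedModType R) := Findim {
  fd_dim : nat;
  fd_basis : 'I_fd_dim -> V;
  fd_coord : 'I_fd_dim -> V -> R;
  fd_coord_lin : forall i a u v,
    fd_coord i (a *: u + v) = a * fd_coord i u + fd_coord i v;
  fd_coord_cts : forall i, continuous (fd_coord i : V -> R^o);
  fd_span : forall v, v = \sum_i fd_coord i v *: fd_basis i }.
Existing Class findim.
Arguments fd_basis {R V _} i.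
Arguments fd_coord {R V _} i v.
Arguments fd_coord_lin {R V _} i a u v.
Arguments fd_coord_cts {R V _} i.
Arguments fd_span {R V _} v.

Section Differentials.
Context {R : realType}.
Implicit Types V W Z : normedModType R.

Lemma diff_eps V W (f : V -> W) x (df : {linear V -> W}) : continuous df ->
  (forall e : R, 0 < e -> \forall h \near (0 : V),
     `|f (h + x) - f x - df h| <= e * `|h|) ->
  differentiable f x /\ 'd f x = df :> (V -> W).
Proof.
move=> dfc H.
have E : f \o shift x = cst (f x) + df +o_ 0 id.
  apply/eqaddoP => e e0; have := H e e0; apply: filterS => h /=.
  by rewrite /= !fctE opprD addrA.
have D := diff_unique dfc E; split=> //; apply/diff_locallyP.
by rewrite D.
Qed.

Lemma eq_diff V W (f g : V -> W) x : (\forall y \near x, f y = g y) ->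
  differentiable f x -> differentiable g x /\ 'd g x = 'd f x :> (V -> W).
Proof.
move=> fg df; apply: diff_eps; first exact: diff_continuous.
move=> e e0; have /diff_locallyP[_ /eqaddoP/(_ e e0)] := df.
have fg0 : \forall h \near (0 : V), f (h + x) = g (h + x).
  by move: fg; rewrite (near_shift 0) subr0.
have fgx := nbhs_singleton fg.
by apply: filterS2 fg0 => h /= E; rewrite !fctE /= -E fgx opprD addrA.
Qed.

Definition fd_linear V {FV : findim V} i : {linear V -> R^o} :=
  HB.pack (fd_coord i : V -> R^o)
    (@GRing.isLinear.Build R V R^o *%R _ (fd_coord_lin i)).

Lemma continuous_sumr V W n (f : 'I_n -> V -> W) x :
  (forall i, {for x, continuous (f i)}) ->
  {for x, continuous (fun y => \sum_i f i y)}.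
Proof.
move=> H; elim: n f H => [|n IH] f H.
  rewrite (_ : (fun _ => _) = fun=> 0) ?funeqE => [|y]; first exact: cst_continuous.
  by rewrite big_ord0.
rewrite (_ : (fun _ => _) = (fun y => (\sum_i f (widen_ord (leqnSn n) i) y)) + f ord_max).
  by apply: continuousD; [apply: IH => i; apply: H|apply: H].
by rewrite funeqE => y; rewrite big_ord_recr.
Qed.

Lemma fd_lin_continuous V W {FV : findim V} (f : {linear V -> W}) : continuous f.
Proof.
move=> x.
rewrite (_ : (f : V -> W) = fun y => \sum_i fd_coord i y *: f (fd_basis i)).
  apply: continuous_sumr => i; apply: continuousZr_tmp.
  exact: fd_coord_cts.
rewrite funeqE => y; rewrite {1}(fd_span y) linear_sum.
by apply: eq_bigr => i _; rewrite linearZ.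
Qed.

Lemma diff_basis V W {FV : findim V} (f : V -> W) x v :
  'd f x v = \sum_i fd_coord i v *: 'd f x (fd_basis i).
Proof.
by rewrite {1}(fd_span v) linear_sum; apply: eq_bigr => i _; rewrite linearZ.
Qed.

Lemma diffDv V W (f g : V -> W) x v : differentiable f x -> differentiable g x ->
  'd (fun y => f y + g y) x v = 'd f x v + 'd g x v.
Proof. by move=> df dg; have /(congr1 (@^~ v)) := diffD df dg. Qed.

Lemma differentiable_scale V W (f : V -> R^o) (g : V -> W) x :
  differentiable f x -> differentiable g x ->
  differentiable (fun y => f y *: g y) x /\
  forall v, 'd (fun y => f y *: g y) x v = f x *: 'd g x v + 'd f x v *: g x.
Proof.
move=> df dg.
have bl : bilinear_for *:%R *:%R (fun (a : R^o) (w : W) => a *: w).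
  by split=> [u'|u] a y z /=; rewrite ?scalerDl ?scalerA // scalerDr !scalerA mulrC.
pose sc : {bilinear R^o -> W -> W} := HB.pack (fun (a : R^o) (w : W) => a *: w)
  (bilinear_isBilinear.Build R R^o W W *:%R *:%R _ bl).
have cs : continuous (fun p : R^o * W => sc p.1 p.2) by exact: scale_continuous.
have dp := differentiable_pair df dg.
rewrite (_ : (fun _ => _) = (fun p => sc p.1 p.2) \o (fun y => (f y, g y))) //.
have ds := @differentiable_bilin _ _ _ _ sc (f x, g x) cs.
split=> [|v]; first exact: differentiable_comp.
rewrite diff_comp //= (@diff_bilin _ _ _ _ sc) //=.
by rewrite (congr1 (@^~ v) (diff_pair df dg)).
Qed.

End Differentials.

(** * Rules for smooth maps *)

Section SmoothCalculus.
Context {R : realType}.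
Implicit Types V W Z : normedModType R.

Lemma CkW V W k (U : set V) (f : V -> W) : Ck k.+1 U f -> Ck k U f.
Proof.
elim: k f => [|k IH] f [D H] /=.
  by move=> x /D; exact: differentiable_continuous.
by split=> // v; apply: IH; exact: H.
Qed.

Lemma Ck_subset V W k (U U' : set V) (f : V -> W) : U' `<=` U ->
  Ck k U f -> Ck k U' f.
Proof.
move=> UU'; elim: k f => [|k IH] f /= H; first by move=> x /UU'; exact: H.
by case: H => D H; split=> [x /UU'|v]; [exact: D|exact/IH/H].
Qed.

Lemma Ck_local V W k (U : set V) (f : V -> W) :
  (forall x, U x -> exists U', U' x /\ Ck k U' f) -> Ck k U f.
Proof.
elim: k f => [|k IH] f /= H.
  by move=> x /H[U' [U'x]]; apply.
split=> [x /H[U' [U'x [+ _]]]|v]; first exact.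
by apply: IH => x /H[U' [U'x [_ +]]]; exists U'.
Qed.

Lemma eq_Ck V W k (U : set V) (f g : V -> W) : open U ->
  (forall x, U x -> f x = g x) -> Ck k U f -> Ck k U g.
Proof.
move=> oU; elim: k f g => [|k IH] f g fg /= H.
  move=> x Ux; have := H x Ux; rewrite /prop_for /continuous_at -(fg _ Ux).
  apply: cvg_trans; apply: near_eq_cvg.
  by near=> y; apply: fg; near: y; exact: open_nbhs_nbhs.
have E x : U x -> differentiable g x /\ 'd g x = 'd f x :> (V -> W).
  move=> Ux; apply: eq_diff; last exact: H.1.
  by near=> y; apply: fg; near: y; exact: open_nbhs_nbhs.
split=> [x /E[]//|v]; apply: (IH (fun x => 'd f x v)); last exact: H.2.
by move=> x /E[_ /(congr1 (@^~ v))/esym].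
Unshelve. all: by end_near. Qed.

Lemma Ck_cst V W k (U : set V) (w : W) : Ck k U (fun _ => w).
Proof.
elim: k w => [|k IH] w /=; first by move=> x _; exact: cst_continuous.
split=> [x _|v]; first exact: differentiable_cst.
rewrite (_ : (fun _ => _) = fun=> 0) ?funeqE => [|x]; first exact: IH.
by have := diff_cst w x => /(congr1 (@^~ v)).
Qed.

Lemma Ck_linear V W {FV : findim V} k (U : set V) (f : {linear V -> W}) : Ck k U f.
Proof.
have c : continuous f by exact: fd_lin_continuous.
case: k => [|k] /=; first by move=> x _; exact: c.
split=> [x _|v]; first exact: linear_differentiable.
rewrite (_ : (fun _ => _) = fun=> f v) ?funeqE => [|x]; first exact: Ck_cst.
by rewrite diff_lin.
Qed.

Lemma CkD V W k (U : set V) (f g : V -> W) : open U -> Ck k U f -> Ck k U g ->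
  Ck k U (fun x => f x + g x).
Proof.
move=> oU; elim: k f g => [|k IH] f g /=.
  by move=> cf cg x Ux; apply: continuousD; [exact: cf|exact: cg].
move=> [df hf] [dg hg]; split=> [x Ux|v].
  by apply: differentiableD; [exact: df|exact: dg].
apply: (eq_Ck (f := fun x => 'd f x v + 'd g x v)) => //; last exact: IH.
by move=> x Ux; exact: (esym (diffDv v (df _ Ux) (dg _ Ux))).
Qed.

Lemma Ck_scale V W k (U : set V) (f : V -> R^o) (g : V -> W) : open U ->
  Ck k U f -> Ck k U g -> Ck k U (fun x => f x *: g x).
Proof.
move=> oU; elim: k f g => [|k IH] f g.
  move=> cf cg x Ux.
  by apply: (@cvgZ _ _ _ (nbhs x)); [exact: cf|exact: cg].
move=> cf cg; have cf' := CkW cf; have cg' := CkW cg.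
case: cf cg => [df hf] [dg hg]; split=> [x Ux|v].
  exact: (differentiable_scale (df _ Ux) (dg _ Ux)).1.
apply: (eq_Ck (f := fun x => f x *: 'd g x v + ('d f x v : R^o) *: g x)) => //.
  by move=> x Ux; exact: (esym ((differentiable_scale (df _ Ux) (dg _ Ux)).2 v)).
by apply: CkD => //; apply: IH => //; [exact: hg|exact: hf].
Qed.

Lemma Ck_sum V W k (U : set V) n (f : 'I_n -> V -> W) : open U ->
  (forall i, Ck k U (f i)) -> Ck k U (fun x => \sum_i f i x).
Proof.
move=> oU H; elim: n f H => [|n IH] f H.
  by apply: (eq_Ck (f := fun=> 0)) => // [x _|]; [rewrite big_ord0|exact: Ck_cst].
apply: (eq_Ck (f := fun x => \sum_i f (widen_ord (leqnSn n) i) x + f ord_max x)) => //.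
  by move=> x _; rewrite big_ord_recr.
by apply: CkD => //; apply: IH => i; exact: H.
Qed.

Lemma Ck_lin_comp V W Z k (U : set V) (f : V -> W) (L : {linear W -> Z}) :
  open U -> continuous L -> Ck k U f -> Ck k U (fun x => L (f x)).
Proof.
move=> oU cL; elim: k f => [|k IH] f.
  by move=> cf x Ux; apply: continuous_comp; [exact: cf|exact: cL].
move=> [df hf].
have dL y : differentiable L y by exact: linear_differentiable.
split=> [x Ux|v].
  exact: (differentiable_comp (df _ Ux) (dL _)).
apply: (eq_Ck (f := fun x => L ('d f x v))) => //; last exact/IH/hf.
move=> x Ux; rewrite -[RHS]/('d (L \o f) x v) (diff_comp (df _ Ux) (dL _)) /=.
by rewrite diff_lin.
Qed.

(** [Ck] differentiates in constant directions, while ['d f x v] varies with [x]. The derivative of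
    the composite is therefore expanded in a basis of [W], which turns it into a sum of products
    covered by the induction. *)
Lemma Ck_comp V W Z {FW : findim W} k (U : set V) (U' : set W) (f : V -> W) (g : W -> Z) :
  open U -> (forall x, U x -> U' (f x)) -> Ck k U f -> Ck k U' g ->
  Ck k U (fun x => g (f x)).
Proof.
move=> oU UU'; elim: k f g UU' => [|k IH] f g UU'.
  by move=> cf cg x Ux; apply: continuous_comp; [exact: cf|exact/cg/UU'].
move=> cf cg; have cf' := CkW cf; case: cf cg => [df hf] [dg hg].
split=> [x Ux|v].
  exact: (differentiable_comp (df _ Ux) (dg _ (UU' _ Ux))).
apply: (eq_Ck (f := fun x => \sum_i (fd_coord i ('d f x v) : R^o) *: 'd g (f x) (fd_basis i)))
  => //.
  move=> x Ux; rewrite -diff_basis -[RHS]/('d (g \o f) x v).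
  by rewrite (diff_comp (df _ Ux) (dg _ (UU' _ Ux))).
apply: Ck_sum => // i; apply: Ck_scale => //; last exact: (IH f (fun y => 'd g y (fd_basis i))
  UU' cf' (hg _)).
exact: (@Ck_lin_comp V W R^o k U (fun x => 'd f x v) (fd_linear i) oU (fd_coord_cts i) (hf v)).
Qed.

Lemma Ck_pair V W Z k (U : set V) (f : V -> W) (g : V -> Z) : open U ->
  Ck k U f -> Ck k U g -> Ck k U (fun x => (f x, g x)).
Proof.
move=> oU; elim: k f g => [|k IH] f g.
  by move=> cf cg x Ux; apply: (cvg_pair (cf _ Ux) (cg _ Ux)).
move=> [df hf] [dg hg]; split=> [x Ux|v].
  by apply: differentiable_pair; [exact: df|exact: dg].
apply: (eq_Ck (f := fun x => ('d f x v, 'd g x v))) => //; last exact: (IH _ _ (hf v) (hg v)).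
by move=> x Ux; exact: (esym (congr1 (@^~ v) (diff_pair (df _ Ux) (dg _ Ux)))).
Qed.

Lemma smooth_differentiable V W (U : set V) (f : V -> W) x :
  smooth U f -> U x -> differentiable f x.
Proof. by move=> /(_ 1%N)[+ _]; apply. Qed.

Lemma smooth_continuous V W (U : set V) (f : V -> W) x :
  smooth U f -> U x -> {for x, continuous f}.
Proof. by move=> /(_ 0%N); apply. Qed.

Lemma smooth_dir V W (U : set V) (f : V -> W) v :
  smooth U f -> smooth U (fun x => 'd f x v).
Proof. by move=> H k; have [_] := H k.+1; apply. Qed.

Lemma smooth_subset V W (U U' : set V) (f : V -> W) : U' `<=` U ->
  smooth U f -> smooth U' f.
Proof. by move=> s H k; exact: Ck_subset s (H k). Qed.

Lemma smooth_local V W (U : set V) (f : V -> W) :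
  (forall x, U x -> exists U', U' x /\ smooth U' f) -> smooth U f.
Proof. by move=> H k; apply: Ck_local => x /H[U' [U'x h]]; exists U'. Qed.

Lemma eq_smooth V W (U : set V) (f g : V -> W) : open U ->
  (forall x, U x -> f x = g x) -> smooth U f -> smooth U g.
Proof. by move=> oU fg H k; exact: eq_Ck oU fg (H k). Qed.

Lemma smooth_cst V W (U : set V) (w : W) : smooth U (fun _ => w).
Proof. by move=> k; exact: Ck_cst. Qed.

Lemma smooth_linear V W {FV : findim V} (U : set V) (f : {linear V -> W}) :
  smooth U f.
Proof. by move=> k; exact: Ck_linear. Qed.

Lemma smoothD V W (U : set V) (f g : V -> W) : open U ->
  smooth U f -> smooth U g -> smooth U (fun x => f x + g x).
Proof. by move=> oU hf hg k; exact: CkD. Qed.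

Lemma smooth_scale V W (U : set V) (f : V -> R^o) (g : V -> W) : open U ->
  smooth U f -> smooth U g -> smooth U (fun x => f x *: g x).
Proof. by move=> oU hf hg k; exact: Ck_scale. Qed.

Lemma smoothB V W (U : set V) (f g : V -> W) : open U ->
  smooth U f -> smooth U g -> smooth U (fun x => f x - g x).
Proof.
move=> oU hf hg; apply: smoothD => //.
apply: (eq_smooth (f := fun x => (-1 : R^o) *: g x)) => //.
  by move=> x _; rewrite scaleN1r.
by apply: smooth_scale => //; exact: smooth_cst.
Qed.

Lemma smooth_sum V W (U : set V) n (f : 'I_n -> V -> W) : open U ->
  (forall i, smooth U (f i)) -> smooth U (fun x => \sum_i f i x).
Proof. by move=> oU H k; apply: Ck_sum => // i; exact: H. Qed.

Lemma smooth_lin_comp V W Z {FW : findim W} (U : set V) (f : V -> W)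
  (L : {linear W -> Z}) : open U -> smooth U f -> smooth U (fun x => L (f x)).
Proof. by move=> oU hf k; apply: Ck_lin_comp => //; exact: fd_lin_continuous. Qed.

Lemma smooth_comp V W Z {FW : findim W} (U : set V) (U' : set W)
    (f : V -> W) (g : W -> Z) : open U -> (forall x, U x -> U' (f x)) ->
  smooth U f -> smooth U' g -> smooth U (fun x => g (f x)).
Proof. by move=> oU UU' hf hg k; exact: (Ck_comp oU UU' (hf k) (hg k)). Qed.

Lemma smooth_pair V W Z (U : set V) (f : V -> W) (g : V -> Z) : open U ->
  smooth U f -> smooth U g -> smooth U (fun x => (f x, g x)).
Proof. by move=> oU hf hg k; exact: Ck_pair. Qed.

Lemma smooth_diff V W Z {FV : findim V} {FW : findim W} (O : set Z) (U : set V) (f : V -> W)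
    (p v : Z -> V) : open O -> (forall z, O z -> U (p z)) ->
  smooth O p -> smooth O v -> smooth U f -> smooth O (fun z => 'd f (p z) (v z)).
Proof.
move=> oO OU hp hv hf.
apply: (eq_smooth (f := fun z => \sum_i (fd_coord i (v z) : R^o) *: 'd f (p z) (fd_basis i))) =>
  //.
  by move=> z _; rewrite -diff_basis.
apply: smooth_sum => // i; apply: smooth_scale => //.
  exact: (@smooth_lin_comp Z V R^o FV O v (fd_linear i)).
exact: (smooth_comp (g := fun y => 'd f y (fd_basis i)) oO OU hp (smooth_dir _ hf)).
Qed.

Lemma line_derive V W (f : V -> W) p v (s : R) : differentiable f (p + s *: v) ->
  is_derive (s : R^o) (1 : R^o) (fun s : R^o => f (p + s *: v)) ('d f (p + s *: v) v).
Proof.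
move=> df.
have dl : is_diff (s : R^o) (fun s : R^o => p + s *: v) (fun s : R^o => s *: v).
  pose l : {linear R^o -> V} := HB.pack (fun s : R^o => s *: v)
    (GRing.isLinear.Build R R^o V *:%R (fun s : R^o => s *: v)
       (fun a b c => etrans (scalerDl _ _ _) (congr1 (+%R^~ _) (esym (scalerA _ _ _))))).
  have cl : continuous l by move=> z; exact: scalel_continuous.
  have dcs : differentiable (fun _ : R^o => p) s by exact: differentiable_cst.
  have dls : differentiable l s by exact: linear_differentiable.
  apply: DiffDef; first exact: (differentiableD dcs dls).
  apply/funext => z; apply: (etrans (diffDv z dcs dls)).
  by rewrite (@diff_lin _ _ _ l) //= (congr1 (@^~ z) (diff_cst p (s : R^o))) add0r.
have dc := differentiable_comp (@ex_diff _ _ _ _ _ _ _ dl) df.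
apply: DeriveDef; first exact: diff_derivable.
rewrite deriveE // -[LHS]/('d (f \o (fun s : R^o => p + s *: v)) s 1) diff_comp //=.
by rewrite diff_val /= scale1r.
Qed.

End SmoothCalculus.

Section FinDimInstances.
Context {R : realType}.

Definition findim_R : findim R^o.
Proof.
apply: (@Findim R R^o 1 (fun _ => 1) (fun _ v => v)) => // [i x|v].
  exact: cvg_id.
by rewrite big_ord1 [RHS]mulr1.
Defined.

Definition findim_rV n : findim 'rV[R]_n.
Proof.
apply: (@Findim R 'rV[R]_n n (fun i => delta_mx 0 i) (fun i v => v 0 i)) => [i a u v|i|v].
- by rewrite !mxE.
- exact: coord_continuous.
- exact: row_sum_delta.
Defined.

Definition findim_prod (V W : normedModType R) {FV : findim V} {FW : findim W} :
  findim (V * W)%type.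
Proof.
unshelve refine (@Findim R (V * W)%type (fd_dim FV + fd_dim FW)
  (fun i => match fintype.split i with inl j => (fd_basis j, 0 : W) | inr j => (0 : V, fd_basis
    j) end)
  (fun i (v : V * W) => match fintype.split i with inl j => fd_coord j v.1 | inr j => fd_coord j
    v.2 end) _ _ _)
  => [i a u v|i|v].
- by case: fintype.split => j; exact: fd_coord_lin.
- case: fintype.split => j x /=.
    by apply: (@continuous_comp _ _ _ fst (fd_coord j : V -> R^o)); [exact: cvg_fst|exact:
      fd_coord_cts].
  by apply: (@continuous_comp _ _ _ snd (fd_coord j : W -> R^o)); [exact: cvg_snd|exact:
    fd_coord_cts].
rewrite big_split_ord /=.
under eq_bigr do rewrite (unsplitK (inl _)).
under [X in _ + X]eq_bigr do rewrite (unsplitK (inr _)).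
rewrite [LHS]surjective_pairing {1}(fd_span v.1) {1}(fd_span v.2).
have -> : \sum_(i < fd_dim FV) fd_coord i v.1 *: ((fd_basis i, 0) : V * W) =
    (\sum_i fd_coord i v.1 *: fd_basis i, 0).
  elim/big_rec2: _ => // i y1 y2 _ ->; congr pair => /=.
  by rewrite scaler0 addr0.
have -> : \sum_(i < fd_dim FW) fd_coord i v.2 *: ((0, fd_basis i) : V * W) =
    (0, \sum_i fd_coord i v.2 *: fd_basis i).
  elim/big_rec2: _ => // i y1 y2 _ ->; congr pair => /=.
  by rewrite scaler0 addr0.
by congr pair; rewrite /= ?addr0 ?add0r.
Defined.

End FinDimInstances.

#[export] Hint Extern 0 (findim _) => eapply findim_R : typeclass_instances.
#[export] Hint Extern 0 (findim _) => eapply findim_rV : typeclass_instances.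
#[export] Hint Extern 1 (findim _) => eapply findim_prod : typeclass_instances.

(** * Symmetry of second derivatives *)

Section Schwarz.
Context {R : realType}.
Implicit Types V W : normedModType R.

Lemma MVT0 (f df : R -> R) (h : R) : 0 < h ->
  (forall s, 0 <= s <= h -> is_derive (s : R^o) (1 : R^o) (f : R^o -> R^o) (df s)) ->
  exists2 s, 0 <= s <= h & f h - f 0 = df s * h.
Proof.
move=> h0 H.
have [||s] := @MVT_segment R f df 0 h (ltW h0).
- by move=> x; rewrite in_itv /= => /andP[/ltW x0 /ltW xh]; apply: H; rewrite x0.
- apply: derivable_within_continuous => x; rewrite in_itv /= => x01.
  by have [] := H x x01.
by rewrite in_itv /= subr0 => s01 E; exists s.
Qed.

(** Two applications of the mean value theorem, in direction v and then w, make the second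
    difference over the parallelogram with sides h v and h w equal to h^2 times a second derivative
    at one of its points; continuity of that derivative at [x] bounds the error. *)
Lemma schwarz_quotient V (f : V -> R^o) (U : set V) x v w : open U -> U x ->
  Ck 2 U f -> forall e : R, 0 < e -> exists2 d : R, 0 < d & forall h, 0 < h < d ->
  `|(f (x + h *: v + h *: w) - f (x + h *: v)) - (f (x + h *: w) - f x)
    - 'd (fun y => 'd f y v) x w * h * h| <= e * h * h.
Proof.
move=> oU Ux [df /(_ v)[ddf /(_ w) cA]] e e0.
pose A y := 'd (fun y => 'd f y v) y w.
have /cvgrPdist_le/(_ e e0) nA := cA x Ux.
have nU : nbhs x U by exact: open_nbhs_nbhs.
have /nbhs_ballP[r /= r0 Hr] : \forall y \near x, `|A x - A y| <= e /\ U y.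
  by near=> y; split; near: y; [exact: nA|exact: nU].
(* The summand 1 keeps [k] positive when v and w vanish. *)
pose k := `|v| + `|w| + 1.
have k0 : 0 < k by rewrite ltr_wpDl // addr_ge0.
exists (r / k); first exact: divr_gt0.
move=> h /andP[h0 hd].
have B s t : 0 <= s <= h -> 0 <= t <= h ->
    `|A x - A (x + s *: v + t *: w)| <= e /\ U (x + s *: v + t *: w).
  move=> /andP[s0 sh] /andP[t0 th]; apply: Hr; rewrite -ball_normE /ball_ /=.
  rewrite -addrA opprD addNKr normrN.
  apply: (le_lt_trans (ler_normD _ _)); rewrite !normrZ !ger0_norm //.
  apply: (@le_lt_trans _ _ (h * (`|v| + `|w|))).
    by rewrite mulrDr lerD // ler_wpM2r.
  apply: (@le_lt_trans _ _ (h * k)); first by rewrite ler_wpM2l ?(ltW h0) // lerDl.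
  by rewrite -ltr_pdivlMr.
have h00 : 0 <= h <= h by rewrite lexx ltW.
have z0 : (0 : R) <= 0 <= h by rewrite lexx ltW.
have [s s0h Es] : exists2 s, 0 <= s <= h &
   (f (x + h *: v + h *: w) - f (x + h *: v)) - (f (x + h *: w) - f x) =
   ('d f (x + s *: v + h *: w) v - 'd f (x + s *: v) v) * h.
  have [|s s0 E] := @MVT0 (fun s => f (x + h *: w + s *: v) - f (x + s *: v))
    (fun s => 'd f (x + h *: w + s *: v) v - 'd f (x + s *: v) v) h h0.
    move=> s sh; apply: is_deriveB; apply: line_derive; apply: df.
      by rewrite addrAC; have [] := B s h sh h00.
    by have [_] := B s 0 sh z0; rewrite scale0r addr0.
  exists s => //; move: E.
  by rewrite scale0r !addr0 ![x + h *: w + _]addrAC.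
have [t t0h Et] := @MVT0 (fun t => 'd f (x + s *: v + t *: w) v)
  (fun t => A (x + s *: v + t *: w)) h h0 (fun t th =>
    line_derive (ddf _ (B s t s0h th).2)).
move: Et; rewrite scale0r addr0 => Et.
rewrite Es Et -!mulrBl !normrM (gtr0_norm h0) -!mulrA.
by rewrite ler_wpM2r ?mulr_ge0 ?(ltW h0) // distrC (B _ _ _ _).1.
Unshelve. all: by end_near. Qed.

(** The second difference is unchanged when v and w are exchanged, so both mixed derivatives are
    within [e / 2] of its quotient by h^2, for every [e]. *)
Lemma schwarz V (f : V -> R^o) (U : set V) x v w : open U -> U x -> Ck 2 U f ->
  'd (fun y => 'd f y v) x w = 'd (fun y => 'd f y w) x v.
Proof.
move=> oU Ux cf; apply/eqP; rewrite -subr_eq0 -normr_le0; apply/ler_addgt0Pl => e e0.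
have e2 : 0 < e / 2 by rewrite divr_gt0.
have [d1 d10 H1] := schwarz_quotient v w oU Ux cf e2.
have [d2 d20 H2] := schwarz_quotient w v oU Ux cf e2.
pose h := Num.min d1 d2 / 2.
have m0 : 0 < Num.min d1 d2 by rewrite lt_min d10.
have h0 : 0 < h by rewrite divr_gt0.
have hm : h < Num.min d1 d2 by rewrite /h ltr_pdivrMr // ltr_pMr // ltr1n.
move: (hm); rewrite lt_min => /andP[hd1 hd2].
have := H1 h; rewrite h0 hd1 => /(_ isT) K1.
have := H2 h; rewrite h0 hd2 => /(_ isT) K2.
have hh : 0 < h * h by exact: mulr_gt0.
rewrite addr0 -(ler_pM2r hh) -[X in _ * X <= _](gtr0_norm hh) -normrM.
move: K1 K2; rewrite [x + h *: w + h *: v]addrAC !ler_norml.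
by move=> /andP[K1 K1'] /andP[K2 K2']; apply/andP; split; lra.
Qed.

End Schwarz.

(** * Integrals over [0, 1] with a parameter *)

Section ParametricIntegral.
Context {R : realType}.
Implicit Types V : normedModType R.

Definition int01 (f : R -> R) : R := \int[@lebesgue_measure R]_(t in `[0, 1]) f t.

Definition cont01 (f : R -> R) : Prop :=
  forall t : R, 0 <= t <= 1 -> {for t, continuous (f : R^o -> R^o)}.

Lemma cont01_integrable f : cont01 f ->
  (@lebesgue_measure R).-integrable `[0, 1] (EFin \o f).
Proof.
move=> cf; apply: continuous_compact_integrable; first exact: segment_compact.
by apply: continuous_in_subspaceT => t; rewrite inE /= in_itv /= => /cf.
Qed.

Lemma cont01B f g : cont01 f -> cont01 g -> cont01 (fun t => f t - g t).
Proof.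
move=> cf cg t t01.
by apply: (@continuousB _ _ _ (f : R^o -> R^o) g); [exact: cf|exact: cg].
Qed.

Lemma eq_int01 f g : (forall t, 0 <= t <= 1 -> f t = g t) -> int01 f = int01 g.
Proof. by move=> H; apply: eq_Rintegral => t; rewrite inE /= in_itv /= => /H. Qed.

Lemma int01_lin a f g : cont01 f -> cont01 g ->
  int01 (fun t => a * f t + g t) = a * int01 f + int01 g.
Proof.
move=> cf cg; rewrite /int01 RintegralD //=; last 2 first.
- apply: (@cont01_integrable (fun t => a * f t)) => t t01.
  by apply: continuousM; [exact: cst_continuous|exact: cf].
- exact: cont01_integrable.
by rewrite RintegralZl //; exact: cont01_integrable.
Qed.

Lemma int01N f : cont01 f -> int01 (fun t => - f t) = - int01 f.
Proof.
move=> cf; have c0 : cont01 (fun=> 0) by move=> t _; exact: cst_continuous.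
have i0 : int01 (fun=> 0) = 0 by rewrite /int01 Rintegral_cst // mul0r.
transitivity (int01 (fun t => -1 * f t + (fun=> 0) t)); last first.
  by rewrite int01_lin // i0 addr0 mulN1r.
by apply: eq_int01 => t _; rewrite mulN1r addr0.
Qed.

Lemma int01B f g : cont01 f -> cont01 g ->
  int01 (fun t => f t - g t) = int01 f - int01 g.
Proof.
by move=> cf cg; rewrite /int01 RintegralB //; exact: cont01_integrable.
Qed.

Lemma int01_le f e : cont01 f -> (forall t, 0 <= t <= 1 -> `|f t| <= e) ->
  `|int01 f| <= e.
Proof.
move=> cf H; have If := cont01_integrable cf.
apply: (le_trans (le_normr_Rintegral _ If)) => //.
have ce : cont01 (fun=> e) by move=> t _; exact: cst_continuous.
apply: (@le_trans _ _ (int01 (fun=> e))).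
  apply: le_Rintegral => //.
  - exact: integrable_norm.
  - exact: cont01_integrable.
rewrite /int01 Rintegral_cst //= lebesgue_measure_itv /= lte_fin ltr01 oppr0 adde0.
by rewrite mulr1.
Qed.

(** The tube lemma: as [0, 1] is compact, finitely many neighborhoods of points (t, q) cover a whole
    tube around the slice at q. *)
Lemma near_01 V (q : V) (P : R -> V -> Prop) :
  (forall t, 0 <= t <= 1 -> \forall z \near ((t, q) : R^o * V), P z.1 z.2) ->
  \forall q' \near q, forall t, 0 <= t <= 1 -> P t q'.
Proof.
move=> H.
have /compact_near_coveringP/(_ V (nbhs q) (fun q' t => P t q') _) := @segment_compact R 0 1.
move=> K; have /K : forall x, [set` `[(0:R), 1]] x -> \forall x' \near x & i \near nbhs q, P x' i.
  move=> t; rewrite /= in_itv /= => /H [[A B] /= [nA nB] AB].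
  by exists (A, B) => // z /AB.
by apply: filterS => q' h t t01; apply: h; rewrite /= in_itv.
Qed.

Lemma cont01_slice V (h : R^o * V -> R^o) (q : V) :
  (forall t, 0 <= t <= 1 -> {for (t, q), continuous h}) -> cont01 (fun t => h (t, q)).
Proof.
move=> Hq t t01; apply: (@continuous_comp _ _ _ (fun t : R^o => (t, q)) h).
  exact: (cvg_pair (@cvg_id _ (nbhs (t : R^o))) (cvg_cst q)).
exact: Hq.
Qed.

Lemma uniform_01 V (h : R^o * V -> R^o) (q : V) (e : R) :
  (forall t, 0 <= t <= 1 -> {for (t, q), continuous h}) -> 0 < e ->
  \forall q' \near q, forall t, 0 <= t <= 1 -> `|h (t, q) - h (t, q')| <= e.
Proof.
move=> cq e0.
apply: (@near_01 _ q (fun t q' => `|h (t, q) - h (t, q')| <= e)) => t t01.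
have e2 : 0 < e / 2 by rewrite divr_gt0.
have /cvgrPdist_le/(_ _ e2) N := cq t t01.
have N' : \forall z \near ((t, q) : R^o * V), `|h (t, q) - h (z.1, q)| <= e / 2.
  have /cvgrPdist_le/(_ _ e2) M := cont01_slice cq t01.
  exists ([set a | `|h (t, q) - h (a, q)| <= e / 2], setT); last by move=> z [].
  by split=> //=; exact: filterT.
move: N N'; apply: filterS2 => -[a b] /= N N'.
rewrite (splitr e) -(subrKA (h (t, q))) (le_trans (ler_normD _ _)) // lerD //.
by rewrite distrC.
Qed.

Lemma int01_continuous V (h : R^o * V -> R^o) (q : V) :
  (\forall q' \near q, forall t, 0 <= t <= 1 -> {for (t, q'), continuous h}) ->
  {for q, continuous (fun q => int01 (fun t => h (t, q)) : R^o)}.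
Proof.
move=> H; apply/cvgrPdist_le => e e0; have cq := nbhs_singleton H.
have := uniform_01 cq e0; apply: filterS2 H => q' cq' nh.
rewrite -int01B; [|exact: cont01_slice..].
apply: int01_le => // t t01; apply: (@continuousB _ _ _ (fun t : R^o => h (t, q) : R^o)).
  exact: (cont01_slice cq).
exact: (cont01_slice cq').
Qed.

Lemma fd_coord_bound V {FV : findim V} :
  exists2 K : R, 0 < K & forall i (v : V), `|fd_coord i v| <= K * `|v|.
Proof.
have /fin_all_exists[K HK] i : exists k, 0 < k /\ forall v : V, `|fd_coord i v| <= k * `|v|.
  have [k k0 Hk] := @linear_lipschitz _ _ _ (fd_linear i) (fd_coord_cts i).
  by exists k; split.
exists (1 + \sum_i K i) => [|i v].
  by rewrite ltr_pwDl // sumr_ge0 // => i _; rewrite ltW // (HK i).1.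
apply: (le_trans ((HK i).2 v)); rewrite ler_wpM2r // (bigD1 i) //= addrCA lerDl.
by rewrite addr_ge0 // sumr_ge0 // => j _; rewrite ltW // (HK j).1.
Qed.

Lemma fd_bound V {FV : findim V} (F G : V -> R) (K e : R) v :
  (forall v, F v = \sum_i fd_coord i v * F (fd_basis i)) ->
  (forall v, G v = \sum_i fd_coord i v * G (fd_basis i)) ->
  0 <= e -> 0 <= K -> (forall i, `|fd_coord i v| <= K * `|v|) ->
  (forall i, `|F (fd_basis i) - G (fd_basis i)| <= e) ->
  `|F v - G v| <= K * e * `|v| * (fd_dim FV).+1%:R.
Proof.
move=> FE GE e0 K0 HK H; rewrite FE GE -sumrB (le_trans (ler_norm_sum _ _ _)) //.
apply: (@le_trans _ _ (\sum_(i < fd_dim FV) K * `|v| * e)).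
  by apply: ler_sum => i _; rewrite -mulrBr normrM ler_pM.
rewrite sumr_const card_ord -[leLHS]mulr_natr [K * _ * e]mulrAC.
by rewrite ler_wpM2l ?ler_nat // !mulr_ge0.
Qed.

(** For each t the mean value theorem on the segment from q to q + v bounds the remainder by a
    variation of the partial derivative, which is small uniformly in t by compactness; integration
    over [0, 1] preserves the bound. *)
Lemma int01_diff V {FV : findim V} (D : set (R^o * V)%type) (W : set V) (h : R^o * V -> R^o) :
  open D -> open W -> (forall t q, 0 <= t <= 1 -> W q -> D (t, q)) -> Ck 1 D h ->
  forall q, W q ->
  differentiable (fun q => int01 (fun t => h (t, q)) : R^o) q /\
  forall v, 'd (fun q => int01 (fun t => h (t, q)) : R^o) q v =
    int01 (fun t => 'd h (t, q) (0, v)).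
Proof.
move=> oD oW sub [dh ch] q Wq.
have ct (g : R^o * V -> R^o) q' : (forall z, D z -> {for z, continuous g}) -> W q' ->
    cont01 (fun t => g (t, q')).
  by move=> H Wq'; apply: cont01_slice => t t01; apply/H/sub.
have hc z : D z -> {for z, continuous h} by move=> /dh/differentiable_continuous.
have cd u q' : W q' -> cont01 (fun t => 'd h (t, q') (0, u)).
  by move=> Wq'; apply: (ct (fun z => 'd h z (0, u))) => // z Dz; exact: ch.
pose df0 v : R^o := int01 (fun t => 'd h (t, q) (0, v)).
have dfl : linear df0.
  move=> a u v; rewrite /df0 -[LHS]/(int01 _) -[RHS]/(a * _ + _) -int01_lin;
    [|exact: cd..].
  apply: eq_int01 => t _.
  have -> : (0, a *: u + v) = a *: ((0, u) : R^o * V) + (0, v).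
    by congr pair; rewrite /= scaler0 addr0.
  by rewrite linearP.
pose df : {linear V -> R^o} := HB.pack df0 (GRing.isLinear.Build R V R^o *:%R df0 dfl).
have [||] := @diff_eps R V R^o (fun q => int01 (fun t => h (t, q)) : R^o) q df; last first.
- by move=> d /(congr1 (@^~ _)) E; split=> // v; rewrite (E v).
- move=> e e0; have [K K0 HK] := @fd_coord_bound V FV.
  (* [K] bounds the coordinate functions and the dimension counts the terms; the successor keeps the
     divisor nonzero in dimension 0. *)
  pose n := fd_dim FV; pose e' := e / (K * n.+1%:R).
  have e'0 : 0 < e' by rewrite divr_gt0 // mulr_gt0.
  have N i : \forall q' \near q, forall t : R, 0 <= t <= 1 ->
      `|'d h (t, q) (0, fd_basis i) - 'd h (t, q') (0, fd_basis i)| <= e'.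
    apply: (@uniform_01 V (fun z => 'd h z (0, fd_basis i))) => // t t01.
    exact/ch/sub.
  have NW : \forall q' \near q, W q' by exact: open_nbhs_nbhs.
  have /nbhs_ballP[r /= r0 Hr] : \forall q' \near q, (forall i (t : R), 0 <= t <= 1 ->
      `|'d h (t, q) (0, fd_basis i) - 'd h (t, q') (0, fd_basis i)| <= e') /\ W q'.
    by apply: filterI => //; apply: filter_forall.
  apply/nbhs_ballP; exists r => //= v; rewrite -ball_normE /ball_ /= sub0r normrN => vr.
  have B s : 0 <= s <= 1 -> ball q r (q + s *: v).
    move=> /andP[s0 s1]; rewrite -ball_normE /ball_ /= opprD addNKr normrN normrZ.
    by rewrite ger0_norm // (le_lt_trans _ vr) // ler_piMl.
  have Wv : W (v + q).
    by have := B 1; rewrite lexx ler01 scale1r addrC => /(_ isT)/Hr[].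
  have c1 : cont01 (fun t => h (t, v + q)) by exact: ct.
  have c2 : cont01 (fun t => h (t, q)) by exact: ct.
  rewrite -(int01B c1 c2) -(int01B (cont01B c1 c2) (cd v q Wq)).
  apply: int01_le => [|t t01]; first exact: (cont01B (cont01B c1 c2) (cd v q Wq)).
  have pE s : (t, q) + s *: ((0, v) : R^o * V) = (t, q + s *: v).
    by congr pair; rewrite /= scaler0 addr0.
  have [s s01] := @MVT0 R (fun s => h ((t, q) + s *: (0, v)))
    (fun s => 'd h ((t, q) + s *: (0, v)) (0, v)) 1 ltr01 (fun s s01 =>
      line_derive (dh _ (eq_ind_r D (sub _ _ t01 (Hr _ (B _ s01)).2) (pE s)))).
  rewrite !pE scale1r scale0r addr0 mulr1 [v + q]addrC => ->.
  have vE u : ((0, u) : R^o * V) = \sum_i fd_coord i u *: (0, fd_basis i).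
    rewrite {1}(fd_span u).
    by elim/big_rec2: _ => // i y1 y2 _ <-; congr pair; rewrite /= scaler0 addr0.
  have dE z u : 'd h z (0, u) = \sum_i fd_coord i u * 'd h z (0, fd_basis i).
    rewrite [in LHS]vE linear_sum; apply: eq_bigr => i _.
    by rewrite linearZ_LR.
  have -> : e * `|v| = K * e' * `|v| * n.+1%:R.
    have -> : e = e' * (K * n.+1%:R) by rewrite divfK // gt_eqF // mulr_gt0.
    by move: (e') => a; ring.
  apply: (fd_bound (F := fun u => 'd h (t, q + s *: v) (0, u))
    (G := fun u => 'd h (t, q) (0, u)) (dE _) (dE _) (ltW e'0) (ltW K0) (HK^~ v)) => i.
  by rewrite distrC; exact: (Hr _ (B _ s01)).1.
- exact: fd_lin_continuous.
Qed.

(** The derivative along v is the integral of the derivative of h along (0, v), again an integral of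
    this kind; hence the induction on k. *)
Lemma int01_Ck V {FV : findim V} k (D : set (R^o * V)%type) (W : set V) (h : R^o * V -> R^o) :
  open D -> open W -> (forall t q, 0 <= t <= 1 -> W q -> D (t, q)) -> Ck k D h ->
  Ck k W (fun q => int01 (fun t => h (t, q)) : R^o).
Proof.
move=> oD oW sub; elim: k h => [|k IH] h.
  move=> ch q Wq; apply: int01_continuous; near=> q' => t t01; apply/ch/sub => //.
  by near: q'; exact: open_nbhs_nbhs.
move=> ck; have c1 : Ck 1 D h.
  by elim: k {IH} ck => // k IH /CkW.
have Id := int01_diff oD oW sub c1; case: ck => dh ch.
split=> [q /Id[]//|v].
apply: (eq_Ck (f := fun q => int01 (fun t => 'd h (t, q) (0, v)) : R^o)) => //.
  by move=> q /Id[_ /(_ v)].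
exact: (IH (fun z => 'd h z (0, v)) (ch (0, v))).
Unshelve. all: by end_near. Qed.

End ParametricIntegral.

(** * Charts, tangent vectors and tangent maps *)

(* The part of [is_manifold] used below, stable under products and bundles. *)
Class charted {R : realType} {V : normedModType R} (A : atlas V) : Prop := Charted {
  ch_dom : forall x : A, dom x x;
  ch_param : forall x y : A, dom x y -> param x (coord x y) = y;
  ch_trans : forall x y : A, open (coord x @` (dom x `&` dom y)) /\
    smooth (coord x @` (dom x `&` dom y)) (transition x y) }.

Section OpenPreimages.
Context {R : realType}.

Lemma open_preimage {T T' : topologicalType} (O : set T) (g : T -> T') (N : set T') :
  open O -> (forall q, O q -> {for q, continuous g}) -> open N ->
  open (O `&` g @^-1` N).
Proof.
move=> oO cg oN; rewrite openE => q [Oq Nq].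
apply: filterI; first exact: open_nbhs_nbhs.
exact: (cg q Oq _ (open_nbhs_nbhs (conj oN Nq))).
Qed.

Lemma is_derive_comp {V W : normedModType R} (F : V -> W) (c : R -> V) (t : R) w :
  is_derive (t : R^o) (1 : R^o) (c : R^o -> V) w -> differentiable F (c t) ->
  is_derive (t : R^o) (1 : R^o) (fun s : R^o => F (c s)) ('d F (c t) w).
Proof.
move=> [dc <-] dF.
have dc' : differentiable (c : R^o -> V) t by apply/derivable1_diffP.
have dFc := @differentiable_comp _ _ _ _ (c : R^o -> V) F t dc' dF.
apply: DeriveDef; first exact: diff_derivable.
rewrite deriveE // -[LHS]/('d (F \o (c : R^o -> V)) t 1) diff_comp //=.
by rewrite deriveE.
Qed.

Lemma is_derive_continuous {V : normedModType R} (c : R -> V) (t : R) w :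
  is_derive (t : R^o) (1 : R^o) (c : R^o -> V) w -> {for t, continuous (c : R^o -> V)}.
Proof. by case=> /derivable1_diffP/differentiable_continuous. Qed.

End OpenPreimages.

Section Charts.
Context {R : realType}.

Section One.
Context {V : normedModType R} {A : atlas V} {CA : charted A}.
Implicit Types x y z : A.

Lemma ch_open x : open (coord x @` dom x).
Proof. by have [+ _] := ch_trans x x; rewrite setIid. Qed.

Lemma coordK x q : (coord x @` dom x) q -> dom x (param x q) /\ coord x (param x q) = q.
Proof. by move=> [y xy <-]; rewrite ch_param. Qed.

Lemma coord_inj x y z : dom x y -> dom x z -> coord x y = coord x z -> y = z.
Proof. by move=> xy xz E; rewrite -(ch_param xy) E ch_param. Qed.

Lemma mopen_chart x (O : set V) : open O -> mopen [set y : A | dom x y /\ O (coord x y)].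
Proof.
move=> oO z; have [oz sz] := ch_trans z x.
have := open_preimage oz (fun q => smooth_continuous sz) oO.
congr open; apply/seteqP; split=> [q [[y [zy xy] <-]]|q [y [[xy Oy] zy] <-]].
  by rewrite /= /transition /= ch_param // => Oy; exists y.
split; first by exists y.
by rewrite /= /transition /= ch_param.
Qed.

Lemma mopen_dom x : mopen (dom x).
Proof.
have := mopen_chart x openT; congr mopen.
by apply/seteqP; split=> [y []|y].
Qed.

Lemma mopenI (U U' : set A) : mopen U -> mopen U' -> mopen (U `&` U').
Proof.
move=> oU oU' x; have := openI (oU x) (oU' x); congr open.
apply/seteqP; split=> [q [[y [Uy xy] <-] [z [Uz xz]]] E|q [y [[Uy U'y] xy] <-]].
  by exists y => //; split=> //; split=> //; rewrite -(coord_inj xz xy E).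
by split; exists y.
Qed.

Lemma mopen_bigcup (I : Type) (P : set I) (U : I -> set A) :
  (forall i, P i -> mopen (U i)) -> mopen (\bigcup_(i in P) U i).
Proof.
move=> oU x; rewrite (_ : coord x @` _ = \bigcup_(i in P) (coord x @` (U i `&` dom x))).
  by apply: bigcup_open => i Pi; exact: oU.
apply/seteqP; split=> [q [y [[i Pi Uy] xy] <-]|q [i Pi [y [Uy xy] <-]]].
  by exists i => //; exists y.
by exists y => //; split=> //; exists i.
Qed.

Lemma mopen_nbhs (U : set A) x y : mopen U -> U x -> dom y x ->
  nbhs (coord y x) (coord y @` (U `&` dom y)).
Proof. by move=> oU Ux yx; apply: open_nbhs_nbhs; split; [exact: oU|exists x]. Qed.

End One.

Lemma flat_charted (V : normedModType R) {FV : findim V} : charted (flat V).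
Proof.
split=> // x y; have -> : coord x @` (dom x `&` dom y) = setT :> set V.
  by apply/seteqP; split=> // q _; exists q.
split; first exact: openT.
exact: (@smooth_linear R V V FV setT idfun).
Qed.

Lemma mopen_flat (V : normedModType R) (U : set V) : @mopen R V (flat V) U <-> open U.
Proof.
have E : id @` (U `&` setT) = U by rewrite setIT image_id.
by split=> [/(_ 0)|oU x]; rewrite /= E.
Qed.

End Charts.
#[export] Hint Extern 0 (charted (flat _)) => eapply flat_charted : typeclass_instances.

(** * Smooth maps in charts *)

Section SmoothAt.
Context {R : realType}.

Section Two.
Context {V W : normedModType R} {A : atlas V} {B : atlas W}.
Context {FV : findim V} {FW : findim W} {CA : charted A} {CB : charted B}.
Implicit Types (x : A) (f g : A -> B).

(* [smooth_at] uses the charts chosen at [x] and [f x]; here they are arbitrary. *)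
Definition smooth_rep (x0 : A) (y0 : B) f x : Prop := exists O : set V,
  [/\ open O, O (coord x0 x), O `<=` coord x0 @` dom x0,
      forall q, O q -> dom y0 (f (param x0 q))
    & smooth O (fun q => coord y0 (f (param x0 q)))].

(** Both transition maps are composed with the representative, so the domain shrinks twice: to [O1],
    which the source transition sends into [O], and to [O2], where the value lies in both target
    charts. *)
Lemma smooth_rep_change x0 x1 (y0 y1 : B) f x : smooth_rep x0 y0 f x ->
  dom x0 x -> dom x1 x -> dom y0 (f x) -> dom y1 (f x) -> smooth_rep x1 y1 f x.
Proof.
move=> [] O [oO Ox OD Of sO] x0x x1x y0x y1x.
have [c1 c1'] := ch_trans x1 x0.
have [c2 c2'] := ch_trans y0 y1.
pose O1 := coord x1 @` (dom x1 `&` dom x0) `&` transition x1 x0 @^-1` O.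
have oO1 : open O1 by apply: open_preimage => // q; exact: smooth_continuous.
have sr : smooth O1 (fun q => coord y0 (f (param x0 (transition x1 x0 q)))).
  have s1' : smooth O1 (transition x1 x0) by apply: smooth_subset c1' => q [].
  by apply: (smooth_comp (g := fun q => coord y0 (f (param x0 q))) oO1 _ s1' sO) => q [].
pose O2 := O1 `&` (fun q => coord y0 (f (param x0 (transition x1 x0 q)))) @^-1`
  (coord y0 @` (dom y0 `&` dom y1)).
have oO2 : open O2 by apply: open_preimage => // q; exact: smooth_continuous.
have tE q : (coord x1 @` (dom x1 `&` dom x0)) q ->
    dom x1 (param x1 q) /\ param x0 (transition x1 x0 q) = param x1 q.
  by move=> [y [x1y x0y] <-]; rewrite /transition /= ch_param // ch_param.
have O2E q : O2 q -> dom y0 (f (param x1 q)) /\ dom y1 (f (param x1 q)).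
  move=> [[/tE[_ E] Oq] [z [y0z y1z]]] /=; rewrite E => Ez.
  have D := Of _ Oq; rewrite E in D; split=> //.
  by rewrite -(coord_inj y0z D Ez).
exists O2; split=> //.
- have I : (coord x1 @` (dom x1 `&` dom x0)) (coord x1 x) by exists x.
  have T : transition x1 x0 (coord x1 x) = coord x0 x by rewrite /transition /= ch_param.
  split; first by split=> //; rewrite /preimage /= T.
  by rewrite /preimage /= T ch_param //; exists (f x).
- by move=> q [[[y [x1y _] <-] _] _]; exists y.
- by move=> q /O2E[].
have sr' : smooth O2 (fun q => coord y0 (f (param x0 (transition x1 x0 q)))).
  by apply: smooth_subset sr => q [].
apply: (eq_smooth oO2 _ (smooth_comp (g := transition y0 y1) oO2 _ sr' c2')); last by move=> q [].
move=> q O2q; have [d0 d1] := O2E q O2q; case: O2q => -[/tE[_ E] _] _.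
by rewrite E /transition /= ch_param.
Qed.

Lemma smooth_at_rep x0 (y0 : B) f x : smooth_at f x -> dom x0 x -> dom y0 (f x) ->
  smooth_rep x0 y0 f x.
Proof. by move=> S D D'; apply: (smooth_rep_change S) => //; exact: ch_dom. Qed.

Lemma rep_smooth_at x0 (y0 : B) f x : smooth_rep x0 y0 f x -> dom x0 x -> dom y0 (f x) ->
  smooth_at f x.
Proof. by move=> S D D'; apply: (smooth_rep_change S) => //; exact: ch_dom. Qed.

Lemma smooth_at_continuous f x (N : set B) : smooth_at f x -> mopen N -> N (f x) ->
  exists U : set A, [/\ mopen U, U x & forall y, U y -> N (f y)].
Proof.
move=> [] O [oO Ox OD Of sO] oN Nx.
have oO' := open_preimage oO (fun q => smooth_continuous sO) (oN (f x)).
exists [set y | dom x y /\ (O `&` (fun q => coord (f x) (f (param x q))) @^-1`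
   (coord (f x) @` (N `&` dom (f x)))) (coord x y)]; split.
- exact: mopen_chart.
- split; [exact: ch_dom|split=> //]; rewrite /preimage /= ch_param; last exact: ch_dom.
  by exists (f x) => //; split=> //; exact: ch_dom.
move=> y [xy [Oy [z [Nz xz]]]]; rewrite /= ch_param // => E.
have D := Of _ Oy; rewrite ch_param // in D.
by rewrite -(coord_inj xz D E).
Qed.

Lemma smooth_at_ext (U : set A) f g x : mopen U -> U x -> (forall y, U y -> f y = g y) ->
  smooth_at g x -> smooth_at f x.
Proof.
move=> oU Ux fg; rewrite /smooth_at (fg _ Ux) => -[] O [oO Ox OD Of sO].
have oO' := openI oO (oU x).
have E q : (O `&` coord x @` (U `&` dom x)) q -> f (param x q) = g (param x q).
  by move=> [_ [y [Uy xy] <-]]; rewrite ch_param // fg.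
exists (O `&` coord x @` (U `&` dom x)); split=> //.
- by split=> //; exists x => //; split=> //; exact: ch_dom.
- by move=> q [Oq _]; exact: OD.
- by move=> q Oq; rewrite E //; apply: Of; case: Oq.
apply: eq_smooth oO' _ (smooth_subset _ sO) => [q /E ->|q []] //.
Qed.

Lemma smooth_map_at (S : set A) f x : mopen S -> smooth_map S f -> S x -> smooth_at f x.
Proof.
move=> oS sf Sx; have [U [g [oU Ux sg fg]]] := sf x Sx.
by apply: (smooth_at_ext (mopenI oU oS)) sg.
Qed.

Lemma smooth_at_map (S : set A) f : (forall x, S x -> smooth_at f x) -> smooth_map S f.
Proof.
move=> H x /H sf; exists (dom x), f; split=> //; [exact: mopen_dom|exact: ch_dom].
Qed.

Lemma smooth_map_sub (S S' : set A) f : S' `<=` S -> smooth_map S f -> smooth_map S' f.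
Proof.
move=> SS' sf x /SS'/sf[U [g [oU Ux sg fg]]]; exists U, g; split=> // y [Uy /SS' Sy].
exact: fg.
Qed.

(** [f] has only local extensions, one near each point, so no single open preimage is at hand. The
    union of all open sets whose trace on [S] is sent into [N] has the right trace. *)
Lemma smooth_map_preimage (S : set A) f (N : set B) : smooth_map S f -> mopen N ->
  exists U : set A, mopen U /\ forall x, S x -> (U x <-> N (f x)).
Proof.
move=> sf oN.
exists (\bigcup_(U in [set U : set A | mopen U /\ forall y, S y -> U y -> N (f y)]) U).
split; first by apply: mopen_bigcup => U [].
move=> x Sx; split=> [[U [_ +] Ux]|Nx]; first exact.
have [U [g [oU Ux sg fg]]] := sf x Sx.
have [U' [oU' U'x gN]] : exists U : set A, [/\ mopen U, U x & forall y, U y -> N (g y)].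
  by apply: smooth_at_continuous => //; rewrite -fg.
exists (U `&` U') => //; split; first exact: mopenI.
by move=> y Sy [Uy U'y]; rewrite fg //; exact: gN.
Qed.

End Two.
End SmoothAt.

Section Composition.
Context {R : realType} {V W Z : normedModType R} {A : atlas V} {B : atlas W} {C : atlas Z}.
Context {FV : findim V} {FW : findim W} {FZ : findim Z}.
Context {CA : charted A} {CB : charted B} {CC : charted C}.

Lemma smooth_at_comp (f : A -> B) (g : B -> C) x :
  smooth_at f x -> smooth_at g (f x) -> smooth_at (g \o f) x.
Proof.
move=> [] O [oO Ox OD Of sO] [] N [oN Nx ND Nf sN].
have oO' := open_preimage oO (fun q => smooth_continuous sO) oN.
have E q : O q -> param (f x) (coord (f x) (f (param x q))) = f (param x q).
  by move=> Oq; rewrite ch_param //; exact: Of.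
exists (O `&` (fun q => coord (f x) (f (param x q))) @^-1` N); split=> //.
- by split=> //; rewrite /preimage /= ch_param //; exact: ch_dom.
- by move=> q [/OD].
- by move=> q [Oq Nq] /=; rewrite -(E q Oq); exact: Nf.
apply: (eq_smooth oO' _ (smooth_comp (f := fun q => coord (f x) (f (param x q)))
  (g := fun q => coord (g (f x)) (g (param (f x) q))) oO' _ _ sN)).
- by move=> q [Oq _]; rewrite E.
- by move=> q [].
by apply: smooth_subset sO => q [].
Qed.

Lemma smooth_map_comp (S : set A) (S' : set B) (f : A -> B) (g : B -> C) :
  smooth_map S f -> smooth_map S' g -> (forall x, S x -> S' (f x)) ->
  smooth_map S (g \o f).
Proof.
move=> sf sg SS' x Sx.
have [U [f' [oU Ux sf' ff']]] := sf x Sx.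
have [N [g' [oN Nx sg' gg']]] := sg (f x) (SS' _ Sx).
have E : f x = f' x by exact: ff'.
rewrite E in sg' Nx.
have [U' [oU' U'x UN]] := smooth_at_continuous sf' oN Nx.
exists (U `&` U'), (g' \o f'); split=> //; first exact: mopenI.
  exact: smooth_at_comp.
move=> y [[Uy U'y] Sy] /=; have Ey : f y = f' y by exact: ff'.
by rewrite gg' ?Ey //; split; [exact: UN|rewrite -Ey; exact: SS'].
Qed.

Lemma smooth_at_pair (f : A -> B) (g : A -> C) x :
  smooth_at f x -> smooth_at g x ->
  @smooth_at R V (W * Z)%type A (prod_atlas B C) (fun y => (f y, g y)) x.
Proof.
move=> [] O [oO Ox OD Of sO] [] N [oN Nx ND Nf sN].
exists (O `&` N); split=> //.
- exact: openI.
- by move=> q [/OD].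
- by move=> q [Oq Nq]; split; [exact: Of|exact: Nf].
apply: (smooth_pair (f := fun q => coord (f x) (f (param x q)))) => //.
- exact: openI.
- by apply: smooth_subset sO => q [].
by apply: smooth_subset sN => q [].
Qed.

Lemma prod_charted : @charted R (W * Z)%type (prod_atlas B C).
Proof.
split=> [x|x y [d1 d2]|x y].
- by split; exact: ch_dom.
- by rewrite /= !ch_param // -surjective_pairing.
have [a1 b1] := ch_trans x.1 y.1; have [a2 b2] := ch_trans x.2 y.2.
pose D1 := coord x.1 @` (dom x.1 `&` dom y.1).
pose D2 := coord x.2 @` (dom x.2 `&` dom y.2).
have DE : @coord _ _ (prod_atlas B C) x @` (dom x `&` dom y) =
    (fst @^-1` D1) `&` (snd @^-1` D2).
  apply/seteqP; split=> [q [z [[d1 d2] [d3 d4]] <-]|[q1 q2] [[z1 [d1 d3] e1] [z2 [d2 d4] e2]]].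
    by split; [exists z.1|exists z.2].
  by exists (z1, z2) => //; rewrite /= e1 e2.
have oD : open ((fst @^-1` D1) `&` (snd @^-1` D2) : set (W * Z)).
  apply: openI; apply: open_comp => // z _; [exact: cvg_fst|exact: cvg_snd].
rewrite DE; split=> //.
pose lf : {linear (W * Z)%type -> W} := HB.pack (fst : W * Z -> W)
  (GRing.isLinear.Build R (W * Z)%type W *:%R fst (fun _ _ _ => erefl)).
pose ls : {linear (W * Z)%type -> Z} := HB.pack (snd : W * Z -> Z)
  (GRing.isLinear.Build R (W * Z)%type Z *:%R snd (fun _ _ _ => erefl)).
apply: (smooth_pair (f := fun q => transition x.1 y.1 (lf q))
  (g := fun q => transition x.2 y.2 (ls q))) => //.
- by apply: smooth_comp b1 => // [q []//|]; exact: smooth_linear.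
- by apply: smooth_comp b2 => // [q []//|]; exact: smooth_linear.
Qed.

End Composition.
#[export] Hint Extern 1 (charted (prod_atlas _ _)) => eapply prod_charted : typeclass_instances.

(** * Velocities of curves *)

Section Velocity.
Context {R : realType}.

Definition mdiff {V W : normedModType R} {A : atlas V} {B : atlas W} (f : A -> B) x : V -> W :=
  'd (fun q => coord (f x) (f (param x q))) (coord x x).

Section OneVelocity.
Context {V : normedModType R} {A : atlas V} {FV : findim V} {CA : charted A}.
Implicit Types (g : R -> A) (t : R) (v w : V).

Lemma vel_unique g t v w : has_velocity g t v -> has_velocity g t w -> v = w.
Proof. by move=> [_ [_ <-]] [_ [_ <-]]. Qed.

Lemma vel_near g g' t v : (\forall s \near t, g s = g' s) ->
  has_velocity g t v -> has_velocity g' t v.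
Proof.
move=> gg' [nd [dv E]]; have gt := nbhs_singleton gg'.
split; rewrite -gt.
  by move: gg' nd; apply: filterS2 => s <-.
apply: (near_eq_is_derive (f := fun s : R^o => coord (g t) (g s))).
  by move: gg'; apply: filterS => s <-.
exact: DeriveDef.
Qed.

Lemma vel_chart y g t v : dom y (g t) -> has_velocity g t v ->
  (\forall s \near t, dom y (g s)) /\
  is_derive (t : R^o) (1 : R^o) (fun s : R^o => coord y (g s)) (move_vec (g t) y (g t) v).
Proof.
move=> yt [nd dv].
have I : (coord (g t) @` (dom (g t) `&` dom y)) (coord (g t) (g t)).
  by exists (g t) => //; split=> //; exact: ch_dom.
have [oD sD] := ch_trans (g t) y.
have nI : \forall s \near t, (coord (g t) @` (dom (g t) `&` dom y)) (coord (g t) (g s)).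
  exact: (is_derive_continuous dv (open_nbhs_nbhs (conj oD I))).
have N : \forall s \near t, dom y (g s) /\ transition (g t) y (coord (g t) (g s)) = coord y (g s).
  move: nd nI; apply: filterS2 => s ds [z [dz yz] E].
  by rewrite /transition /= ch_param // -(coord_inj dz ds E).
split; first by move: N; apply: filterS => s [].
have := is_derive_comp (F := transition (g t) y) dv (smooth_differentiable sD I).
apply: near_eq_is_derive; move: N; apply: filterS => s [].
by [].
Qed.

Lemma vel_mopen g t v (U : set A) : has_velocity g t v -> mopen U -> U (g t) ->
  \forall s \near t, U (g s).
Proof.
move=> [nd dv] oU Ut.
have nI : \forall s \near t, (coord (g t) @` (U `&` dom (g t))) (coord (g t) (g s)).
  exact: (is_derive_continuous dv (mopen_nbhs oU Ut (ch_dom (g t)))).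
move: nd nI; apply: filterS2 => s ds [y [Uy dy] E].
by rewrite -(coord_inj dy ds E).
Qed.

End OneVelocity.

Section TwoVelocity.
Context {V W : normedModType R} {A : atlas V} {B : atlas W}.
Context {FV : findim V} {FW : findim W} {CA : charted A} {CB : charted B}.

Lemma vel_comp (f : A -> B) (g : R -> A) t v : smooth_at f (g t) -> has_velocity g t v ->
  has_velocity (f \o g) t (mdiff f (g t) v).
Proof.
move=> sf vg; have [U [oU Ut Uf]] := smooth_at_continuous sf (mopen_dom (f (g t))) (ch_dom _).
have N : \forall s \near t, U (g s) by exact: (vel_mopen vg oU Ut).
split; first by move: N; apply: filterS => s /Uf.
case: vg sf => nd dv [] O [oO Ot OD Od sO].
have := is_derive_comp (F := fun q => coord (f (g t)) (f (param (g t) q))) dv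
  (smooth_differentiable sO Ot).
apply: near_eq_is_derive; move: nd; apply: filterS => s ds.
by rewrite ch_param.
Qed.

End TwoVelocity.
End Velocity.

(** * Tangent vectors and tangent maps of subsets *)

Section Tangent.
Context {R : realType}.

Section TangentMap.
Context {V W : normedModType R} {A : atlas V} {B : atlas W}.
Context {FV : findim V} {FW : findim W} {CA : charted A} {CB : charted B}.
Implicit Types (S : set A) (f : A -> B) (g : R -> A) (x : A) (v : V).

Lemma curve_at_near S x v g (U : set A) : curve_at S x v g -> mopen U -> U x ->
  \forall t \near (0 : R), U (g t) /\ S (g t).
Proof.
move=> [g0 gS _ vg] oU Ux; apply: filterI => //.
by apply: (vel_mopen vg) => //; rewrite g0.
Qed.

Lemma curve_at_vel S f x v g (U : set A) (f' : A -> B) : mopen U -> U x ->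
  (forall y, (U `&` S) y -> f y = f' y) -> smooth_at f' x ->
  curve_at S x v g -> has_velocity (f \o g) 0 (mdiff f' x v).
Proof.
move=> oU Ux ff' sf' cg.
have N : \forall t \near (0 : R), (f' \o g) t = (f \o g) t.
  by apply: filterS (curve_at_near cg oU Ux) => t /ff'.
apply: (vel_near N); case: cg => g0 _ _ vg.
by rewrite -{1}g0; apply: vel_comp => //; rewrite g0.
Qed.

(** This makes the choice in [Tmap] harmless: a local extension [f'] shows that every curve in [S]
    with velocity v is sent to a curve with velocity [mdiff f' x v], and velocities are unique. *)
Lemma TmapE S f x v (U : set A) (f' : A -> B) : mopen U -> U x ->
  (forall y, (U `&` S) y -> f y = f' y) -> smooth_at f' x -> tangent S x v ->
  Tmap S f x v = mdiff f' x v.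
Proof.
move=> oU Ux ff' sf' [g cg]; rewrite /Tmap.
case: xgetP => [w _ [h [ch vh]]|/(_ (mdiff f' x v))]; last first.
  by case; exists g; split=> //; exact: (curve_at_vel oU Ux ff' sf' cg).
exact: (vel_unique vh (curve_at_vel oU Ux ff' sf' ch)).
Qed.

Lemma Tmap_vel S f x v g : smooth_map S f -> S x -> curve_at S x v g ->
  has_velocity (f \o g) 0 (Tmap S f x v).
Proof.
move=> sf Sx cg; have [U [f' [oU Ux sf' ff']]] := sf x Sx.
rewrite (TmapE oU Ux ff' sf'); last by exists g.
exact: (curve_at_vel oU Ux ff' sf' cg).
Qed.

Lemma Tmap_val S f x v g w : smooth_map S f -> S x -> curve_at S x v g ->
  has_velocity (f \o g) 0 w -> Tmap S f x v = w.
Proof. by move=> sf Sx cg; apply: vel_unique; exact: Tmap_vel cg. Qed.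

Lemma Tmap_linear S f x a u v : smooth_map S f -> S x -> tangent S x u -> tangent S x v ->
  tangent S x (a *: u + v) -> Tmap S f x (a *: u + v) = a *: Tmap S f x u + Tmap S f x v.
Proof.
move=> sf Sx tu tv tw; have [U [f' [oU Ux sf' ff']]] := sf x Sx.
by rewrite !(TmapE oU Ux ff' sf') // /mdiff linearP.
Qed.

Lemma curve_at_comp S (S' : set B) f x v g : smooth_map S f -> S x -> (forall y, S y -> S' (f
  y)) ->
  curve_at S x v g -> curve_at S' (f x) (Tmap S f x v) (f \o g).
Proof.
move=> sf Sx SS' cg; have vf := Tmap_vel sf Sx cg.
have [U [f' [oU Ux sf' ff']]] := sf x Sx.
have N := curve_at_near cg oU Ux.
case: cg => g0 gS sg vg; split=> //=; first by rewrite g0.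
  by move: gS; apply: filterS => t /SS'.
(* Near 0 the curve stays in [S] and [U], where [f] agrees with its smooth extension; hence [f \o g]
   is smooth at 0. *)
have /nbhs_ballP[r /= r0 Hr] := N.
have oB : @mopen R R^o (flat R^o) (ball (0 : R^o) r) by apply/mopen_flat; exact: ball_open.
apply: (smooth_at_ext (A := flat R^o) (f := f \o g) (g := f' \o g) oB (ballxx _ r0)).
  by move=> t /Hr [Ut St]; exact: ff'.
apply: (smooth_at_comp (A := flat R^o)) => //.
by rewrite g0.
Qed.

Lemma Tmap_tangent S (S' : set B) f x v : smooth_map S f -> S x -> (forall y, S y -> S' (f y)) ->
  tangent S x v -> tangent S' (f x) (Tmap S f x v).
Proof. by move=> sf Sx SS' [g cg]; exists (f \o g); exact: curve_at_comp. Qed.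

Lemma Tmap_sub S1 S f x v : S1 `<=` S -> smooth_map S f -> S1 x -> tangent S1 x v ->
  Tmap S1 f x v = Tmap S f x v.
Proof.
move=> s1 sf S1x [g cg].
apply: (Tmap_val (g := g)) => //; first exact: smooth_map_sub sf.
apply: Tmap_vel => //; first exact: s1.
by case: cg => ? N ? ?; split=> //; apply: filterS N => t; exact: s1.
Qed.

End TangentMap.

Section TangentSet.
Context {V : normedModType R} {A : atlas V} {FV : findim V} {CA : charted A}.
Implicit Types (S : set A) (x : A) (v : V).

Lemma tangent_sub S S' x v : S `<=` S' -> tangent S x v -> tangent S' x v.
Proof.
by move=> SS' [g [g0 N ? ?]]; exists g; split=> //; apply: filterS N => t; exact: SS'.
Qed.

Lemma tangent_open S (U : set A) x v : mopen U -> U x -> tangent S x v ->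
  tangent (S `&` U) x v.
Proof.
move=> oU Ux [g cg]; exists g.
have H : \forall t \near (0 : R), (S `&` U) (g t).
  by apply: filterS (curve_at_near cg oU Ux) => t [].
by case: cg.
Qed.

Lemma smooth_at_id x : @smooth_at R V V A A idfun x.
Proof.
exists (coord x @` dom x); split=> //; first exact: ch_open.
- by exists x => //; exact: ch_dom.
- by move=> q [y xy <-]; rewrite ch_param.
apply: (eq_smooth (f := idfun)); [exact: ch_open| |exact: (@smooth_linear R V V FV _ idfun)].
by move=> q [y xy <-]; rewrite /= ch_param.
Qed.

Lemma smooth_map_id S : @smooth_map R V V A A S idfun.
Proof. by apply: smooth_at_map => x _; exact: smooth_at_id. Qed.

Lemma Tmap_id S x v : S x -> tangent S x v -> @Tmap R V A V A S idfun x v = v.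
Proof.
move=> Sx [g cg]; apply: (Tmap_val (g := g)) => //; first exact: smooth_map_id.
by case: cg.
Qed.

End TangentSet.

Lemma Tmap_comp {V W Z : normedModType R} {A : atlas V} {B : atlas W} {C : atlas Z}
   {FV : findim V} {FW : findim W} {FZ : findim Z}
   {CA : charted A} {CB : charted B} {CC : charted C}
   (S : set A) (S' : set B) (f : A -> B) (h : B -> C) x v :
  smooth_map S f -> smooth_map S' h -> (forall y, S y -> S' (f y)) -> S x ->
  tangent S x v -> Tmap S (h \o f) x v = Tmap S' h (f x) (Tmap S f x v).
Proof.
move=> sf sh SS' Sx [g cg]; apply: (Tmap_val (g := g)) => //.
  exact: smooth_map_comp sf sh SS'.
apply: (Tmap_vel sh (SS' _ Sx)).
exact: curve_at_comp.
Qed.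

End Tangent.

(** * The bundles TM + T*M and T*M *)

Lemma manifold_charted {R : realType} {n : nat} (M : manifold R n) :
  charted (manifold_atlas M).
Proof. by have [] := manifoldP M. Qed.
#[export] Hint Extern 0 (charted (manifold_atlas _)) => eapply manifold_charted :
  typeclass_instances.

Section Dot.
Context {R : realType} {n : nat}.
Implicit Types p v w : 'rV[R]_n.

Lemma dot_lin p a v w : dot p (a *: v + w) = a * dot p v + dot p w.
Proof.
rewrite /dot mulr_sumr -big_split /=; apply: eq_bigr => i _.
by rewrite !mxE mulrDr mulrCA.
Qed.

Lemma dot_linl v a p q : dot (a *: p + q) v = a * dot p v + dot q v.
Proof.
rewrite /dot mulr_sumr -big_split /=; apply: eq_bigr => i _.
by rewrite !mxE mulrDl mulrA.
Qed.

Lemma dotC p v : dot p v = dot v p.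
Proof. by apply: eq_bigr => i _; rewrite mulrC. Qed.

Lemma dot0r p : dot p 0 = 0.
Proof. by rewrite /dot big1 // => i _; rewrite mxE mulr0. Qed.

Lemma dotDr p v w : dot p (v + w) = dot p v + dot p w.
Proof. by rewrite -{1}[v]scale1r dot_lin mul1r. Qed.

Lemma dotDl v p q : dot (p + q) v = dot p v + dot q v.
Proof. by rewrite -{1}[p]scale1r dot_linl mul1r. Qed.

Lemma dotZr p a v : dot p (a *: v) = a * dot p v.
Proof. by rewrite -{1}[a *: v]addr0 dot_lin dot0r addr0. Qed.

Lemma dotZl v a p : dot (a *: p) v = a * dot p v.
Proof. by rewrite dotC dotZr dotC. Qed.

Lemma dotNl v p : dot (- p) v = - dot p v.
Proof. by rewrite -scaleN1r dotZl mulN1r. Qed.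

Lemma dot_delta p i : dot p (delta_mx 0 i) = p 0 i.
Proof.
rewrite /dot (bigD1 i) //= mxE !eqxx mulr1 big1 ?addr0 // => j ji.
by rewrite mxE (negbTE ji) andbF mulr0.
Qed.

Lemma dot_ext p q : (forall v, dot p v = dot q v) -> p = q.
Proof. by move=> H; apply/rowP => i; rewrite -!dot_delta H. Qed.

Lemma dot_sumr p m (c : 'I_m -> R) (e : 'I_m -> 'rV[R]_n) :
  dot p (\sum_i c i *: e i) = \sum_i c i * dot p (e i).
Proof.
elim/big_rec2: _ => [|i y1 y2 _ <-]; first by rewrite dot0r.
by rewrite dotDr dotZr.
Qed.

Lemma dot_suml v m (c : 'I_m -> R) (e : 'I_m -> 'rV[R]_n) :
  dot (\sum_i c i *: e i) v = \sum_i c i * dot (e i) v.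
Proof. by rewrite dotC dot_sumr; apply: eq_bigr => i _; rewrite dotC. Qed.

Lemma smooth_row {V : normedModType R} (U : set V) m (f : 'I_m -> V -> R^o) : open U ->
  (forall i, smooth U (f i)) -> smooth U (fun x => \row_i f i x).
Proof.
move=> oU sf; apply: (eq_smooth (f := fun x => \sum_i f i x *: delta_mx 0 i)) => //.
  by move=> x _; rewrite [RHS]row_sum_delta; apply: eq_bigr => i _; rewrite mxE.
by apply: smooth_sum => // i; apply: smooth_scale => //; exact: smooth_cst.
Qed.

Lemma smooth_entry {V : normedModType R} (U : set V) (f : V -> 'rV[R]_n) i : open U ->
  smooth U f -> smooth U (fun x => f x 0 i : R^o).
Proof.
move=> oU sf.
exact: (@smooth_lin_comp R V 'rV[R]_n R^o _ U f (fd_linear (FV := findim_rV n) i)).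
Qed.

Lemma smooth_dot {V : normedModType R} (U : set V) (f g : V -> 'rV[R]_n) : open U ->
  smooth U f -> smooth U g -> smooth U (fun x => dot (f x) (g x) : R^o).
Proof.
move=> oU sf sg; apply: smooth_sum => // i.
by apply: (smooth_scale (f := fun x => f x 0 i : R^o)) => //; exact: smooth_entry.
Qed.

Lemma differentiable_dot {V : normedModType R} (f g : V -> 'rV[R]_n) x :
  differentiable f x -> differentiable g x ->
  differentiable (fun y => dot (f y) (g y) : R^o) x /\
  forall v : V, 'd (fun y => dot (f y) (g y) : R^o) x v = dot (f x) ('d g x v) + dot ('d f x v)
    (g x).
Proof.
move=> df dg.
pose L i : {linear 'rV[R]_n -> R^o} := fd_linear (FV := findim_rV n) i.
have cL i : continuous (L i) by exact: fd_lin_continuous.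
have dE (h : V -> 'rV[R]_n) i : differentiable h x ->
    differentiable (fun y => h y 0 i : R^o) x /\
    forall v : V, 'd (fun y => h y 0 i : R^o) x v = 'd h x v 0 i.
  move=> dh; have dl : differentiable (L i) (h x) by exact: linear_differentiable.
  split=> [|v]; first exact: (differentiable_comp dh dl).
  exact: (etrans (congr1 (@^~ v) (diff_comp dh dl)) (congr1 (@^~ ('d h x v)) (diff_lin (h x) (cL
    i)))).
pose F i y : R^o := f y 0 i * g y 0 i.
have dF i : differentiable (F i) x /\ forall v : V, 'd (F i) x v = f x 0 i * 'd g x v 0 i + 'd f
  x v 0 i * g x 0 i.
  have [dfi Efi] := dE f i df; have [dgi Egi] := dE g i dg.
  have [dS ES] := differentiable_scale dfi dgi.
  split=> [|v]; first exact: dS.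
  exact: (etrans (ES v) (f_equal2 (fun a b : R => f x 0 i * a + b * g x 0 i) (Egi v) (Efi v))).
have FE : (fun y => dot (f y) (g y) : R^o) = \sum_i F i.
  by apply/funext => y; rewrite fct_sumE.
have dS : differentiable (\sum_i F i) x by apply: differentiable_sum => i; exact: (dF i).1.
rewrite FE; split=> // v.
rewrite -deriveE // derive_sum => [|i]; last exact: diff_derivable (dF i).1.
rewrite -big_split /=; apply: eq_bigr => i _.
by rewrite deriveE ?(dF i).2 //; exact: (dF i).1.
Qed.

End Dot.

Section MoveVec.
Context {R : realType} {V : normedModType R} {A : atlas V} {FV : findim V} {CA : charted A}.
Implicit Types x y z w : A.

Lemma transition_diff x y z : dom x z -> dom y z -> differentiable (transition x y) (coord x z).
Proof. by move=> xz yz; have [_ /smooth_differentiable] := ch_trans x y; apply; exists z. Qed.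

Lemma move_vec_id x z v : dom x z -> move_vec x x z v = v.
Proof.
move=> xz; have cid : continuous (idfun : V -> V) by move=> p; exact: cvg_id.
have did := @linear_differentiable _ _ _ idfun (coord x z) cid.
have [|//|_ E] := @eq_diff _ _ _ idfun (transition x x) (coord x z).
  have [oD _] := ch_trans x x.
  have : \forall q \near coord x z, (coord x @` (dom x `&` dom x)) q.
    by apply: open_nbhs_nbhs; split=> //; exists z.
  by apply: filterS => q [y [xy _] <-]; rewrite /transition /= ch_param.
by rewrite /move_vec E (@diff_lin _ _ _ idfun).
Qed.

Lemma move_vec_comp x y w z v : dom x z -> dom y z -> dom w z ->
  move_vec y w z (move_vec x y z v) = move_vec x w z v.
Proof.
move=> xz yz wz.
have E : \forall q \near coord x z, (transition y w \o transition x y) q = transition x w q.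
  have [oD _] := ch_trans x y.
  have : \forall q \near coord x z, (coord x @` (dom x `&` dom y)) q.
    by apply: open_nbhs_nbhs; split=> //; exists z.
  by apply: filterS => q [u [xu yu] <-]; rewrite /transition /= !ch_param.
have T : transition x y (coord x z) = coord y z by rewrite /transition /= ch_param.
have d1 := transition_diff xz yz; have d2 := transition_diff yz wz.
rewrite -T in d2.
have [_ D] := eq_diff E (differentiable_comp d1 d2).
have := etrans D (diff_comp d1 d2).
by rewrite T => /(congr1 (@^~ v))/esym.
Qed.

End MoveVec.

Section MoveCov.
Context {R : realType} {n : nat} {M : manifold R n}.
Local Notation E := 'rV[R]_n.
Implicit Types x y z w : M.

(** Covectors move by the transpose of the map that moves vectors back, which preserves the pairing.
    Through [dot_ext] the identities for covectors follow from those for vectors. *)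
Lemma dot_move_cov x y z p v : dot (move_cov x y z p) v = dot p (move_vec y x z v).
Proof.
have -> : move_vec y x z v = \sum_i v 0 i *: move_vec y x z (delta_mx 0 i).
  exact: (@diff_basis _ _ _ (findim_rV n)).
by rewrite dot_sumr; apply: eq_bigr => i _; rewrite mxE mulrC.
Qed.

Lemma move_cov_id x z p : dom x z -> move_cov x x z p = p.
Proof. by move=> xz; apply: dot_ext => v; rewrite dot_move_cov move_vec_id. Qed.

Lemma move_cov_comp x y w z p : dom x z -> dom y z -> dom w z ->
  move_cov y w z (move_cov x y z p) = move_cov x w z p.
Proof.
move=> xz yz wz.
apply: dot_ext => v.
apply: (etrans (dot_move_cov _ _ _ _ _)).
apply: (etrans (dot_move_cov _ _ _ _ _)).
apply: (etrans _ (esym (dot_move_cov _ _ _ _ _))).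
congr dot.
exact: (move_vec_comp v wz yz xz).
Qed.

End MoveCov.

#[local] Opaque diff.

Section LocallyLinear.
Context {R : realType} {V W : normedModType R} {A : atlas V} {B : atlas W}.
Context {FV : findim V} {CA : charted A}.

(** In the bundle charts, induced from those of the base, the maps [base], [prTs] and [scale] are
    linear; this yields their smoothness and their differentials together. *)
Lemma smooth_at_linear (f : A -> B) x (L : {linear V -> W}) :
  (forall y, dom x y -> dom (f x) (f y) /\ coord (f x) (f y) = L (coord x y)) ->
  smooth_at f x /\ mdiff f x = L :> (V -> W).
Proof.
move=> H; have oD : open (coord x @` dom x) by exact: ch_open.
have Dx : (coord x @` dom x) (coord x x) by exists x => //; exact: ch_dom.
have E q : (coord x @` dom x) q -> coord (f x) (f (param x q)) = L q.
  by move=> [y xy <-]; rewrite ch_param // (H y xy).2.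
split.
  exists (coord x @` dom x); split=> //.
    by move=> q [y xy <-]; rewrite ch_param //; exact: (H y xy).1.
  apply: (eq_smooth oD _ (smooth_linear _ L)) => q Dq; exact: esym (E q Dq).
have cL : continuous L by exact: fd_lin_continuous.
have N : \forall q \near coord x x, L q = coord (f x) (f (param x q)).
  have H1 : \forall q \near coord x x, (coord x @` dom x) q by exact: (open_nbhs_nbhs (conj oD
    Dx)).
  by apply: filterS H1 => q Dq; exact: esym (E q Dq).
have [_ D] := eq_diff N (linear_differentiable _ cL).
exact: (etrans D (diff_lin _ cL)).
Qed.

End LocallyLinear.

Section Bundle.
Context {R : realType} {n : nat} {M : manifold R n}.
Local Notation E := 'rV[R]_n.

(** [move_vec] and [move_cov] with the base point given by its coordinates [q], a vector variable in
    which smoothness can be expressed. *)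
Definition tr_vec (x y : M) (q v : E) : E := 'd (transition x y) q v.
Definition tr_cov (x y : M) (q p : E) : E :=
  \row_i dot p ('d (transition y x) (transition x y q) (delta_mx 0 i)).

Lemma tr_vecE (x y z : M) v : tr_vec x y (coord x z) v = move_vec x y z v.
Proof. by []. Qed.

Lemma tr_covE (x y z : M) p : dom x z -> tr_cov x y (coord x z) p = move_cov x y z p.
Proof. by move=> xz; rewrite /tr_cov /transition /= ch_param. Qed.

Lemma smooth_tr_vec (x y : M) (V : normedModType R) (U : set V) (q v : V -> E) : open U ->
  (forall z, U z -> (coord x @` (dom x `&` dom y)) (q z)) ->
  smooth U q -> smooth U v -> smooth U (fun z => tr_vec x y (q z) (v z)).
Proof.
move=> oU UD sq sv; have [_ s] := ch_trans x y.
exact: (smooth_diff oU UD sq sv s).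
Qed.

Lemma smooth_tr_cov (x y : M) (V : normedModType R) (U : set V) (q p : V -> E) : open U ->
  (forall z, U z -> (coord x @` (dom x `&` dom y)) (q z)) ->
  smooth U q -> smooth U p -> smooth U (fun z => tr_cov x y (q z) (p z)).
Proof.
move=> oU UD sq sp; have [_ s] := ch_trans x y; have [_ s'] := ch_trans y x.
apply: smooth_row => // i; apply: (smooth_dot oU sp).
have st : smooth U (fun z => transition x y (q z)) by exact: smooth_comp sq s.
apply: (smooth_diff (U := coord y @` (dom y `&` dom x)) oU _ st _ s').
  by move=> z /UD[u [xu yu] <-]; exists u => //; rewrite /transition /= ch_param.
exact: smooth_cst.
Qed.

Local Notation C3 x y := (fun q : E * E * E => (coord x @` (dom x `&` dom y)) q.1.1).

Definition pr1 : {linear (E * E * E)%type -> E} := HB.pack (fun z : E * E * E => z.1.1)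
  (GRing.isLinear.Build R (E * E * E)%type E *:%R (fun z : E * E * E => z.1.1) (fun _ _ _ =>
    erefl)).
Definition pr2 : {linear (E * E * E)%type -> E} := HB.pack (fun z : E * E * E => z.1.2)
  (GRing.isLinear.Build R (E * E * E)%type E *:%R (fun z : E * E * E => z.1.2) (fun _ _ _ =>
    erefl)).
Definition pr3 : {linear (E * E * E)%type -> E} := HB.pack (fun z : E * E * E => z.2)
  (GRing.isLinear.Build R (E * E * E)%type E *:%R (fun z : E * E * E => z.2) (fun _ _ _ =>
    erefl)).
Definition pr13 : {linear (E * E * E)%type -> (E * E)%type} :=
  HB.pack (fun z : E * E * E => (z.1.1, z.2))
  (GRing.isLinear.Build R (E * E * E)%type (E * E)%type *:%R (fun z : E * E * E => (z.1.1, z.2))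
    (fun _ _ _ => erefl)).
Definition cpr1 : {linear (E * E)%type -> E} := HB.pack (fun z : E * E => z.1)
  (GRing.isLinear.Build R (E * E)%type E *:%R (fun z : E * E => z.1) (fun _ _ _ => erefl)).
Definition cpr2 : {linear (E * E)%type -> E} := HB.pack (fun z : E * E => z.2)
  (GRing.isLinear.Build R (E * E)%type E *:%R (fun z : E * E => z.2) (fun _ _ _ => erefl)).

Lemma open_linear_preimage {V W : normedModType R} {FV : findim V} (L : {linear V -> W}) (U :
  set W) :
  open U -> open (L @^-1` U).
Proof. by move=> oU; apply: open_comp => // z _; exact: fd_lin_continuous. Qed.

Lemma pont_coord_im (a b : pontryagin M) :
  coord a @` (dom a `&` dom b) = pr1 @^-1` (coord a.1.1 @` (dom a.1.1 `&` dom b.1.1)).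
Proof.
apply/seteqP; split=> [q [c [ac bc] <-]|[[q v] p] /= [z [az bz] Eq]].
  by exists c.1.1.
exists (z, move_vec a.1.1 z z v, move_cov a.1.1 z z p) => //=.
have zz : dom z z by exact: ch_dom.
congr (_, _, _) => //.
  exact: (etrans (move_vec_comp _ az zz az) (move_vec_id _ az)).
exact: (etrans (move_cov_comp _ az zz az) (move_cov_id _ az)).
Qed.

Lemma cot_coord_im (a b : cotangent M) :
  coord a @` (dom a `&` dom b) = cpr1 @^-1` (coord a.1 @` (dom a.1 `&` dom b.1)).
Proof.
apply/seteqP; split=> [q [c [ac bc] <-]|[q p] /= [z [az bz] Eq]].
  by exists c.1.
exists (z, move_cov a.1 z z p) => //=.
have zz : dom z z by exact: ch_dom.
congr (_, _) => //.
exact: (etrans (move_cov_comp _ az zz az) (move_cov_id _ az)).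
Qed.

Lemma pontryagin_charted : charted (pontryagin M).
Proof.
split=> [a|a b ab|a b]; first exact: (ch_dom a.1.1).
  rewrite /= ch_param //; case: b ab => [[z v] p] /= az; have zz : dom z z by exact: ch_dom.
  congr (_, _, _) => //.
    exact: (etrans (move_vec_comp _ zz az zz) (move_vec_id _ zz)).
  exact: (etrans (move_cov_comp _ zz az zz) (move_cov_id _ zz)).
rewrite pont_coord_im; have [oD sD] := ch_trans a.1.1 b.1.1.
pose proof (open_linear_preimage pr1 oD) as oD'; split=> //.
have s1 : smooth (pr1 @^-1` (coord a.1.1 @` (dom a.1.1 `&` dom b.1.1))) pr1 by exact:
  smooth_linear.
have s2 : smooth (pr1 @^-1` (coord a.1.1 @` (dom a.1.1 `&` dom b.1.1))) pr2 by exact: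
  smooth_linear.
have s3 : smooth (pr1 @^-1` (coord a.1.1 @` (dom a.1.1 `&` dom b.1.1))) pr3 by exact:
  smooth_linear.
pose proof (smooth_comp (g := transition a.1.1 b.1.1) oD' (fun z H => H) s1 sD) as c1.
pose proof (@smooth_tr_vec a.1.1 b.1.1 _ _ _ _ oD' (fun z H => H) s1 s2) as c2.
pose proof (@smooth_tr_cov a.1.1 b.1.1 _ _ _ _ oD' (fun z H => H) s1 s3) as c3.
apply: (eq_smooth oD' _ (smooth_pair oD' (smooth_pair oD' c1 c2) c3)).
move=> [[q v] p] /= [z [az bz] Eq]; rewrite /transition /=.
rewrite -Eq (ch_param az); have zz : dom z z by exact: ch_dom.
apply: (f_equal2 pair (f_equal2 pair _ _) _); first by [].
  exact: (etrans (tr_vecE _ _ _ _) (esym (move_vec_comp _ az zz bz))).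
exact: (etrans (tr_covE _ _ az) (esym (move_cov_comp _ az zz bz))).
Qed.

Lemma cotangent_charted : charted (cotangent M).
Proof.
split=> [a|a b ab|a b]; first exact: (ch_dom a.1).
  rewrite /= ch_param //; case: b ab => [z p] /= az; have zz : dom z z by exact: ch_dom.
  congr (_, _) => //.
  exact: (etrans (move_cov_comp _ zz az zz) (move_cov_id _ zz)).
rewrite cot_coord_im; have [oD sD] := ch_trans a.1 b.1.
pose proof (open_linear_preimage cpr1 oD) as oD'; split=> //.
have s1 : smooth (cpr1 @^-1` (coord a.1 @` (dom a.1 `&` dom b.1))) cpr1 by exact: smooth_linear.
have s3 : smooth (cpr1 @^-1` (coord a.1 @` (dom a.1 `&` dom b.1))) cpr2 by exact: smooth_linear.
pose proof (smooth_comp (g := transition a.1 b.1) oD' (fun z H => H) s1 sD) as c1.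
pose proof (@smooth_tr_cov a.1 b.1 _ _ _ _ oD' (fun z H => H) s1 s3) as c3.
apply: (eq_smooth oD' _ (smooth_pair oD' c1 c3)).
move=> [q p] /= [z [az bz] Eq]; rewrite /transition /=.
rewrite -Eq (ch_param az); have zz : dom z z by exact: ch_dom.
apply: (f_equal2 pair); first by [].
exact: (etrans (tr_covE _ _ az) (esym (move_cov_comp _ az zz bz))).
Qed.

End Bundle.
#[export] Hint Extern 0 (charted (pontryagin _)) => eapply pontryagin_charted :
  typeclass_instances.
#[export] Hint Extern 0 (charted (cotangent _)) => eapply cotangent_charted : typeclass_instances.

Section BundleMaps.
Context {R : realType} {n : nat} {M : manifold R n}.
Local Notation E := 'rV[R]_n.
Implicit Types a : pontryagin M.

Lemma base_smooth_at a : @smooth_at R _ _ (pontryagin M) M (@base R n M) a /\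
  @mdiff R _ _ (pontryagin M) M (@base R n M) a = pr1 :> (_ -> _).
Proof. by apply: smooth_at_linear => b. Qed.

Lemma prTs_smooth_at a : @smooth_at R _ _ (pontryagin M) (cotangent M) (@prTs R n M) a /\
  @mdiff R _ _ (pontryagin M) (cotangent M) (@prTs R n M) a = pr13 :> (_ -> _).
Proof. by apply: smooth_at_linear => b. Qed.

Definition scale_fun (t : R) (z : E * E * E) : E * E * E := (z.1.1, t *: z.1.2, t *: z.2).

Lemma scale_fun_linear (t : R) : linear (scale_fun t).
Proof. by move=> c u v; congr (_, _, _); rewrite /= scalerDr !scalerA mulrC. Qed.

Definition scale_lin (t : R) : {linear (E * E * E)%type -> (E * E * E)%type} :=
  HB.pack (scale_fun t) (GRing.isLinear.Build R (E * E * E)%type (E * E * E)%type *:%R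
    (scale_fun t) (scale_fun_linear t)).

Lemma scale_smooth_at (t : R) a :
  @smooth_at R _ _ (pontryagin M) (pontryagin M) (@Defs.scale R n M t) a /\
  @mdiff R _ _ (pontryagin M) (pontryagin M) (@Defs.scale R n M t) a = scale_lin t :> (_ -> _).
Proof.
apply: smooth_at_linear => b ab; split=> //=; congr (_, _, _).
  by rewrite /move_vec linearZ.
by apply: dot_ext => v; rewrite dotZl !dot_move_cov dotZl.
Qed.

Lemma coord_self a : coord a a = (coord a.1.1 a.1.1, a.1.2, a.2).
Proof.
have zz : dom a.1.1 a.1.1 by exact: ch_dom.
by congr (_, _, _); [exact: move_vec_id|exact: move_cov_id].
Qed.

End BundleMaps.

(** * The flow of a spray and the form omega *)

Section MoreCalculus.
Context {R : realType}.
Implicit Types V W Z : normedModType R.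

Lemma diff_lin_comp V W Z {FW : findim W} (L : {linear W -> Z}) (f : V -> W) x v :
  differentiable f x -> 'd (fun y => L (f y)) x v = L ('d f x v).
Proof.
move=> df; have cL : continuous L by exact: fd_lin_continuous.
have dL : differentiable L (f x) by exact: linear_differentiable.
exact: (etrans (congr1 (@^~ v) (diff_comp df dL)) (congr1 (@^~ ('d f x v)) (diff_lin (f x) cL))).
Qed.

Lemma fd_ext V {FV : findim V} (u v : V) : (forall i, fd_coord i u = fd_coord i v) -> u = v.
Proof. by move=> H; rewrite (fd_span u) (fd_span v); apply: eq_bigr => i _; rewrite H. Qed.

Lemma schwarz_vec V W {FW : findim W} (f : V -> W) (U : set V) x v w : open U -> U x ->
  smooth U f -> 'd (fun y => 'd f y v) x w = 'd (fun y => 'd f y w) x v.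
Proof.
move=> oU Ux sf; apply: fd_ext => i; pose L : {linear W -> R^o} := fd_linear i.
have E a b : 'd (fun y => 'd (fun z => L (f z)) y a) x b = L ('d (fun y => 'd f y a) x b).
  have N : \forall y \near x, L ('d f y a) = 'd (fun z => L (f z)) y a.
    have NU : \forall y \near x, U y by exact: open_nbhs_nbhs.
    apply: filterS NU => y Uy; apply/esym; apply: diff_lin_comp.
    exact: smooth_differentiable sf Uy.
  have d1 := smooth_differentiable (smooth_dir a sf) Ux.
  have cL : continuous L by exact: fd_lin_continuous.
  have dL : differentiable L ('d f x a) by exact: linear_differentiable.
  have [_ E] := eq_diff N (differentiable_comp d1 dL).
  exact: (etrans (congr1 (@^~ b) E) (diff_lin_comp L b d1)).
have s : smooth U (fun z => L (f z)) by exact: (smooth_lin_comp L oU sf).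
exact: (etrans (esym (E v w)) (etrans (schwarz v w oU Ux (s 2)) (E w v))).
Qed.

Lemma line_vel V {FV : findim V} (q u : V) :
  @has_velocity R V (flat V) (fun s => q + s *: u) 0 u.
Proof.
split; first exact: (@filterT _ (nbhs (0 : R)) _).
have := @line_derive R V V idfun q u 0; rewrite /=.
have cid : continuous (idfun : V -> V) by move=> z; exact: cvg_id.
move=> /(_ (@linear_differentiable _ _ _ idfun _ cid)).
by rewrite (congr1 (@^~ u) (@diff_lin _ _ _ idfun _ cid)).
Qed.

Lemma line_smooth V {FV : findim V} (q u : V) (t : R) :
  @smooth_at R R^o V (flat R^o) (flat V) (fun s => q + s *: u) t.
Proof.
exists setT; split=> //; first exact: openT.
  by move=> z _; exists z.
apply: smoothD; [exact: openT|exact: smooth_cst|].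
apply: (smooth_scale (f := idfun : R^o -> R^o)); [exact: openT| |exact: smooth_cst].
exact: (@smooth_linear R R^o R^o _ setT idfun).
Qed.

Lemma line_curve V {FV : findim V} (W : set V) (q u : V) : open W -> W q ->
  @curve_at R V (flat V) W q u (fun s => q + s *: u).
Proof.
move=> oW Wq; split.
- by rewrite scale0r addr0.
- apply: (vel_mopen (A := flat V) (line_vel q u)).
    exact/mopen_flat.
  by rewrite scale0r addr0.
- exact: line_smooth.
exact: line_vel.
Qed.

End MoreCalculus.

(** * The flow along a family of points of Sigma *)

Section Flow.
Context {R : realType} {n : nat} {M : manifold R n}.
Local Notation E := 'rV[R]_n.
Context {L Sig : set (pontryagin M)} {X : pontryagin M -> E * E * E}.
Context {O : set (R * pontryagin M)} {phi : R -> pontryagin M -> pontryagin M}.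
Hypothesis phi_flow : local_flow L X O phi.
Hypothesis Sig_dom : spray_domain L O Sig.

Lemma Sig_L a : Sig a -> L a.
Proof. by case: Sig_dom => -[U [_ ->]] _ _ []. Qed.

Lemma Sig_O t a : 0 <= t <= 1 -> Sig a -> O (t, a).
Proof. by case: Sig_dom => _ _ H; exact: H. Qed.

Lemma flow_L t a : O (t, a) -> L (phi t a).
Proof. by case: phi_flow => _ _ _ _ [H _] /H[]. Qed.

Lemma flow_smooth_map t : 0 <= t <= 1 -> smooth_map Sig (phi t).
Proof.
move=> t01 a Sa; case: phi_flow => _ _ _ _ [_ /(_ _ (Sig_O t01 Sa))].
move=> [U [g [oU Ua sg Ug]]].
have sp : @smooth_at R _ _ (pontryagin M) (prod_atlas (flat R^o) (pontryagin M)) (fun b => (t,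
  b)) a.
  apply: (smooth_at_pair (B := flat R^o) (C := pontryagin M) (f := fun=> t) (g := idfun)).
    exists (coord a @` dom a); split=> //.
    - exact: ch_open.
    - by exists a => //; exact: ch_dom.
    - exact: smooth_cst.
  exact: smooth_at_id.
have [U' [oU' U'a UU']] := smooth_at_continuous sp oU Ua.
exists U', (fun b => g (t, b)); split=> //.
  exact: (smooth_at_comp sp sg).
move=> b [U'b Sb]; rewrite -(Ug (t, b)) //; split; first exact: UU'.
exact: Sig_O.
Qed.

Section FlowAlong.
Context {Vd : normedModType R} {Fd : findim Vd}.
Variables (W : set Vd) (psi : Vd -> pontryagin M).
Hypothesis oW : open W.
Hypothesis spsi : @smooth_map R Vd _ (flat Vd) (pontryagin M) W psi.
Hypothesis W_Sig : forall q, W q -> Sig (psi q).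
Local Notation T := (R^o * Vd)%type.

(* [liouville_along v] is the Liouville form p dq of T*M on the derivative of
   [cot_along] in the direction [v]. *)
Definition flow_along (z : T) : pontryagin M := phi z.1 (psi z.2).
Definition cot_along (z : T) : cotangent M := prTs (flow_along z).
Definition liouville_along (v : Vd) (z : T) : R^o :=
  dot (cot_along z).2
    (@mdiff R T E (flat T) M (fun z => base (flow_along z)) z (0, v)).

(** The flow is smooth only relative to the subset [O] of R * L, but [psi] takes its values in
    Sigma, inside [L], so the composite is smooth on an open set of a vector space. Being open, [D]
    leaves room around the ends of [0, 1], where two-sided derivatives are taken. *)
Lemma flow_along_dom : exists D : set T,
  [/\ open D, forall t q, 0 <= t <= 1 -> W q -> D (t, q),
      forall z, D z -> W z.2 /\ O (z.1, psi z.2)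
    & forall z, D z -> @smooth_at R T _ (flat T) (pontryagin M) flow_along z].
Proof.
have [[U0 [oU0 OE]] _ _ _ [_ sO]] := phi_flow.
pose D := [set z : T | W z.2 /\ U0 (z.1, psi z.2)].
have DO z : D z -> O (z.1, psi z.2).
  by move=> [Wz Uz]; rewrite OE; split=> //; split=> //; apply/Sig_L/W_Sig.
have sp z : W z.2 -> @smooth_at R T _ (flat T) (prod_atlas (flat R^o) (pontryagin M))
    (fun z => (z.1, psi z.2)) z.
  move=> Wz.
  pose lf : {linear T -> R^o} := HB.pack (fst : T -> R^o)
    (GRing.isLinear.Build R T R^o *:%R fst (fun _ _ _ => erefl)).
  pose ls : {linear T -> Vd} := HB.pack (snd : T -> Vd)
    (GRing.isLinear.Build R T Vd *:%R snd (fun _ _ _ => erefl)).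
  have [sf _] := @smooth_at_linear R T R^o (flat T) (flat R^o) _ _ fst z lf (fun _ _ => conj I
    erefl).
  have [ss _] := @smooth_at_linear R T Vd (flat T) (flat Vd) _ _ snd z ls (fun _ _ => conj I
    erefl).
  apply: (smooth_at_pair (A := flat T) (B := flat R^o) (C := pontryagin M) (f := fst) (g := psi
    \o snd)) => //.
  apply: (smooth_at_comp (A := flat T) (B := flat Vd) ss).
  by apply: (smooth_map_at (A := flat Vd) _ spsi) => //; exact/mopen_flat.
have nD z (U : set (prod_atlas (flat R^o) (pontryagin M))) : mopen U -> W z.2 -> U (z.1, psi
  z.2) ->
    exists N : set T, [/\ open N, N z & forall z', N z' -> U (z'.1, psi z'.2)].
  move=> oU Wz Uz; have [N [/mopen_flat oN Nz H]] := smooth_at_continuous (sp z Wz) oU Uz.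
  by exists N.
have oW2 : open [set z : T | W z.2] by apply: open_comp => // z _; exact: cvg_snd.
have oD : open D.
  rewrite openE => z [Wz Uz]; have [N [oN Nz NU]] := nD z U0 oU0 Wz Uz.
  have N1 : nbhs z N by exact: open_nbhs_nbhs.
  have N2 : nbhs z [set z : T | W z.2] by exact: open_nbhs_nbhs.
  by apply: filterS (filterI N1 N2) => z' [/NU ? ?].
exists D; split=> //.
- move=> t q t01 Wq; split=> //.
  by have := Sig_O t01 (W_Sig Wq); rewrite OE => -[].
- by move=> z Dz; split; [case: Dz|exact: DO].
move=> z Dz; have [U [g [oU Ua sg Ug]]] := sO _ (DO z Dz).
have [N [oN Nz NU]] := nD z U oU Dz.1 Ua.
have oND : @mopen R T (flat T) (N `&` D) by apply/mopen_flat; exact: openI.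
apply: (smooth_at_ext (A := flat T) (g := g \o (fun z => (z.1, psi z.2))) oND) => //.
  by move=> z' [Nz' Dz']; exact: (Ug (z'.1, psi z'.2) (conj (NU _ Nz') (DO _ Dz'))).
exact: (smooth_at_comp (A := flat T) (sp z Dz.1) sg).
Qed.

Lemma cot_along_smooth D z : (forall z, D z ->
    @smooth_at R T _ (flat T) (pontryagin M) flow_along z) -> D z ->
  @smooth_at R T _ (flat T) (cotangent M) cot_along z.
Proof.
move=> H Dz; apply: (smooth_at_comp (A := flat T) (f := flow_along) (g := @prTs R n M)).
  exact: H.
exact: (prTs_smooth_at _).1.
Qed.

Lemma base_along_smooth D z : (forall z, D z ->
    @smooth_at R T _ (flat T) (pontryagin M) flow_along z) -> D z ->
  @smooth_at R T _ (flat T) M (fun z => base (flow_along z)) z.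
Proof.
move=> H Dz; apply: (smooth_at_comp (A := flat T) (f := flow_along) (g := @base R n M)).
  exact: H.
exact: (base_smooth_at _).1.
Qed.

(** [liouville_along] is computed at each point in the chart chosen there, which may vary without
    any continuity. The form p dq does not depend on the chart, so near [z0] it is P dQ in the fixed
    chart at [cot_along z0]. *)
Lemma along_local (D : set T) z0 : open D -> (forall z, D z ->
    @smooth_at R T _ (flat T) (pontryagin M) flow_along z) -> D z0 ->
  exists (N : set T) (Q P : T -> E),
  [/\ open N, N z0, smooth N Q /\ smooth N P,
      forall z, N z -> coord (cot_along z0) (cot_along z) = (Q z, P z)
    & forall v z, N z -> liouville_along v z = dot (P z) ('d Q z (0, v))].
Proof.
move=> oD sD Dz0.
have [] := cot_along_smooth sD Dz0.
move=> O1 [oO1 Oz _ Od sO1]; exists (O1 `&` D).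
exists (fun z => cpr1 (coord (cot_along z0) (cot_along z))).
exists (fun z => cpr2 (coord (cot_along z0) (cot_along z))).
have oN := openI oO1 oD.
have sN : smooth (O1 `&` D) (fun z => coord (cot_along z0) (cot_along z)).
  by apply: smooth_subset sO1 => z [].
pose proof (smooth_lin_comp cpr1 oN sN) as sQ.
pose proof (smooth_lin_comp cpr2 oN sN) as sP.
split; [exact: oN|by split|by split| |].
  by move=> z _; exact: surjective_pairing.
move=> v z Nz; set x0 := (cot_along z0).1; set x := base (flow_along z).
have c0 : z + 0 *: ((0, v) : T) = z by rewrite scale0r addr0.
have x0x : dom x0 x := Od _ Nz.1.
have xx : dom x x by exact: ch_dom.
have sb := base_along_smooth sD Nz.2.
pose proof (line_vel z ((0, v) : T)) as vl.
have vb : has_velocity (fun s : R => base (flow_along (z + s *: (0, v)))) 0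
    (@mdiff R T E (flat T) M (fun z => base (flow_along z)) z (0, v)).
  have sb' : @smooth_at R T _ (flat T) M (fun z => base (flow_along z)) (z + 0 *: ((0, v) : T)).
    by rewrite c0.
  pose proof (vel_comp (A := flat T) sb' vl) as vb.
  by cbv beta in vb; rewrite c0 in vb.
have [_ d1] : (\forall s \near (0:R), dom x0 (base (flow_along (z + s *: (0, v))))) /\
   is_derive (0 : R^o) (1 : R^o) (fun s : R^o => coord x0 (base (flow_along (z + s *: (0, v)))))
     (move_vec x x0 x (@mdiff R T E (flat T) M (fun z => base (flow_along z)) z (0, v))).
  have x0x' : dom x0 (base (flow_along (z + 0 *: ((0, v) : T)))) by rewrite c0.
  pose proof (vel_chart (g := fun s : R => base (flow_along (z + s *: ((0, v) : T)))) x0x' vb)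
    as d1.
  by cbv beta in d1; rewrite c0 in d1.
have dQ : differentiable (fun z => cpr1 (coord (cot_along z0) (cot_along z))) (z + 0 *: ((0, v)
  : T)).
  by rewrite c0; exact: smooth_differentiable sQ Nz.
have := line_derive dQ; rewrite c0 => d2.
(* Both values are the derivative of the base curve in the chart at [x0], once by moving its
   velocity there and once directly. *)
have e12 := etrans (esym (@derive_val _ _ _ _ _ _ _ d1)) (@derive_val _ _ _ _ _ _ _ d2).
rewrite -e12 /liouville_along.
apply/esym/(etrans (dot_move_cov _ _ _ _ _)); congr dot.
exact: (etrans (move_vec_comp _ xx x0x xx) (move_vec_id _ xx)).
Qed.

End FlowAlong.
End Flow.

Lemma int01_smooth {R : realType} {V : normedModType R} {FV : findim V} (D : set (R^o * V)%type)
    (W : set V) (h : R^o * V -> R^o) :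
  open D -> open W -> (forall t q, 0 <= t <= 1 -> W q -> D (t, q)) -> smooth D h ->
  smooth W (fun q => int01 (fun t => h (t, q)) : R^o).
Proof. by move=> oD oW sub sh k; exact: int01_Ck oD oW sub (sh k). Qed.

(* As omega_can = - d(p dq), the exterior derivative is - [spray_form L S phi]. *)
Definition spray_theta {R : realType} {n : nat} {M : manifold R n} (L S : set (pontryagin M))
    (phi : R -> pontryagin M -> pontryagin M) : @form1 R _ (pontryagin M) :=
  fun a v => int01 (fun t => dot (phi t a).2
    (Tmap L (@prTs R n M) (phi t a) (Tmap S (phi t) a v)).1).

(** * Integral formulas for omega and its primitive *)

Section FlowForms.
Context {R : realType} {n : nat} {M : manifold R n}.
Local Notation E := 'rV[R]_n.
Context {L Sig : set (pontryagin M)} {X : pontryagin M -> E * E * E}.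
Context {O : set (R * pontryagin M)} {phi : R -> pontryagin M -> pontryagin M}.
Hypothesis phi_flow : local_flow L X O phi.
Hypothesis Sig_dom : spray_domain L O Sig.
Context {Vd : normedModType R} {Fd : findim Vd}.
Variables (W : set Vd) (psi : Vd -> pontryagin M).
Hypothesis oW : open W.
Hypothesis spsi : @smooth_map R Vd _ (flat Vd) (pontryagin M) W psi.
Hypothesis W_Sig : forall q, W q -> Sig (psi q).
Local Notation T := (R^o * Vd)%type.
Local Notation Tpsi := (@Tmap R Vd (flat Vd) _ (pontryagin M) W psi).
Local Notation cot := (cot_along (phi := phi) psi).
Local Notation flowa := (flow_along (phi := phi) psi).
Local Notation lio := (liouville_along (phi := phi) psi).

Section OnDomain.
Variable D : set T.
Hypothesis oD : open D.
Hypothesis sD : forall z, D z -> @smooth_at R T _ (flat T) (pontryagin M) flowa z.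

Lemma liouville_smooth v : smooth D (lio v).
Proof.
apply: smooth_local => z0 Dz0.
have [N [Q [P [oN Nz0 [sQ sP] _ H]]]] := along_local oD sD Dz0.
exists N; split=> //.
apply: (eq_smooth oN _ (smooth_dot oN sP (smooth_dir (0, v) sQ))) => z Nz.
exact: esym (H v z Nz).
Qed.

(** With p dq written as P dQ, the terms with second derivatives of Q cancel by symmetry and only
    products of first derivatives of P and Q remain. The right-hand side is minus the exterior
    derivative of p dq on (u, v). *)
Lemma omega_along u v z0 : D z0 ->
  omega_can (cot z0) (@mdiff R T _ (flat T) (cotangent M) cot z0 (0, u))
    (@mdiff R T _ (flat T) (cotangent M) cot z0 (0, v)) =
  'd (lio u) z0 (0, v) - 'd (lio v) z0 (0, u).
Proof.
move=> Dz0.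
have [N [Q [P [oN Nz0 [sQ sP] QP H]]]] := along_local oD sD Dz0.
have NN : \forall z \near z0, N z by exact: open_nbhs_nbhs.
have mE w : @mdiff R T _ (flat T) (cotangent M) cot z0 w = ('d Q z0 w, 'd P z0 w).
  have NE : \forall z \near z0, (Q z, P z) = coord (cot z0) (cot z).
    by apply: filterS NN => z /QP.
  have dQ := smooth_differentiable sQ Nz0; have dP := smooth_differentiable sP Nz0.
  have [_ E1] := eq_diff NE (differentiable_pair dQ dP).
  exact: (etrans (congr1 (@^~ w) E1) (congr1 (@^~ w) (diff_pair dQ dP))).
have dE w w' : 'd (lio w) z0 (0, w') =
    dot (P z0) ('d (fun z => 'd Q z (0, w)) z0 (0, w')) + dot ('d P z0 (0, w')) ('d Q z0 (0, w)).
  have NE : \forall z \near z0, (dot (P z) ('d Q z (0, w)) : R^o) = lio w z.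
    by apply: filterS NN => z Nz; exact: esym (H w z Nz).
  have dP := smooth_differentiable sP Nz0.
  have dQ := smooth_differentiable (smooth_dir (0, w) sQ) Nz0.
  have [dd Ed] := differentiable_dot dP dQ.
  have [_ E1] := eq_diff NE dd.
  exact: (etrans (congr1 (@^~ (0, w')) E1) (Ed (0, w'))).
have key (p s s' qu qv pu pv : E) : s = s' ->
    omega_can (cot z0) (qu, pu) (qv, pv) = (dot p s + dot pv qu) - (dot p s' + dot pu qv).
  by move=> ->; rewrite /omega_can /= opprD addrACA subrr add0r.
pose proof (schwarz_vec (0, u) (0, v) oN Nz0 sQ) as SE.
apply: (etrans (f_equal2 (omega_can (cot z0)) (mE (0, u)) (mE (0, v)))).
exact: (etrans (key _ _ _ _ _ _ _ SE) (esym (f_equal2 (fun a b : R => a - b) (dE u v) (dE v u)))).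
Qed.

Lemma liouville_lin a u v z : lio (a *: u + v) z = a * lio u z + lio v z.
Proof.
rewrite /liouville_along.
have -> : (0, a *: u + v) = a *: ((0, u) : T) + (0, v).
  by congr pair; rewrite /= scaler0 addr0.
by rewrite -dot_lin /mdiff linearP.
Qed.

Lemma cot_mdiff1 z w : D z ->
  (@mdiff R T _ (flat T) (cotangent M) cot z w).1 =
  @mdiff R T E (flat T) M (fun z => base (flowa z)) z w.
Proof.
move=> Dz; have [] := cot_along_smooth sD Dz.
move=> O1 [oO1 Oz _ Od sO1].
have dc := smooth_differentiable sO1 Oz.
exact: esym (diff_lin_comp cpr1 w dc).
Qed.

End OnDomain.

Lemma Tpsi_curve q u : W q -> curve_at Sig (psi q) (Tpsi q u) (fun s => psi (q + s *: u)).
Proof.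
move=> Wq.
exact: (curve_at_comp (A := flat Vd) (S := W) (f := psi) spsi Wq W_Sig (line_curve u oW Wq)).
Qed.

Lemma prTs_smooth_map S : @smooth_map R _ _ (pontryagin M) (cotangent M) S (@prTs R n M).
Proof. by apply: smooth_at_map => a _; exact: (prTs_smooth_at a).1. Qed.

(** The nested [Tmap] are evaluated on the curve s |-> psi (q + s u), pushed forward by the flow;
    this replaces them by one ordinary differential on a vector space. *)
Lemma cot_Tmap D t q u : (forall z, D z ->
    @smooth_at R T _ (flat T) (pontryagin M) flowa z) -> D (t, q) ->
  0 <= t <= 1 -> W q ->
  Tmap L (@prTs R n M) (phi t (psi q)) (Tmap Sig (phi t) (psi q) (Tpsi q u)) =
  @mdiff R T _ (flat T) (cotangent M) cot (t, q) (0, u).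
Proof.
move=> sD Dz t01 Wq; pose proof (Tpsi_curve u Wq) as c1.
have SL a : Sig a -> L (phi t a).
  by move=> Sa; apply/(flow_L phi_flow)/(Sig_O Sig_dom).
pose proof (flow_smooth_map phi_flow Sig_dom t01) as sf.
pose proof (curve_at_comp sf (W_Sig Wq) SL c1) as c2.
apply: (Tmap_val _ _ c2).
- exact: prTs_smooth_map.
- exact/SL/W_Sig.
have E (s : R) : (t, q) + s *: ((0, u) : T) = (t, q + s *: u).
  by congr pair; rewrite /= scaler0 addr0.
have E0 : (t, q) + 0 *: ((0, u) : T) = (t, q) by rewrite E scale0r addr0.
have sc : @smooth_at R T _ (flat T) (cotangent M) cot ((t, q) + 0 *: ((0, u) : T)).
  by rewrite E0; exact: cot_along_smooth sD Dz.
pose proof (vel_comp (A := flat T) (B := cotangent M) sc (line_vel (t, q) ((0, u) : T))) as vc.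
cbv beta in vc; rewrite E0 in vc.
have NE : \forall s \near nbhs (0 : R), cot ((t, q) + s *: ((0, u) : T)) = cot (t, q + s *: u).
  by apply: filterS (@filterT _ (nbhs (0 : R)) _) => s _; rewrite E.
exact: (vel_near NE vc).
Qed.

(** Both integrands are expressed by the functions [lio] on a common open [D]. The derivatives serve
    exactness; the pointwise expression by [omega_can] is kept because linearity in u is read off
    from it. *)
Lemma spray_theta_along : exists D : set T,
  [/\ open D, forall (t : R) q, 0 <= t <= 1 -> W q -> D (t, q),
      forall v, smooth D (lio v),
      forall q u, W q -> spray_theta L Sig phi (psi q) (Tpsi q u) =
        int01 (fun t => lio u (t, q))
    & forall q u v, W q -> spray_form L Sig phi (psi q) (Tpsi q u) (Tpsi q v) =
        int01 (fun t => 'd (lio u) (t, q) (0, v) - 'd (lio v) (t, q) (0, u)) /\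
        forall t : R, 0 <= t <= 1 ->
          'd (lio u) (t, q) (0, v) - 'd (lio v) (t, q) (0, u) =
          omega_can (cot (t, q)) (@mdiff R T _ (flat T) (cotangent M) cot (t, q) (0, u))
            (@mdiff R T _ (flat T) (cotangent M) cot (t, q) (0, v))].
Proof.
have [D [oD sub DO sD]] := flow_along_dom phi_flow Sig_dom oW spsi W_Sig.
exists D; split; [exact: oD|exact: sub|by move=> v; exact: liouville_smooth| |].
  move=> q u Wq; apply: eq_int01 => t t01; have Dz := sub t q t01 Wq.
  rewrite (cot_Tmap u sD Dz t01 Wq) (cot_mdiff1 sD _ Dz).
  by [].
move=> q u v Wq; split=> [|t t01]; last first.
  exact: esym (omega_along oD sD u v (sub t q t01 Wq)).
apply: eq_int01 => t t01; have Dz := sub t q t01 Wq.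
rewrite /pull_form2 (cot_Tmap u sD Dz t01 Wq) (cot_Tmap v sD Dz t01 Wq).
exact: (omega_along oD sD u v Dz).
Qed.

Lemma spray_theta_smooth u : smooth W (fun q => spray_theta L Sig phi (psi q) (Tpsi q u) : R^o).
Proof.
have [D [oD sub sl H _]] := spray_theta_along.
apply: (eq_smooth oW _ (int01_smooth oD oW sub (sl u))) => q Wq.
exact: esym (H q u Wq).
Qed.

Lemma spray_form_exact q u v : W q ->
  - spray_form L Sig phi (psi q) (Tpsi q u) (Tpsi q v) =
  'd (fun q => spray_theta L Sig phi (psi q) (Tpsi q v) : R^o) q u -
  'd (fun q => spray_theta L Sig phi (psi q) (Tpsi q u) : R^o) q v.
Proof.
move=> Wq; have [D [oD sub sl H H']] := spray_theta_along.
have cd a b : cont01 (fun t => 'd (lio a) (t, q) (0, b)).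
  move=> t t01; apply: (cont01_slice (h := fun z => 'd (lio a) z (0, b)) _ t01) => s s01.
  exact: smooth_continuous (smooth_dir _ (sl a)) (sub s q s01 Wq).
have dE a b : 'd (fun q => spray_theta L Sig phi (psi q) (Tpsi q a) : R^o) q b =
    int01 (fun t => 'd (lio a) (t, q) (0, b)).
  have [d1 E1] := int01_diff oD oW sub (sl a 1%N) Wq.
  have NW : \forall q' \near q, W q' by exact: open_nbhs_nbhs.
  have NE : \forall q' \near q, (int01 (fun t => lio a (t, q')) : R^o) =
      spray_theta L Sig phi (psi q') (Tpsi q' a).
    by apply: filterS NW => q' Wq'; exact: esym (H q' a Wq').
  have [_ E2] := eq_diff NE d1.
  exact: (etrans (congr1 (@^~ b) E2) (E1 b)).
have [H1 _] := H' q u v Wq.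
apply: (etrans (congr1 -%R H1)).
apply: (etrans (esym (int01N (cont01B (cd u v) (cd v u))))).
apply: (etrans _ (esym (f_equal2 (fun a b : R => a - b) (dE v u) (dE u v)))).
apply: (etrans _ (int01B (cd v u) (cd u v))).
by apply: eq_int01 => t _; exact: opprB.
Qed.

Lemma spray_theta_linear q a u v : W q ->
  spray_theta L Sig phi (psi q) (Tpsi q (a *: u + v)) =
  a * spray_theta L Sig phi (psi q) (Tpsi q u) + spray_theta L Sig phi (psi q) (Tpsi q v).
Proof.
move=> Wq; have [D [oD sub sl H _]] := spray_theta_along.
have cl b : cont01 (fun t => lio b (t, q)).
  apply: cont01_slice => s s01; exact: smooth_continuous (sl b) (sub s q s01 Wq).
apply: (etrans (H q _ Wq)).
apply: (etrans _ (esym (f_equal2 (fun x y : R => a * x + y) (H q u Wq) (H q v Wq)))).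
apply: (etrans _ (int01_lin a (cl u) (cl v))).
by apply: eq_int01 => t _; exact: liouville_lin.
Qed.

Lemma spray_form_bilinear q : W q ->
  (forall a u u' v, spray_form L Sig phi (psi q) (Tpsi q (a *: u + u')) (Tpsi q v) =
    a * spray_form L Sig phi (psi q) (Tpsi q u) (Tpsi q v) +
    spray_form L Sig phi (psi q) (Tpsi q u') (Tpsi q v)) /\
  (forall u v, spray_form L Sig phi (psi q) (Tpsi q u) (Tpsi q v) =
    - spray_form L Sig phi (psi q) (Tpsi q v) (Tpsi q u)).
Proof.
move=> Wq; have [D [oD sub sl H H']] := spray_theta_along.
have cd a b : cont01 (fun t => 'd (lio a) (t, q) (0, b)).
  move=> t t01; apply: (cont01_slice (h := fun z => 'd (lio a) z (0, b)) _ t01) => s s01.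
  exact: smooth_continuous (smooth_dir _ (sl a)) (sub s q s01 Wq).
have ck a b := cont01B (cd a b) (cd b a).
split=> [a u u' v|u v].
  have [I1 E1] := H' q (a *: u + u') v Wq; have [I2 E2] := H' q u v Wq.
  have [I3 E3] := H' q u' v Wq.
  apply: (etrans I1).
  apply: (etrans _ (esym (f_equal2 (fun x y : R => a * x + y) I2 I3))).
  apply: (etrans _ (int01_lin a (ck u v) (ck u' v))).
  apply: eq_int01 => t t01.
  apply: (etrans (E1 t t01)).
  apply: (etrans _ (esym (f_equal2 (fun x y : R => a * x + y) (E2 t t01) (E3 t t01)))).
  have -> : (0, a *: u + u') = a *: ((0, u) : T) + (0, u').
    by congr pair; rewrite /= scaler0 addr0.
  rewrite /mdiff linearP /omega_can /=.
  by rewrite dot_lin dot_linl mulrBr opprD addrACA.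
have [I1 _] := H' q u v Wq; have [I2 _] := H' q v u Wq.
apply: (etrans I1); apply: (etrans _ (esym (congr1 -%R I2))).
apply: (etrans _ (int01N (ck v u))); apply: eq_int01 => t _.
exact: esym (opprB _ _).
Qed.

End FlowForms.

(** * Dual pairs *)

Section DualPairAlgebra.
Context {R : realType}.

Lemma mulmx_tr_rows m1 m2 k (A : 'M[R]_(m1, k)) (B : 'M[R]_(m2, k)) :
  (forall i j, row i A *m (row j B)^T = 0) -> A *m B^T = 0.
Proof.
move=> H; apply/matrixP => i j; have /matrixP/(_ 0 0) := H i j.
by rewrite !mxE => E; rewrite -[RHS]E; apply: eq_bigr => l _; rewrite !mxE.
Qed.

(* The orthogonal of ker S and ker E + ker Om both have dimension
   n + dim (ker S /\ ker Om). *)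
Lemma mxrank_symp_compl n (S E : 'M[R]_(n + n, n)) (Om : 'M[R]_(n + n)) :
  row_full S -> row_full E -> Om^T = - Om ->
  (forall u w : 'rV_(n + n), u *m S = 0 -> w *m E = 0 -> w *m Om *m u^T = 0) ->
  (forall u : 'rV_(n + n), u *m S = 0 -> u *m E = 0 -> u *m Om = 0 -> u = 0) ->
  forall v : 'rV_(n + n), (forall u : 'rV_(n + n), u *m S = 0 -> v *m Om *m u^T = 0) ->
  exists w k : 'rV_(n + n), [/\ v = w + k, w *m E = 0 & k *m Om = 0].
Proof.
move=> fS fE skew orth triv v vV.
pose V := kermx S; pose W := kermx E; pose K := kermx Om.
(* [F] is the orthogonal of [V] for [Om]; subspaces are row spaces. *)
pose F := kermx (Om *m V^T).
have rS : \rank S = n by apply/eqP.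
have rE : \rank E = n by apply/eqP.
have rV' : \rank V = n by rewrite mxrank_ker rS addnK.
have rW : \rank W = n by rewrite mxrank_ker rE addnK.
have rowV i : row i V *m S = 0 by rewrite -row_mul mulmx_ker row0.
have rowW i : row i W *m E = 0 by rewrite -row_mul mulmx_ker row0.
have vF : (v <= F)%MS.
  apply/sub_kermxP; rewrite mulmxA; apply: mulmx_tr_rows => i j.
  rewrite (_ : row i _ = v *m Om); first by apply: vV; exact: rowV.
  by apply/rowP => l; rewrite !mxE (ord1 i).
have WF : (W <= F)%MS.
  apply/sub_kermxP; rewrite mulmxA; apply: mulmx_tr_rows => i j.
  by rewrite row_mul; apply: orth; [exact: rowV|exact: rowW].
have KF : (K <= F)%MS by apply/sub_kermxP; rewrite mulmxA mulmx_ker mul0mx.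
have sF : (W + K <= F)%MS by rewrite addsmx_sub WF.
have cap0 : \rank ((V :&: K) :&: (W :&: K))%MS = 0%N.
  apply/eqP; rewrite mxrank_eq0; apply/eqP/row_matrixP => i; rewrite row0.
  have H : (row i ((V :&: K) :&: (W :&: K))%MS <= (V :&: K) :&: (W :&: K))%MS by exact: row_sub.
  rewrite !sub_capmx in H; case/andP: H => /andP[/sub_kermxP a1 /sub_kermxP a2]
    /andP[/sub_kermxP a3 _].
  exact: triv.
(* By [cap0], V /\ K and W /\ K are independent inside K, so rank (W + K) = n + rank K - rank (W /\
   K) is at least n + rank (V /\ K). This equals rank F, since rank (V Om) = n - rank (V /\ K). *)
have r1 := mxrank_sum_cap (V :&: K)%MS (W :&: K)%MS.
have r2 := mxrank_sum_cap W K.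
have r3 := mxrank_mul_ker V Om.
have sK : ((V :&: K) + (W :&: K) <= K)%MS by rewrite addsmx_sub !capmxSr.
have r4 := mxrankS sK.
have r5 : \rank F = (n + n - \rank (V *m Om))%N.
  rewrite mxrank_ker; congr (_ - _)%N.
  by rewrite -mxrank_tr trmx_mul trmxK skew mulmxN mxrank_opp.
have /leqifP := mxrank_leqif_sup sF; case: ifP => [FWK _|_ lt].
  have /sub_addsmxP[[x y] /= vE] := submx_trans vF FWK.
  exists (x *m W), (y *m K); split=> //.
    by rewrite -mulmxA mulmx_ker mulmx0.
  by rewrite -mulmxA mulmx_ker mulmx0.
exfalso; rewrite cap0 in r1; rewrite rV' in r3; rewrite rW in r2.
rewrite r5 in lt; rewrite -/K in r3.
move: lt r1 r2 r3 r4; lia.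
Qed.

Section Vectors.
Context {n : nat}.
Local Notation E := 'rV[R]_n.
Local Notation T := 'rV[R]_(n + n).
Context {s e : {linear T -> E}} {om : T -> T -> R} {L0 L1 : E -> E -> Prop}.
Hypothesis om_lin : forall a u u' v, om (a *: u + u') v = a * om u v + om u' v.
Hypothesis om_skew : forall u v, om u v = - om v u.
Hypothesis s_surj : forall w, exists v, s v = w.
Hypothesis e_surj : forall w, exists v, e v = w.
Hypothesis orth : forall u w, s u = 0 -> e w = 0 -> om u w = 0.
Hypothesis triv : forall u, s u = 0 -> e u = 0 -> (forall v, om u v = 0) -> u = 0.
Hypothesis fwd0 : forall w p, L0 w p <-> exists v, s v = w /\ forall u, dot p (s u) = om v u.
Hypothesis fwd1 : forall w p, L1 w p <-> exists v, e v = w /\ forall u, dot p (e u) = om v u.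

Let om_linr a u v v' : om u (a *: v + v') = a * om u v + om u v'.
Proof. by rewrite om_skew om_lin [om v u]om_skew [om v' u]om_skew; ring. Qed.

Let om0l v : om 0 v = 0.
Proof. by have := om_lin 1 0 0 v; rewrite scale1r addr0 mul1r => /esym/eqP; rewrite -subr_eq0
  addrK => /eqP. Qed.

Let om_sum_r m (c : 'I_m -> R) (f : 'I_m -> T) u :
  om u (\sum_i c i *: f i) = \sum_i c i * om u (f i).
Proof.
elim/big_rec2: _ => [|i y1 y2 _ <-]; first by rewrite om_skew om0l oppr0.
exact: om_linr.
Qed.

Let Om := \matrix_(i, j) om (delta_mx 0 i) (delta_mx 0 j).

Let OmE (u v : T) : u *m Om *m v^T = (om u v)%:M.
Proof.
have E1 : om u v = \sum_j v 0 j * om u (delta_mx 0 j).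
  by rewrite {1}(row_sum_delta v) om_sum_r.
have E2 w : om u w = \sum_i u 0 i * om (delta_mx 0 i) w.
  rewrite om_skew {1}(row_sum_delta u) om_sum_r -sumrN; apply: eq_bigr => i _.
  by rewrite -mulrN -om_skew.
apply/matrixP => i j; rewrite !ord1 !mxE eqxx mulr1n E1; apply: eq_bigr => l _.
rewrite !mxE E2 mulrC; congr (_ * _); apply: eq_bigr => k _.
by rewrite !mxE.
Qed.

Lemma factor_through (f : T -> R) : (forall a u v, f (a *: u + v) = a * f u + f v) ->
  (forall u, e u = 0 -> f u = 0) -> exists g : E, forall u, dot g (e u) = f u.
Proof.
move=> fl fk; have /fin_all_exists[r Hr] i : exists v : T, e v = delta_mx 0 i by exact: e_surj.
exists (\row_i f (r i)) => u.
have f0 : f 0 = 0 by apply: fk; rewrite linear0.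
have fs (c : 'I_n -> R) : f (\sum_i c i *: r i) = \sum_i c i * f (r i).
  by elim/big_rec2: _ => // i y1 y2 _ <-; exact: fl.
pose w := \sum_i e u 0 i *: r i.
have ew : e w = e u.
  rewrite /w linear_sum [RHS]row_sum_delta; apply: eq_bigr => i _.
  by rewrite linearZ Hr.
have -> : f u = f w.
  have := fl 1 (u - w) w; rewrite scale1r subrK mul1r => ->.
  by rewrite (fk (u - w)) ?add0r // linearB ew subrr.
by rewrite fs /dot; apply: eq_bigr => i _; rewrite mxE mulrC.
Qed.

(** The forward condition for s turns b into v' with s^* b = i_v' om. This vanishes on ker s, so v'
    = w + k with w in ker e and k in ker om. The difference v' - v lies in ker s, hence its
    contraction with om vanishes on ker e and descends to the covector g. *)
Lemma dual_pair_transfer v b : L0 (s v) b ->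
  exists g, L1 (e v) (- g) /\ forall u, dot b (s u) = dot g (e u) + om v u.
Proof.
move=> /fwd0[v' [sv' bv']].
have lE (f : {linear T -> E}) u : u *m lin1_mx f = f u by exact: mul_rV_lin1.
have full (f : {linear T -> E}) : (forall w, exists v, f v = w) -> row_full (lin1_mx f).
  move=> fs; apply/row_fullP; have /fin_all_exists[r Hr] i := fs (delta_mx 0 i).
  exists (\matrix_i r i); apply/row_matrixP => i.
  by rewrite row_mul rowK lE Hr rowE mulmx1.
have [w [k [vE w0 k0]]] : exists w k : T, [/\ v' = w + k, w *m lin1_mx e = 0 & k *m Om = 0].
  apply: (@mxrank_symp_compl n (lin1_mx s) (lin1_mx e) Om).
  - exact: full.
  - exact: full.
  - by apply/matrixP => i j; rewrite !mxE om_skew.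
  - move=> u w; rewrite !lE OmE => su ew; rewrite om_skew orth //.
    by apply/matrixP => i j; rewrite !mxE oppr0 mul0rn.
  - move=> u; rewrite !lE => su eu uO; apply: triv => // z.
    by have := OmE u z; rewrite uO mul0mx => /matrixP/(_ 0 0); rewrite !mxE eqxx mulr1n.
  - move=> u; rewrite lE OmE -bv' => ->; rewrite dot0r.
    by apply/matrixP => i j; rewrite !mxE mul0rn.
rewrite lE in w0.
have kO z : om k z = 0.
  by have := OmE k z; rewrite k0 mul0mx => /matrixP/(_ 0 0); rewrite !mxE eqxx mulr1n.
pose u0 := v' - v.
have su0 : s u0 = 0 by rewrite linearB sv' subrr.
have [g Hg] : exists g : E, forall u, dot g (e u) = om u0 u.
  by apply: factor_through => [a x y|x ex]; [exact: om_linr|exact: orth].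
have v'E : v' = 1 *: u0 + v by rewrite scale1r subrK.
exists g; split; last by move=> u; rewrite bv' Hg v'E om_lin mul1r.
(* [e] sends [k] and [v'] to the same vector, so the witness goes to [e v' - e u0], which is [e v].
   As [k] is in the kernel of [om], the contraction is that of [- u0], namely e^* (- g). *)
apply/fwd1; exists ((-1) *: u0 + k); split.
  have ev' : e v' = e k by rewrite vE linearD w0 add0r.
  by rewrite linearP scaleN1r /u0 linearB ev' opprB subrK.
by move=> u; rewrite om_lin kO addr0 mulN1r dotNl Hg.
Qed.

End Vectors.
End DualPairAlgebra.

#[local] Opaque Tmap.

Section DeriveCurves.
Context {R : realType}.

Lemma is_derive_unique {V W : normedModType R} (f : V -> W) x v a b :
  is_derive x v f a -> is_derive x v f b -> a = b.
Proof. by move=> [_ <-] [_ <-]. Qed.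

Lemma is_derive_linear {V W : normedModType R} {FV : findim V} (L : {linear V -> W})
    (c : R -> V) (t : R) w :
  is_derive (t : R^o) (1 : R^o) (c : R^o -> V) w ->
  is_derive (t : R^o) (1 : R^o) (fun s : R^o => L (c s)) (L w).
Proof.
move=> dc; have cL : continuous L by exact: fd_lin_continuous.
have dL : differentiable L (c t) by exact: linear_differentiable.
have E : 'd L (c t) w = L w by exact: (congr1 (@^~ w) (diff_lin (c t) cL)).
by rewrite -E; exact: is_derive_comp.
Qed.

Lemma is_derive_affine {V : normedModType R} {FV : findim V} (p d : V) :
  is_derive (0 : R^o) (1 : R^o) (fun s : R^o => p + s *: d) d.
Proof. exact: (line_vel p d).2. Qed.

End DeriveCurves.

Section TangentFlat.
Context {R : realType} {Vd V : normedModType R} {A : atlas V}.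
Context {Fd : findim Vd} {FV : findim V} {CA : charted A}.
Variables (W : set Vd) (psi : Vd -> A).
Hypothesis oW : open W.
Hypothesis spsi : @smooth_map R Vd _ (flat Vd) A W psi.
Local Notation Tpsi := (@Tmap R Vd (flat Vd) _ A W psi).

Lemma Tmap_flat_linear q a u v : W q -> Tpsi q (a *: u + v) = a *: Tpsi q u + Tpsi q v.
Proof.
move=> Wq; apply: (Tmap_linear (A := flat Vd)) => //;
  by eexists; exact: (line_curve _ oW Wq).
Qed.

Lemma Tmap_flat_tangent (S : set A) q u : (forall q, W q -> S (psi q)) -> W q ->
  tangent S (psi q) (Tpsi q u).
Proof.
move=> WS Wq; apply: (Tmap_tangent (A := flat Vd) spsi Wq WS).
by eexists; exact: (line_curve _ oW Wq).
Qed.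

Lemma Tmap_flat_vel q u : W q ->
  has_velocity (fun s : R => psi (q + s *: u)) 0 (Tpsi q u).
Proof. move=> Wq; exact: (Tmap_vel (A := flat Vd) spsi Wq (line_curve u oW Wq)). Qed.

End TangentFlat.

(** * Frames of L and the tangent spaces of Sigma *)

Section LocalFrame.
Context {R : realType} {n : nat} {M : manifold R n}.
Local Notation E := 'rV[R]_n.
Local Notation pr1 := (@pr1 R n).
Local Notation pr2 := (@pr2 R n).
Local Notation pr3 := (@pr3 R n).
Local Notation cpr1 := (@cpr1 R n).
Local Notation cpr2 := (@cpr2 R n).
Context {L : set (pontryagin M)} {Sig : set (pontryagin M)}.
Hypothesis L_bundle : subbundle n setT L.
Hypothesis L_lag : lagrangian L.
Hypothesis Sig_open : exists U, mopen U /\ Sig = L `&` U.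

Lemma pair_sum m (c : 'I_m -> R) (f : 'I_m -> E * E) :
  \sum_i c i *: f i = (\sum_i c i *: (f i).1, \sum_i c i *: (f i).2).
Proof. by elim/big_rec3: _ => // i y1 y2 y3 _ ->. Qed.

Lemma move_vec_sum (x y z : M) m (c : 'I_m -> R) (f : 'I_m -> E) :
  move_vec x y z (\sum_i c i *: f i) = \sum_i c i *: move_vec x y z (f i).
Proof.
rewrite /move_vec linear_sum; apply: eq_bigr => i _; exact: linearZ.
Qed.

Lemma move_cov_sum (x y z : M) m (c : 'I_m -> R) (f : 'I_m -> E) :
  move_cov x y z (\sum_i c i *: f i) = \sum_i c i *: move_cov x y z (f i).
Proof.
apply: dot_ext => v; rewrite dot_move_cov !dot_suml; apply: eq_bigr => i _.
by rewrite dot_move_cov.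
Qed.

(** [eps] gives the frame in a single bundle chart, that over [x0]. Each section is smooth there on
    its own neighborhood of the point; these finitely many neighborhoods are intersected to obtain
    [O]. *)
Lemma local_frame (x0 : M) : exists (O : set E) (e : 'I_n -> M -> E * E) (eps : 'I_n -> E -> E *
  E),
  [/\ open O, O (coord x0 x0) /\ O `<=` coord x0 @` dom x0,
      forall i, smooth O (eps i),
      forall y, dom x0 y -> O (coord x0 y) -> is_basis (fiber L y) (e ^~ y)
    & forall i y, dom x0 y -> O (coord x0 y) ->
       eps i (coord x0 y) = (move_vec y x0 y (e i y).1, move_cov y x0 y (e i y).2)].
Proof.
have [_ /(_ x0 I)[U [e [oU Ux0 se eb]]]] := L_bundle.
pose a : pontryagin M := (x0, 0, 0).
pose F i : M -> pontryagin M := fun y => (y, (e i y).1, (e i y).2).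
have oTU : mopen (setT `&` U) by rewrite setTI.
have xx : dom x0 x0 by exact: ch_dom.
have sF i : @smooth_rep R _ _ M (pontryagin M) x0 a (F i) x0.
  apply: smooth_at_rep => //.
  by apply: (smooth_map_at oTU (se i)).
pose G i (q : E) := @coord _ _ (pontryagin M) a (F i (param x0 q)).
pose P i q := exists N1 : set E, [/\ open N1, N1 q & smooth N1 (G i)].
pose DU := coord x0 @` (U `&` dom x0).
have n0 i : \forall q \near coord x0 x0, P i q.
  have [N1 [op1 N1x _ _ sN1]] := sF i.
  have HN : \forall q \near coord x0 x0, N1 q by exact: open_nbhs_nbhs.
  by apply: filterS HN => q N1q; exists N1.
have n1 : \forall q \near coord x0 x0, forall i, P i q.
  exact: (@filter_forall _ _ P (nbhs (coord x0 x0)) _ n0).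
have n2 : \forall q \near coord x0 x0, DU q by exact: mopen_nbhs.
have nO := filterI n1 n2.
pose O := interior [set q | (forall i, P i q) /\ DU q].
have oO : open O by exact: open_interior.
have Osub q : O q -> (forall i, P i q) /\ DU q.
  by move=> Oq; exact: (interior_subset Oq).
have OU y : dom x0 y -> O (coord x0 y) -> U y.
  by move=> xy /Osub[_ [z [Uz xz] /(coord_inj xz xy) <-]].
exists O, e, (fun i q => ((G i q).1.2, (G i q).2)).
split; [exact: oO|split; [exact: nO|]| | |].
- by move=> q /Osub[_ [y [_ xy] <-]]; exists y.
- move=> i; have sG : smooth O (G i).
    by apply: smooth_local => q /Osub[/(_ i)[N1 [_ N1q s1]] _]; exists N1.
  move: (G i) sG => g sG.
  have s2 : smooth O (fun q => pr2 (g q)) by exact: smooth_lin_comp.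
  have s3 : smooth O (fun q => pr3 (g q)) by exact: smooth_lin_comp.
  exact: (smooth_pair oO s2 s3).
- by move=> y xy Oy; apply: eb; split=> //; exact: OU.
by move=> i y xy Oy; rewrite /G ch_param.
Qed.

(** A point of [L] near a is given by n coordinates of its base point and n coefficients in the
    frame. This identifies the velocities of curves in Sigma with R^(n + n), the setting of the rank
    count for dual pairs. *)
Lemma L_param (a : pontryagin M) : Sig a ->
  exists (W : set 'rV[R]_(n + n)) (psi : 'rV[R]_(n + n) -> pontryagin M) q0,
  let T := @Tmap R 'rV[R]_(n + n) (flat _) _ (pontryagin M) W psi q0 in
  [/\ open W /\ W q0,
      psi q0 = a /\ forall q, W q -> Sig (psi q),
      @smooth_map R 'rV[R]_(n + n) _ (flat _) (pontryagin M) W psi,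
      forall v, tangent Sig a v -> exists u, v = T u
    & forall u, T u = 0 -> u = 0].
Proof.
move=> Sa; have [U [oU SE]] := Sig_open.
set x0 := a.1.1; have [] := local_frame x0.
move=> O [e [eps [oO [Ox OD] seps eb epsE]]].
have xx : dom x0 x0 by exact: ch_dom.
pose y (z : 'rV[R]_(n + n)) : M := param x0 (lsubmx z).
pose psi (z : 'rV[R]_(n + n)) : pontryagin M :=
  (y z, \sum_i rsubmx z 0 i *: (e i (y z)).1, \sum_i rsubmx z 0 i *: (e i (y z)).2).
pose ll : {linear 'rV[R]_(n + n) -> E} := lsubmx.
pose rl : {linear 'rV[R]_(n + n) -> E} := rsubmx.
pose W0 : set 'rV[R]_(n + n) := ll @^-1` O.
pose proof (open_linear_preimage ll oO : open W0) as oW0.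
have W0y z : W0 z -> dom x0 (y z) /\ coord x0 (y z) = lsubmx z.
  by move=> /OD; exact: coordK.
have cpsi z : W0 z -> @coord _ _ (pontryagin M) a (psi z) =
    (lsubmx z, \sum_i rsubmx z 0 i *: (eps i (lsubmx z)).1,
       \sum_i rsubmx z 0 i *: (eps i (lsubmx z)).2).
  move=> Wz; have [d c] := W0y z Wz.
  apply: (f_equal2 pair (f_equal2 pair _ _) _); first exact: c.
    apply: (etrans (move_vec_sum _ _ _ _ _)); apply: eq_bigr => i _.
    by rewrite -c epsE // c.
  apply: (etrans (move_cov_sum _ _ _ _ _)); apply: eq_bigr => i _.
  by rewrite -c epsE // c.
have oT : @mopen R _ (flat 'rV[R]_(n + n)) W0 by apply/mopen_flat.
have sc i : smooth W0 (fun z => rl z 0 i : R^o).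
  by apply: smooth_entry => //; exact: smooth_linear.
have se i : smooth W0 (fun z => eps i (ll z)).
  by apply: (smooth_comp oW0 _ _ (seps i)) => //; exact: smooth_linear.
have se1 i : smooth W0 (fun z => cpr1 (eps i (ll z))) by exact: smooth_lin_comp.
have se2 i : smooth W0 (fun z => cpr2 (eps i (ll z))) by exact: smooth_lin_comp.
have sl : smooth W0 ll by exact: smooth_linear.
have s1 : smooth W0 (fun z => \sum_i (rl z 0 i : R^o) *: cpr1 (eps i (ll z))).
  by apply: smooth_sum => // i; apply: smooth_scale.
have s2 : smooth W0 (fun z => \sum_i (rl z 0 i : R^o) *: cpr2 (eps i (ll z))).
  by apply: smooth_sum => // i; apply: smooth_scale.
have sat z : W0 z -> @smooth_at R _ _ (flat 'rV[R]_(n + n)) (pontryagin M) psi z.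
  move=> Wz; have [d _] := W0y z Wz.
  apply: (@rep_smooth_at _ _ _ (flat 'rV[R]_(n + n)) (pontryagin M) _ _ _ _ z a) => //.
  exists W0; split.
  - exact: oW0.
  - exact: Wz.
  - by move=> q _; exists q.
  - by move=> q /W0y[].
  apply: (eq_smooth oW0 _ (smooth_pair oW0 (smooth_pair oW0 sl s1) s2)) => q Wq.
  exact: esym (cpsi q Wq).
have psiL z : W0 z -> L (psi z).
  move=> Wz; have [d c] := W0y z Wz.
  have Oy : O (coord x0 (y z)) by rewrite c.
  have [/(_ (\sum_i rsubmx z 0 i *: e i (y z)))[_ H] _] := eb _ d Oy.
  have := H (ex_intro _ (fun i => rsubmx z 0 i) erefl).
  by rewrite pair_sum.
have sW0 : @smooth_map R _ _ (flat 'rV[R]_(n + n)) (pontryagin M) W0 psi.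
  by apply: smooth_at_map => z; exact: sat.
have [N [/mopen_flat oN NU]] := smooth_map_preimage sW0 oU.
have oW : open (W0 `&` N) by exact: openI.
have sW : @smooth_map R _ _ (flat 'rV[R]_(n + n)) (pontryagin M) (W0 `&` N) psi.
  by apply: (smooth_map_sub (A := flat 'rV[R]_(n + n)) _ sW0) => z [].
have La : L a by move: Sa; rewrite SE => -[].
have aE : (x0, a.1.2, a.2) = a by rewrite /x0; case: (a) => [[? ?] ?].
have [c0 c0E] : exists c : 'I_n -> R, (a.1.2, a.2) = \sum_i c i *: e i x0.
  have [/(_ (a.1.2, a.2))[H _] _] := eb _ xx Ox; apply: H.
  by change (L (x0, a.1.2, a.2)); rewrite aE.
pose q0 : 'rV[R]_(n + n) := row_mx (coord x0 x0) (\row_i c0 i).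
have lq0 : lsubmx q0 = coord x0 x0 by exact: row_mxKl.
have rq0 : rsubmx q0 = \row_i c0 i by exact: row_mxKr.
have yq0 : y q0 = x0 by rewrite /y lq0 ch_param.
have pq0 : psi q0 = a.
  rewrite /psi yq0 rq0.
  under eq_bigr do rewrite mxE.
  under [X in (_, X)]eq_bigr do rewrite mxE.
  by move: c0E; rewrite pair_sum => -[<- <-].
have W0q0 : W0 q0 by rewrite /W0 /preimage /= lq0.
have Wq0 : (W0 `&` N) q0.
  split=> //; apply/(NU q0 W0q0); rewrite pq0.
  by move: Sa; rewrite SE => -[].
have WSig q : (W0 `&` N) q -> Sig (psi q).
  by move=> [Wq Nq]; rewrite SE; split; [exact: psiL|apply/(NU q Wq)].
pose T := @Tmap R 'rV[R]_(n + n) (flat _) _ (pontryagin M) (W0 `&` N) psi q0.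
have q00 u : q0 + 0 *: u = q0 by rewrite scale0r addr0.
have dT u : is_derive (0 : R^o) (1 : R^o)
    (fun s : R^o => @coord _ _ (pontryagin M) a (psi (q0 + (s : R) *: u))) (T u).
  have [_ vT] := Tmap_flat_vel oW sW u Wq0.
  by rewrite q00 pq0 in vT.
have nW0 u : \forall s \near (0 : R), W0 (q0 + s *: u).
  apply: (vel_mopen (A := flat 'rV[R]_(n + n)) (line_vel q0 u)) => //.
  by rewrite q00.
have lE u (s : R) : lsubmx (q0 + s *: u) = coord x0 x0 + s *: lsubmx u.
  by rewrite -lq0 addrC [RHS]addrC; exact: (linearP ll).
have rE u (s : R) i : rsubmx (q0 + s *: u) 0 i = c0 i + s * rsubmx u 0 i.
  have -> : rsubmx (q0 + s *: u) = s *: rsubmx u + rsubmx q0.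
    by rewrite addrC; exact: (linearP rl).
  by rewrite rq0 !mxE addrC.
have T1 u : (T u).1.1 = lsubmx u.
  have NE : \forall s \near (0 : R), coord x0 x0 + s *: lsubmx u =
      pr1 (@coord _ _ (pontryagin M) a (psi (q0 + s *: u))).
    by apply: filterS (nW0 u) => s Ws; rewrite (cpsi _ Ws) -lE.
  pose proof (near_eq_is_derive NE (is_derive_affine (coord x0 x0) (lsubmx u))) as d3.
  pose proof (is_derive_linear pr1 (dT u)) as d1.
  exact: (is_derive_unique d1 d3).
have eps0 i : eps i (coord x0 x0) = e i x0.
  by rewrite epsE // move_vec_id // move_cov_id // -surjective_pairing.
have sumE (u : 'rV[R]_(n + n)) (s : R) (f : 'I_n -> E) :
    \sum_i rsubmx (q0 + s *: u) 0 i *: f i =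
    \sum_i c0 i *: f i + s *: \sum_i rsubmx u 0 i *: f i.
  rewrite scaler_sumr -big_split; apply: eq_bigr => i _.
  by rewrite rE scalerDl scalerA.
have T2 u : lsubmx u = 0 ->
    T u = (0, \sum_i rsubmx u 0 i *: (e i x0).1, \sum_i rsubmx u 0 i *: (e i x0).2).
  move=> lu; set d := (_, _, _).
  pose p : E * E * E := (coord x0 x0, \sum_i c0 i *: (e i x0).1, \sum_i c0 i *: (e i x0).2).
  have NE : \forall s \near (0 : R), p + s *: d =
      @coord _ _ (pontryagin M) a (psi (q0 + s *: u)).
    apply: filterS (nW0 u) => s Ws; rewrite (cpsi _ Ws) lE lu scaler0 addr0.
    apply: (f_equal2 pair (f_equal2 pair _ _) _).
    - by rewrite /= scaler0 addr0.
    - by rewrite /= sumE; congr (_ + _ *: _); apply: eq_bigr => i _; rewrite eps0.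
    - by rewrite /= sumE; congr (_ + _ *: _); apply: eq_bigr => i _; rewrite eps0.
  apply: (is_derive_unique (dT u)).
  apply: (near_eq_is_derive NE); exact: is_derive_affine.
(* As [L] is Lagrangian, the functions [G i] vanish exactly on [L]. *)
pose G i (c : E * E * E) : R^o :=
  dot (pr3 c) (cpr1 (eps i (pr1 c))) + dot (cpr2 (eps i (pr1 c))) (pr2 c).
pose ca := @coord _ _ (pontryagin M) a a.
have caE : ca = (coord x0 x0, a.1.2, a.2) by exact: coord_self.
pose DO : set (E * E * E) := pr1 @^-1` O.
pose proof (open_linear_preimage pr1 oO : open DO) as oDO.
have DOca : DO ca by rewrite /DO /preimage /=; exact: Ox.
have p1 : smooth DO pr1 by exact: smooth_linear.
have p2 : smooth DO pr2 by exact: smooth_linear.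
have p3 : smooth DO pr3 by exact: smooth_linear.
have sep i : smooth DO (fun c => eps i (pr1 c)) by exact: (smooth_comp oDO _ p1 (seps i)).
have sG i : smooth DO (G i).
  apply: smoothD => //; apply: smooth_dot => //; exact: smooth_lin_comp.
have dG i : differentiable (G i) ca by exact: smooth_differentiable (sG i) DOca.
(* A curve in Sigma stays in [L], where [G i] is constantly 0, so its velocity is in the kernel of
   the differential. *)
have star v : tangent Sig a v -> forall i, 'd (G i) ca v = 0.
  move=> [g [g0 gS _ vg]] i.
  have [_ dv] := vg; rewrite g0 in dv.
  have mN : @mopen _ _ (pontryagin M) [set b | dom a b /\ DO (coord a b)] by exact: mopen_chart.
  have Na : dom a (g 0) /\ DO (@coord _ _ (pontryagin M) a (g 0)) by rewrite g0; split=> //;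
    exact: ch_dom.
  have NN : \forall s \near (0 : R), dom a (g s) /\ DO (@coord _ _ (pontryagin M) a (g s)).
    exact: (vel_mopen vg mN Na).
  have NZ : \forall s \near (0 : R), (0 : R^o) = G i (@coord _ _ (pontryagin M) a (g s)).
    apply: filterS2 gS NN => s Ss [ds Os].
    have Ls : L (g s) by move: Ss; rewrite SE => -[].
    move: (g s) Ls ds Os => [[z v'] p] Lz az Oz; apply/esym.
    have zz : dom z z by exact: ch_dom.
    have [ez1 ez2] := eb z az Oz.
    have Fe : fiber L z (e i z).
      apply/ez1; exists (fun j => (i == j)%:R); rewrite (bigD1 i) //= eqxx scale1r.
      by rewrite big1 ?addr0 // => j ji; rewrite eq_sym (negbTE ji) scale0r.
    have /L_lag/(_ _ Fe) /= H0 : fiber L z (v', p) by [].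
    rewrite /G /= epsE //.
    apply: (etrans _ H0); congr (_ + _).
      apply: (etrans (dot_move_cov _ _ _ _ _)); congr dot.
      exact: (etrans (move_vec_comp _ zz az zz) (move_vec_id _ zz)).
    apply: (etrans (dot_move_cov _ _ _ _ _)); congr dot.
    exact: (etrans (move_vec_comp _ zz az zz) (move_vec_id _ zz)).
  have dG' : differentiable (G i) (@coord _ _ (pontryagin M) a (g 0)) by rewrite g0; exact: dG.
  pose proof (is_derive_comp dv dG') as d1.
  have d2 := near_eq_is_derive NZ (is_derive_cst (0 : R^o) (0 : R^o) (1 : R^o)).
  rewrite g0 in d1; exact: (is_derive_unique d1 d2).
have star2 i (v2 v3 : E) : 'd (G i) ca (0, v2, v3) = dot v3 (e i x0).1 + dot (e i x0).2 v2.
  have ca0 : ca + 0 *: ((0, v2, v3) : E * E * E) = ca by rewrite scale0r addr0.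
  have dG0 : differentiable (G i) (ca + 0 *: ((0, v2, v3) : E * E * E)) by rewrite ca0.
  have d1 := line_derive dG0; rewrite ca0 in d1.
  pose b : R^o := dot v3 (e i x0).1 + dot (e i x0).2 v2.
  have NE : \forall s \near (0 : R), G i ca + s *: b = G i (ca + s *: ((0, v2, v3) : E * E * E)).
    apply: filterS (@filterT _ (nbhs (0 : R)) _) => s _.
    rewrite /G caE /= scaler0 addr0 eps0 dotDl dotZl dotDr dotZr.
    by rewrite /b [s *: _]mulrDr addrACA.
  exact: (is_derive_unique d1 (near_eq_is_derive NE (is_derive_affine (G i ca) b))).
exists (W0 `&` N), psi, q0; rewrite -/T; split.
- by split.
- by split.
- exact: sW.
(* [u1] carries the base component of v. The rest [w] is vertical and, by [star2], orthogonal to the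
   frame; maximal isotropy puts it in the fiber of [L], where it is a combination of the frame, that
   is, [T u2]. *)
- move=> v tv; pose u1 : 'rV[R]_(n + n) := row_mx v.1.1 0.
  have tT : tangent Sig a (T u1).
    pose proof (Tmap_flat_tangent oW sW u1 WSig Wq0) as tp; by rewrite pq0 in tp.
  pose w := v - T u1.
  have w1 : w.1.1 = 0 by rewrite /w /= T1 row_mxKl subrr.
  have wG i : dot w.2 (e i x0).1 + dot (e i x0).2 w.1.2 = 0.
    rewrite -star2; have -> : (0, w.1.2, w.2) = w by rewrite -w1; case: (w) => [[? ?] ?].
    by rewrite /w linearB (star v tv i) (star _ tT i) subrr.
  have : fiber L x0 (w.1.2, w.2).
    apply/L_lag => w' /(eb x0 xx Ox).1[c ->] /=.
    rewrite pair_sum /= dot_sumr dot_suml -big_split big1 //= => i _.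
    by rewrite -mulrDr wG mulr0.
  move=> /(eb x0 xx Ox).1[c]; rewrite pair_sum => wE.
  have wE1 : w.1.2 = _ := congr1 fst wE; have wE2 : w.2 = _ := congr1 snd wE.
  pose u2 : 'rV[R]_(n + n) := row_mx 0 (\row_i c i).
  have Tu2 : T u2 = w.
    rewrite T2 ?row_mxKl // row_mxKr.
    have -> : w = (w.1.1, w.1.2, w.2) by case: (w) => [[? ?] ?].
    rewrite w1 wE1 wE2; congr (_, _, _); apply: eq_bigr => i _; by rewrite mxE.
  exists (1 *: u1 + u2); rewrite /T (Tmap_flat_linear oW sW _ _ _ Wq0) -/T scale1r Tu2.
  by rewrite /w addrC subrK.
move=> u Tu0; have lu : lsubmx u = 0 by rewrite -T1 Tu0.
have := T2 u lu; rewrite Tu0 => -[z1 z2].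
have r0 := (eb x0 xx Ox).2 (fun i => rsubmx u 0 i).
have ru : rsubmx u = 0.
  apply/rowP => i; rewrite [RHS]mxE; apply: r0.
  by rewrite pair_sum -z1 -z2.
by rewrite -[u]hsubmxK lu ru row_mx0.
Qed.

End LocalFrame.

(** * The correspondence of covectors on Sigma *)

Section Duality.
Context {R : realType} (S : saturation R).
Local Notation n := (sdim S).
Local Notation M := (sM S).
Local Notation L := (@sL R S).
Local Notation Sig := (@sSig R S).
Local Notation phi := (@sphi R S).
Local Notation E := 'rV[R]_n.
Local Notation e := (spray_exp phi).
Local Notation om := (spray_form L Sig phi).
Local Notation Ts := (@Tmap R _ (pontryagin M) _ M Sig (@base R n M)).
Local Notation Te := (@Tmap R _ (pontryagin M) _ M Sig e).

Lemma Sig_openP : exists U, mopen U /\ Sig = L `&` U.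
Proof. by have [] := Sig_domain S. Qed.

Lemma base_smooth_map : @smooth_map R _ _ (pontryagin M) M Sig (@base R n M).
Proof. by have [[[]]] := Sig_dual_pair S. Qed.

Lemma exp_smooth_map : @smooth_map R _ _ (pontryagin M) M Sig e.
Proof. by have [[_ []]] := Sig_dual_pair S. Qed.

Lemma Sig_param a : Sig a ->
  exists (W : set 'rV[R]_(n + n)) (psi : 'rV[R]_(n + n) -> pontryagin M) q0,
  let T := @Tmap R 'rV[R]_(n + n) (flat _) _ (pontryagin M) W psi q0 in
  [/\ open W /\ W q0,
      psi q0 = a /\ forall q, W q -> Sig (psi q),
      @smooth_map R 'rV[R]_(n + n) _ (flat _) (pontryagin M) W psi,
      forall v, tangent Sig a v <-> exists u, v = T u
    & forall u, T u = 0 -> u = 0].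
Proof.
move=> Sa; have [Lb Llag _] := L_dirac S.
have [W [psi [q0 [[oW Wq0] [pq WS] sp surj inj]]]] := L_param Lb Llag Sig_openP Sa.
exists W, psi, q0; split=> //; move=> v; split; first exact: surj.
move=> [u ->]; rewrite -pq; exact: (Tmap_flat_tangent oW sp u WS Wq0).
Qed.

Lemma theta_linear a c u v : Sig a -> tangent Sig a u -> tangent Sig a v ->
  spray_theta L Sig phi a (c *: u + v) =
  c * spray_theta L Sig phi a u + spray_theta L Sig phi a v.
Proof.
move=> Sa; have [W [psi [q0 [[oW Wq0] [pq WS] sp surj _]]]] := Sig_param Sa.
move=> /surj[u' ->] /surj[v' ->]; rewrite -(Tmap_flat_linear oW sp _ _ _ Wq0) -pq.
exact: (spray_theta_linear (phi_flow S) (Sig_domain S) oW sp WS).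
Qed.

(** A parametrization transports everything to R^(n + n), where the algebra of dual pairs applies.
    The two halves differ by exchanging the legs of the dual pair. *)
Lemma duality a v : Sig a -> tangent Sig a v ->
  (forall b, L (base a, Ts a v, b) -> exists g, L (e a, Te a v, g) /\
     forall u, tangent Sig a u -> dot b (Ts a u) = dot g (Te a u) + om a v u) /\
  (forall g, L (e a, Te a v, g) -> exists b, L (base a, Ts a v, b) /\
     forall u, tangent Sig a u -> dot b (Ts a u) = dot g (Te a u) + om a v u).
Proof.
move=> Sa tv; have [W [psi [q0 [[oW Wq0] [pq WS] sp surj inj]]]] := Sig_param Sa.
pose T u := @Tmap R 'rV[R]_(n + n) (flat _) _ (pontryagin M) W psi q0 u.
have tT u : tangent Sig a (T u) by apply/surj; exists u.
have Tl c u w : T (c *: u + w) = c *: T u + T w by exact: (Tmap_flat_linear oW sp).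
have lin (f : pontryagin M -> M) : @smooth_map R _ _ (pontryagin M) M Sig f ->
    linear (fun u => @Tmap R _ (pontryagin M) _ M Sig f a (T u)).
  move=> sf c u w; rewrite Tl; apply: Tmap_linear => //.
  by rewrite -Tl.
pose s' : {linear 'rV[R]_(n + n) -> E} := HB.pack (fun u => Ts a (T u))
  (GRing.isLinear.Build R 'rV[R]_(n + n) E *:%R _ (lin _ base_smooth_map)).
pose e' : {linear 'rV[R]_(n + n) -> E} := HB.pack (fun u => Te a (T u))
  (GRing.isLinear.Build R 'rV[R]_(n + n) E *:%R _ (lin _ exp_smooth_map)).
pose om' u w := om a (T u) (T w).
have [ol sk] : (forall c u u' w, om' (c *: u + u') w = c * om' u w + om' u' w) /\
    (forall u w, om' u w = - om' w u).
  pose proof (spray_form_bilinear (phi_flow S) (Sig_domain S) oW sp WS Wq0) as H.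
  by rewrite pq in H.
have [[ss se] fs fe orth triv] := Sig_dual_pair S.
have surj_s w : exists u, s' u = w.
  by case: ss => _ _ /(_ a Sa w)[x [/surj[u ->] <-]]; exists u.
have surj_e w : exists u, e' u = w.
  by case: se => _ _ /(_ a Sa w)[x [/surj[u ->] <-]]; exists u.
have orth' u w : s' u = 0 -> e' w = 0 -> om' u w = 0 by move=> su ew; apply: orth.
have orth'' u w : e' u = 0 -> s' w = 0 -> om' u w = 0.
  by move=> eu sw; rewrite sk orth' ?oppr0.
have triv' u : s' u = 0 -> e' u = 0 -> (forall w, om' u w = 0) -> u = 0.
  move=> su eu ou; apply: inj; apply: (triv a) => //.
  by move=> w /surj[w' ->]; exact: ou.
have triv'' u : e' u = 0 -> s' u = 0 -> (forall w, om' u w = 0) -> u = 0.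
  by move=> eu su; exact: triv'.
have fwd0 w p : L (base a, w, p) <-> exists x, s' x = w /\ forall u, dot p (s' u) = om' x u.
  split=> [/(fs a Sa)[x [/surj[u ->] Eu [_ H]]]|[x [xw H]]].
    by exists u; split=> // z; exact: (H (T z) (tT z)).
  apply/(fs a Sa); exists (T x); split; [exact: tT|exact: xw|split; [exact: tT|]].
  by move=> u /surj[u' ->]; exact: (H u').
have fwd1 w p : opp_dirac L (e a, w, p) <-> exists x, e' x = w /\ forall u, dot p (e' u) = om' x
  u.
  split=> [/(fe a Sa)[x [/surj[u ->] Eu [_ H]]]|[x [xw H]]].
    by exists u; split=> // z; exact: (H (T z) (tT z)).
  apply/(fe a Sa); exists (T x); split; [exact: tT|exact: xw|split; [exact: tT|]].
  by move=> u /surj[u' ->]; exact: (H u').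
have [v' vE] := (surj v).1 tv.
split=> [b Lb|g Lg].
  have Lb' : L (base a, s' v', b) by rewrite /= /T -vE.
  have [g [Lg H]] := @dual_pair_transfer R n s' e' om' (fun w p => L (base a, w, p))
    (fun w p => opp_dirac L (e a, w, p)) ol sk surj_s surj_e orth' triv' fwd0 fwd1 v' b Lb'.
  exists g; split; first by move: Lg; rewrite /opp_dirac /= opprK /T -vE.
  by move=> u /surj[u' ->]; rewrite vE; exact: H.
(* With the legs exchanged the transfer starts from - L, so [g] enters with a sign and the covector
   found over [base] is returned with one. *)
have Lg' : opp_dirac L (e a, e' v', - g) by rewrite /opp_dirac /= opprK /T -vE.
have [b [Lb H]] := @dual_pair_transfer R n e' s' om' (fun w p => opp_dirac L (e a, w, p))
  (fun w p => L (base a, w, p)) ol sk surj_e surj_s orth'' triv'' fwd1 fwd0 v' (- g) Lg'.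
exists (- b); split; first by move: Lb; rewrite /= /T -vE.
move=> u /surj[u' ->]; have := H u'; rewrite !dotNl vE /= => Hu.
by rewrite -[dot g _]opprK Hu opprD addrNK.
Qed.

End Duality.

(** * The local Dirac saturation *)

Section PartOne.
Context {R : realType} (S : saturation R).
Local Notation n := (sdim S).
Local Notation M := (sM S).
Local Notation L := (@sL R S).
Local Notation Sig := (@sSig R S).
Local Notation X := (@sX R S).
Local Notation P := (@sP R S).
Local Notation phi := (@sphi R S).
Local Notation e := (spray_exp phi).
Local Notation om := (spray_form L Sig phi).
Local Notation CS := (@CSig R S).
Local Notation Ts := (@Tmap R _ (pontryagin M) _ M Sig (@base R n M)).
Local Notation Te := (@Tmap R _ (pontryagin M) _ M Sig e).

Lemma CSig_Sig a : CS a -> Sig a. Proof. by case. Qed.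

Lemma CSig_X a : CS a -> X (base a).
Proof. by case=> Ca _; have [[r [H _]] _ _ _] := C_complement S; exact: H. Qed.

(** Removes the two pullbacks along inclusions. [Tmap] of [idfun] is known to be the identity on
    tangent vectors, whence the tangency assumptions. *)
Lemma opp_j_omegaE a u v : CS a -> tangent CS a u -> tangent CS a v ->
  @opp_j_omega R S a u v = - om a u v.
Proof.
move=> Ca tu tv; have CX : CS `<=` @SigX R S by move=> b Cb; split; [exact: CSig_Sig|exact:
  CSig_X].
have Xa := CX _ Ca.
apply: (congr1 -%R).
apply: (etrans (f_equal2 (@omega_X R S a) (Tmap_id Ca tu) (Tmap_id Ca tv))).
exact: (f_equal2 (om a) (Tmap_id Xa (tangent_sub CX tu)) (Tmap_id Xa (tangent_sub CX tv))).
Qed.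

Lemma Tmap_CSig (f : pontryagin M -> M) a u : @smooth_map R _ _ (pontryagin M) M Sig f ->
  CS a -> tangent CS a u ->
  @Tmap R _ (pontryagin M) _ M CS f a u = @Tmap R _ (pontryagin M) _ M Sig f a u.
Proof. by move=> sf Ca tu; apply: Tmap_sub => // b; exact: CSig_Sig. Qed.

Lemma pull_family_id (Y : set M) x w be : Y x ->
  pull_dirac Y idfun (family_of L) x (w, be) <->
  tangent Y x w /\ exists p, L (x, w, p) /\ forall u, tangent Y x u -> be u = dot p u.
Proof.
move=> Yx; split=> [[/= tw [be' [[p [/= Lp /= Ep]] /= H]]]|[tw [p [Lp H]]]].
  split=> //; exists p; split; first by rewrite Tmap_id in Lp.
  by move=> u tu; rewrite H // Ep Tmap_id.
split=> //; exists (dot p); split.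
  by exists p; split=> //=; rewrite Tmap_id.
by move=> u tu; rewrite /= H // Tmap_id.
Qed.

Lemma pull_base_L_X a v al : CS a ->
  pull_dirac CS (@base R n M) (@L_X R S) a (v, al) <->
  tangent CS a v /\ exists p, L (base a, Ts a v, p) /\
    forall u, tangent CS a u -> al u = dot p (Ts a u).
Proof.
move=> Ca; have Xa := CSig_X Ca; have sb := @base_smooth_map R S.
have sbC : @smooth_map R _ _ (pontryagin M) M CS (@base R n M).
  by apply: smooth_map_sub sb => b; exact: CSig_Sig.
have tX u : tangent CS a u -> tangent X (base a) (Ts a u).
  move=> tu; rewrite -Tmap_CSig //; exact: (Tmap_tangent sbC Ca CSig_X).
split=> [[/= tv [be [/(pull_family_id _ _ Xa)[tw [p [/= Lp /= Ep]]] /= H]]]|[tv [p [Lp H]]]].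
  split=> //; exists p; rewrite Tmap_CSig // in Lp; split=> // u tu.
  by rewrite H // Tmap_CSig // Ep //; exact: tX.
split=> //; exists (dot p); split.
  apply/(pull_family_id _ _ Xa); rewrite /= Tmap_CSig //.
  by split; [exact: tX|exists p].
by move=> u tu; rewrite /= H // Tmap_CSig.
Qed.

(** The right-hand side describes exp^! L on C /\ Sigma. Both implications follow from [duality],
    whose term in omega is cancelled by the gauge form, equal to - omega on vectors tangent to C /\
    Sigma. *)
Lemma gauge_L_X a v be : CS a ->
  gauge CS (pull_dirac CS (@base R n M) (@L_X R S)) (@opp_j_omega R S) a (v, be) <->
  tangent CS a v /\ exists p, L (e a, Te a v, p) /\
    forall u, tangent CS a u -> be u = dot p (Te a u).
Proof.
move=> Ca; have Sa := CSig_Sig Ca.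
have tS u : tangent CS a u -> tangent Sig a u by apply: tangent_sub => b; exact: CSig_Sig.
split=> [[al [/(pull_base_L_X _ _ Ca)[tv [p [/= Lp /= Ep]]] /= H]]|[tv [p [Lp H]]]].
  split=> //; have [/(_ p Lp)[g [Lg Hg]] _] := duality Sa (tS _ tv).
  exists g; split=> // u tu; rewrite H // Ep // (Hg _ (tS _ tu)) opp_j_omegaE //=.
  by rewrite addrK.
have [_ /(_ p Lp)[b [Lb Hb]]] := duality Sa (tS _ tv).
exists (fun u => dot b (Ts a u)); split.
  by apply/(pull_base_L_X _ _ Ca); split=> //; exists b.
move=> u tu; rewrite /= H // (Hb _ (tS _ tu)) opp_j_omegaE //.
by rewrite addrK.
Qed.

Lemma exp_inverse : exists g : M -> pontryagin M,
  [/\ @smooth_map R _ _ (pontryagin M) M CS e,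
      @smooth_map R _ _ M (pontryagin M) P g,
      forall a, CS a -> P (e a) /\ g (e a) = a
    & forall x, P x -> CS (g x) /\ e (g x) = x].
Proof. by have [_ [g]] := exp_embedding S; rewrite -(P_image S); exists g. Qed.

Lemma pull_L_P (g : M -> pontryagin M) x :
  @smooth_map R _ _ M (pontryagin M) P g ->
  (forall x, P x -> CS (g x) /\ e (g x) = x) -> P x ->
  pull_dirac P g (gauge CS (pull_dirac CS (@base R n M) (@L_X R S)) (@opp_j_omega R S)) x =
  @L_P R S x.
Proof.
move=> sg gP Px; have [Cg eg] := gP x Px.
have se := @exp_smooth_map R S.
have tg u : tangent P x u -> tangent CS (g x) (@Tmap R _ M _ (pontryagin M) P g x u).
  by move=> tu; apply: (Tmap_tangent sg Px) => // y /gP[].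
(* [e \o g] is known to be the identity only on [P]; it is therefore compared with [idfun] along a
   curve that stays in [P]. *)
have Teg u : tangent P x u -> Te (g x) (@Tmap R _ M _ (pontryagin M) P g x u) = u.
  move=> tu; rewrite -(Tmap_comp sg se) //; last by move=> y /gP[/CSig_Sig].
  transitivity (@Tmap R _ M _ M P idfun x u); last exact: Tmap_id.
  case: tu => h ch; have sid : @smooth_map R _ _ M M P idfun by exact: smooth_map_id.
  have sc : @smooth_map R _ _ M M P (e \o g).
    by apply: (smooth_map_comp sg se) => y /gP[/CSig_Sig].
  apply: (Tmap_val sc Px ch); apply: (vel_near _ (Tmap_vel sid Px ch)).
  by case: ch => _ N _ _; apply: filterS N => t /gP[].
apply/seteqP; split=> [[w al] [/= tw [be [/(gauge_L_X _ _ Cg)[tv [p [/= Lp /= Ep]]] /= H]]]|[w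
  al]].
  apply/(pull_family_id _ _ Px); split=> //; exists p.
  rewrite Teg // eg in Lp; split=> // u tu.
  by rewrite H // Ep ?Teg //; exact: tg.
move=> /(pull_family_id _ _ Px)[tw [p [Lp Ep]]]; split=> //=.
exists (fun u => dot p (Te (g x) u)); split; last by move=> u tu; rewrite /= Ep // Teg.
apply/(gauge_L_X _ _ Cg); split; first exact: tg.
by exists p; rewrite Teg // eg.
Qed.

(** [psi] is any smooth map into C /\ Sigma, not just a parametrization, because the lemma is also
    applied to parametrizations of P followed by the inverse of exp, or by that inverse and the
    bundle map of the gluing. *)
Lemma opp_j_omega_along {Vd : normedModType R} {Fd : findim Vd} (W : set Vd)
    (psi : Vd -> pontryagin M) :
  open W -> @smooth_map R Vd _ (flat Vd) (pontryagin M) W psi -> (forall q, W q -> CS (psi q)) ->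
  let T := @Tmap R Vd (flat Vd) _ (pontryagin M) W psi in
  (forall u, smooth W (fun q => spray_theta L Sig phi (psi q) (T q u) : R^o)) /\
  forall q u v, W q -> @opp_j_omega R S (psi q) (T q u) (T q v) =
    'd (fun q => spray_theta L Sig phi (psi q) (T q v) : R^o) q u -
    'd (fun q => spray_theta L Sig phi (psi q) (T q u) : R^o) q v.
Proof.
move=> oW sp WC T; have WS q : W q -> Sig (psi q) by move=> /WC/CSig_Sig.
split=> [u|q u v Wq]; first exact: (spray_theta_smooth (phi_flow S) (Sig_domain S) oW sp WS).
rewrite opp_j_omegaE; [|exact: WC|exact: Tmap_flat_tangent..].
exact: (spray_form_exact (phi_flow S) (Sig_domain S) oW sp WS).
Qed.

Lemma exact_opp_j_omega : exact_form CS (@opp_j_omega R S).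
Proof.
exists (spray_theta L Sig phi); split; first split.
- move=> a c u v Ca tu tv; apply: theta_linear; first exact: CSig_Sig.
    by apply: tangent_sub tu => b; exact: CSig_Sig.
  by apply: tangent_sub tv => b; exact: CSig_Sig.
- move=> k W U psi rho [[oW oU] sp _ im _] v.
  have WC q : W q -> CS (psi q).
    move=> Wq; have [] // : (CS `&` U) (psi q) by rewrite -im; exists q.
  exact: (opp_j_omega_along oW sp WC).1.
move=> k W U psi rho [[oW oU] sp _ im _] T q v w Wq.
have WC q' : W q' -> CS (psi q').
  move=> Wq'; have [] // : (CS `&` U) (psi q') by rewrite -im; exists q'.
have [sth H] := opp_j_omega_along oW sp WC.
have d1 := smooth_differentiable (sth w) Wq; have d2 := smooth_differentiable (sth v) Wq.
apply: (etrans (H q v w Wq)).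
exact: (esym (f_equal2 (fun a b : R => a - b) (deriveE v d1) (deriveE w d2))).
Qed.

End PartOne.

(** * Curves with zero velocity *)

Section ConstantCurves.
Context {R : realType} {V : normedModType R} {FV : findim V}.

Lemma locally_constant (k : R -> V) (t : R) :
  (\forall s \near t, is_derive (s : R^o) (1 : R^o) (k : R^o -> V) 0) ->
  \forall s \near t, k s = k t.
Proof.
move=> /nbhs_ballP[r /= r0 Hr]; apply/nbhs_ballP; exists r => //= s.
rewrite -ball_normE /ball_ /= => ts.
have B u : 0 <= u <= 1 -> is_derive (t + u *: (s - t) : R^o) (1 : R^o) (k : R^o -> V) 0.
  move=> /andP[u0 u1]; apply: Hr; rewrite -ball_normE /ball_ /= opprD addNKr normrN.
  by rewrite normrM (ger0_norm u0) distrC (le_lt_trans _ ts) // ler_piMl.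
have D u : 0 <= u <= 1 ->
    is_derive (u : R^o) (1 : R^o) (fun u : R^o => k (t + u *: (s - t))) 0.
  move=> u01; have [dk Ek] := B u u01.
  have dk' : differentiable (k : R^o -> V) (t + u *: (s - t)) by apply/derivable1_diffP.
  have E0 : 'd (k : R^o -> V) (t + u *: (s - t)) (s - t) = 0.
    have lin (F : {linear R^o -> V}) : F 1 = 0 -> F (s - t) = 0.
      move=> F1; have -> : s - t = (s - t) *: (1 : R^o) by rewrite [RHS]mulr1.
      by rewrite linearZ_LR F1 scaler0.
    by apply: lin; exact: (etrans (esym (deriveE _ dk')) Ek).
  by rewrite -E0; exact: (@line_derive R R^o V k t (s - t) u dk').
apply: fd_ext => i.
have [||u u01] := @MVT0 R (fun u => fd_coord i (k (t + u *: (s - t)))) (fun=> 0) 1.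
- exact: ltr01.
- move=> u u01; pose proof (is_derive_linear (fd_linear i) (D u u01)) as d.
  by rewrite linear0 in d.
rewrite mul0r scale1r scale0r addr0 [t + _]addrC subrK => /eqP.
by rewrite subr_eq0 => /eqP.
Qed.

End ConstantCurves.

(** The curve may leave every single chart, so calculus gives only local constancy. The function
    [f], 1 where the curve is at [g 0] and 0 elsewhere, is then locally constant on [0, 1]; its
    derivative vanishes and the mean value theorem gives f 1 = f 0. *)
Lemma constant_curve {R : realType} {V : normedModType R} {A : atlas V} {FV : findim V}
    {CA : charted A} (g : R -> A) :
  (forall t : R, 0 <= t <= 1 -> \forall s \near t, has_velocity g s 0) -> g 1 = g 0.
Proof.
move=> H; pose f (t : R) : R := if `[< g t = g 0 >] then 1 else 0.
have loc (t : R) : 0 <= t <= 1 -> \forall s \near t, g s = g t.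
  move=> t01; have vt := nbhs_singleton (H t t01).
  have nd : \forall s \near t, dom (g t) (g s) by case: vt.
  have nk : \forall s \near t, is_derive (s : R^o) (1 : R^o) (fun s : R^o => coord (g t) (g s)) 0.
    apply: filterS2 nd (H t t01) => s ds vs.
    have [_] := vel_chart ds vs.
    by rewrite /move_vec linear0.
  have nc : \forall s \near t, coord (g t) (g s) = coord (g t) (g t).
    exact: (locally_constant nk).
  by apply: filterS2 nd nc => s ds E; exact: (coord_inj ds (ch_dom _) E).
have [||t t01] := @MVT0 R f (fun=> 0) 1; first exact: ltr01.
  move=> t t01.
  have NE : \forall s \near (t : R^o), f t = f s.
    by apply: filterS (loc t t01) => s E; rewrite /f E.
  apply: (near_eq_is_derive NE); exact: is_derive_cst.
rewrite mul0r => fE; apply: contrapT => g10; move: fE.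
by rewrite /f (asboolF g10) asboolT // sub0r => /eqP; rewrite oppr_eq0 oner_eq0.
Qed.

Lemma Tmap_mdiff {R : realType} {V W : normedModType R} {A : atlas V} {B : atlas W}
    {FV : findim V} {FW : findim W} {CA : charted A} {CB : charted B}
    (S : set A) (f : A -> B) x v :
  smooth_at f x -> tangent S x v -> Tmap S f x v = mdiff f x v.
Proof.
move=> sf tv.
by apply: (TmapE (U := dom x) (f' := f)) => //; [exact: mopen_dom|exact: ch_dom].
Qed.

(** * The spray and its flow on the zero section *)

Section ZeroSection.
Context {R : realType} {n : nat} {M : manifold R n}.
Local Notation E := 'rV[R]_n.
Context {L : set (pontryagin M)} {X : pontryagin M -> E * E * E}.
Context {O : set (R * pontryagin M)} {phi : R -> pontryagin M -> pontryagin M}.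
Hypothesis X_spray : spray L X.
Hypothesis phi_flow : local_flow L X O phi.

(* Homogeneity with t = 2 gives 2^-1 w = 2 w for the vertical part w. *)
Lemma spray_zero x : L (x, 0, 0) -> X (x, 0, 0) = 0.
Proof.
have n2 : (2^-1 - 2 : R) != 0 by apply/eqP => H; lra.
move=> Lz; have [[tX _] bX sX] := X_spray; set z : pontryagin M := (x, 0, 0).
have X1 : (X z).1.1 = 0.
  have := bX z Lz; rewrite (Tmap_mdiff (base_smooth_at z).1 (tX z Lz)).
  by rewrite (base_smooth_at z).2.
have sz (t : R) : Defs.scale t z = z by rewrite /Defs.scale /= !scaler0.
have := sX 2 z; rewrite pnatr_eq0 sz => /(_ isT Lz).
rewrite (Tmap_mdiff (scale_smooth_at 2^-1 z).1 (tX z Lz)) (scale_smooth_at _ _).2 /= => E2.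
have h (v : E) : 2^-1 *: v = 2 *: v -> v = 0.
  move=> /eqP; rewrite -subr_eq0 -scalerBl scaler_eq0 (negbTE n2).
  by move=> /eqP.
move: X1 E2; rewrite /scale_fun; case: (X z) => [[v1 v2] v3] /= -> [_ /h -> /h ->].
by [].
Qed.

Lemma flow_time_smooth z s0 : O (s0, z) ->
  @smooth_at R R^o _ (flat R^o) (pontryagin M) (fun s => phi s z) s0 /\
  \forall s \near s0, O (s, z).
Proof.
move=> Oz; have [[U [oU OE]] _ _ _ [_ /(_ _ Oz)[N [g [oN Nz sg Ng]]]]] := phi_flow.
have Lz : L z by move: Oz; rewrite OE => -[_ []].
have sp : @smooth_at R _ _ (flat R^o) (prod_atlas (flat R^o) (pontryagin M)) (fun s => (s, z)) s0.
  apply: (smooth_at_pair (A := flat R^o) (B := flat R^o) (C := pontryagin M) (f := idfun) (g :=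
    fun=> z)).
    exact: smooth_at_id.
  exists setT; split; [exact: openT|by []|by move=> q _; exists q|by move=> q _; exact: ch_dom|].
  exact: smooth_cst.
pose proof (mopenI oN oU) as oNU.
have NUz : (N `&` U) (s0, z) by split=> //; move: Oz; rewrite OE => -[].
have [Q [/mopen_flat oQ Qs QN]] := smooth_at_continuous sp oNU NUz.
have OQ s : Q s -> O (s, z) by move=> /QN[_ Us]; rewrite OE.
split; last first.
  have NQ : \forall s \near s0, Q s by exact: (open_nbhs_nbhs (conj oQ Qs)).
  by apply: filterS NQ => s; exact: OQ.
have oQ' : @mopen R R^o (flat R^o) Q by exact/mopen_flat.
apply: (smooth_at_ext (A := flat R^o) (g := g \o (fun s => (s, z))) oQ' Qs).
  by move=> s Qs'; apply: (Ng (s, z)); split; [exact: (QN _ Qs').1|exact: OQ].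
exact: (smooth_at_comp (A := flat R^o) sp sg).
Qed.

Lemma near_flow_dom (t : R) (c : R -> pontryagin M) (N : set (prod_atlas (flat R^o) (pontryagin
  M))) :
  @smooth_at R R^o _ (flat R^o) (pontryagin M) c 0 -> mopen N -> N (t, c 0) ->
  \forall s \near (0 : R), N (t, c s).
Proof.
move=> sc oN N0.
have sp : @smooth_at R _ _ (flat R^o) (prod_atlas (flat R^o) (pontryagin M)) (fun s => (t, c s))
  (0 : R^o).
  apply: (smooth_at_pair (A := flat R^o) (B := flat R^o) (C := pontryagin M) (f := fun=> t) (g
    := c)) => //.
  exists setT; split; [exact: openT|by []|by move=> q _; exists q|by []|].
  exact: smooth_cst.
have [Q [/mopen_flat oQ Qs QN]] := smooth_at_continuous sp oN N0.
have NQ : \forall s \near (0 : R), Q s by exact: (open_nbhs_nbhs (conj oQ Qs)).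
by apply: filterS NQ => s; exact: QN.
Qed.

Lemma has_velocity_shift (g : R -> pontryagin M) (t : R) v :
  has_velocity g t v -> has_velocity (fun s => g (t + s)) 0 v.
Proof.
move=> [nd dv]; have t0 : t + 0 = t by rewrite addr0.
have dc : is_derive (0 : R^o) (1 : R^o) (fun s : R^o => t + s : R^o) (1 : R^o).
  pose proof (is_derive_affine (t : R^o) (1 : R^o)) as d.
  have NE : \forall s \near (0 : R), (t : R^o) + s *: (1 : R^o) = t + s.
    by apply: filterS (@filterT _ (nbhs (0 : R)) _) => s _; rewrite [s *: _]mulr1.
  exact: (near_eq_is_derive NE d).
split; rewrite t0.
  have cc := is_derive_continuous dc.
  have nd' : nbhs (t + 0) [set s | dom (g t) (g s)] by rewrite t0.
  exact: (cc _ nd').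
have [dg Eg] := dv.
have dg' : differentiable (fun s : R^o => coord (g t) (g s)) (t + 0) by rewrite t0;
  apply/derivable1_diffP.
have E : 'd (fun s : R^o => coord (g t) (g s)) (t + 0) 1 = v.
  by apply: (etrans (esym (deriveE _ dg'))); rewrite t0; exact: Eg.
pose proof (is_derive_comp dc dg') as d2.
by rewrite E in d2.
Qed.

(** The flow law takes the place of uniqueness of integral curves: phi_t (phi_s z) = phi_(s + t) z,
    differentiated at s = 0, shows that the orbit of z has zero velocity at each time. *)
Lemma flow_zero x : L (x, 0, 0) -> (forall t, 0 <= t <= 1 -> O (t, (x, 0, 0))) ->
  phi 1 (x, 0, 0) = (x, 0, 0).
Proof.
set z : pontryagin M := (x, 0, 0) => Lz O01.
have [[U [oU OE]] O0 _ flowE [velE sO]] := phi_flow.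
have [Oz phi0] := O0 z Lz.
(* [phi t] maps the vector X z = 0 to X (phi t z). *)
have X0 t : O (t, z) -> X (phi t z) = 0.
  move=> Ot; have [sc nO] := flow_time_smooth Oz.
  have [_ v0] := velE 0 z Oz; rewrite phi0 (spray_zero Lz) in v0.
  have [N [g [oN Nz sg Ng]]] := sO (t, z) Ot.
  (* For s near 0 the points involved stay where the extension [g] equals the flow and where the
     flow law is available. *)
  have nN : \forall s \near (0 : R), N (t, phi s z).
    by apply: (near_flow_dom sc oN); rewrite phi0.
  have nU : \forall s \near (0 : R), U (t, phi s z).
    apply: (near_flow_dom sc oU); rewrite phi0.
    by move: Ot; rewrite OE => -[].
  have [_ nt] := flow_time_smooth Ot.
  have nt' : \forall s \near (0 : R), O (t + s, z).
    have cc : {for (0 : R), continuous (fun s : R => t + s)}.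
      apply: (@continuousD R R R (fun=> t) idfun (0 : R)); [exact: cst_continuous|exact: cvg_id].
    have nt0 : nbhs (t + 0) [set s | O (s, z)] by rewrite addr0.
    exact: (cc _ nt0).
  have sgt : @smooth_at R _ _ (pontryagin M) (pontryagin M) (fun b => g (t, b)) (phi 0 z).
    rewrite phi0.
    have sp : @smooth_at R _ _ (pontryagin M) (prod_atlas (flat R^o) (pontryagin M)) (fun b =>
      (t, b)) z.
      apply: (smooth_at_pair (B := flat R^o) (C := pontryagin M) (f := fun=> t) (g := idfun)).
        exists (coord z @` dom z); split; [exact: ch_open| |by []|by []|exact: smooth_cst].
        by exists z => //; exact: ch_dom.
      exact: smooth_at_id.
    exact: (smooth_at_comp sp sg).
  have v0' : has_velocity (fun s => phi s z) 0 0 by exact: v0.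
  pose proof (vel_comp sgt v0') as v1.
  have v1' : has_velocity ((fun b => g (t, b)) \o (fun s => phi s z)) 0 0.
    by move: v1; rewrite /mdiff linear0.
  have [_ vt] := velE t z Ot.
  pose proof (has_velocity_shift (g := fun s => phi s z) vt) as v2.
  apply: (vel_unique v2); apply: (vel_near _ v1').
  apply: filterS2 (filterI nO nN) (filterI nU nt') => s [Os Ns] [Us Ots] /=.
  have OO : O (t, phi s z) by rewrite OE; split=> //; split=> //; exact: (velE s z Os).1.
  by rewrite -(Ng (t, phi s z) (conj Ns OO)) /= flowE // addrC.
apply: (etrans _ phi0); apply: (constant_curve (g := fun t => phi t z)) => t t01.
have [_ nO] := flow_time_smooth (O01 t t01).
by apply: filterS nO => s Os; have [_] := velE s z Os; rewrite X0.
Qed.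

End ZeroSection.

(** On [S] near x the map psi o rho is the identity, so every velocity in [S] is a value of the
    linear map [mdiff psi q], and conversely. *)
Lemma tangent_submanifold_linear {R : realType} {V : normedModType R} {A : atlas V}
    {FV : findim V} {CA : charted A} (k : nat) (S : set A) x c u v :
  is_submanifold k S -> S x -> tangent S x u -> tangent S x v -> tangent S x (c *: u + v).
Proof.
move=> sub Sx tu tv; have [W [U [psi [rho [Ux [[oW oU] sp sr im inv]]]]]] := sub x Sx.
have [q Wq qx] : (psi @` W) x by rewrite im.
have oW' : @mopen R _ (flat 'rV[R]_k) W by exact/mopen_flat.
have spq : @smooth_at R _ _ (flat 'rV[R]_k) A psi q by exact: (smooth_map_at (A := flat
  'rV[R]_k) oW' sp).
have srx : @smooth_at R _ _ A (flat 'rV[R]_k) rho x by exact: (smooth_map_at oU sr).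
have rx : rho x = q by rewrite -qx inv.
have WS q' : W q' -> S (psi q').
  by move=> Wq'; have [] // : (S `&` U) (psi q') by rewrite -im; exists q'.
have tE w : tangent S x w -> exists w', w = @mdiff R _ _ (flat 'rV[R]_k) A psi q w'.
  move=> [g cg].
  have N : \forall t \near (0 : R), U (g t) /\ S (g t) by exact: (curve_at_near cg oU Ux).
  case: cg => g0 _ _ vg.
  have srg : @smooth_at R _ _ A (flat 'rV[R]_k) rho (g 0) by rewrite g0.
  pose proof (vel_comp (B := flat 'rV[R]_k) srg vg) as v1.
  have spg : @smooth_at R _ _ (flat 'rV[R]_k) A psi ((rho \o g) 0) by rewrite /= g0 rx.
  pose proof (vel_comp (A := flat 'rV[R]_k) spg v1) as v2.
  have NE : \forall s \near (0 : R), (psi \o (rho \o g)) s = g s.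
    apply: filterS N => s [Us Ss].
    have [q' Wq' E] : (psi @` W) (g s) by rewrite im.
    by rewrite /= -E inv.
  pose proof (vel_near NE v2) as v3.
  exists (@mdiff R _ _ A (flat 'rV[R]_k) rho (g 0) w).
  have q0E : (rho \o g) 0 = q by rewrite /= g0.
  by rewrite q0E in v3; exact: (vel_unique vg v3).
have [u' ->] := tE u tu; have [v' ->] := tE v tv.
have -> : c *: @mdiff R _ _ (flat 'rV[R]_k) A psi q u' + @mdiff R _ _ (flat 'rV[R]_k) A psi q v' =
    @mdiff R _ _ (flat 'rV[R]_k) A psi q (c *: u' + v') by rewrite /mdiff linearP.
have tl : tangent (A := flat 'rV[R]_k) W q (c *: u' + v').
  by eexists; exact: (line_curve _ oW Wq).
rewrite -(Tmap_mdiff spq tl) -qx.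
exact: (Tmap_flat_tangent oW sp _ WS Wq).
Qed.

Section ZeroSections.
Context {R : realType} (S : saturation R).
Local Notation M := (sM S).

Lemma Sig_zero (x : M) : sSig S (x, 0, 0).
Proof. by have [] := Sig_domain S. Qed.

Lemma exp_zero (x : M) : spray_exp (@sphi R S) (x, 0, 0) = x.
Proof.
rewrite /spray_exp (flow_zero (V_spray S) (phi_flow S)) //.
  exact: (Sig_L (Sig_domain S) (Sig_zero x)).
by move=> t t01; exact: (Sig_O (Sig_domain S) t01 (Sig_zero x)).
Qed.

Lemma C_zero (x : M) : sX S x -> sC S (x, 0, 0).
Proof.
move=> Xx; have [[r [_ /(_ x Xx)[U [e [oU Ux _ eb]]]]] _ _ _] := C_complement S.
have [/(_ 0)[_ H] _] := eb x (conj Xx Ux).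
apply: H; exists (fun=> 0); by rewrite big1 // => i _; rewrite scale0r.
Qed.

Lemma C_L (a : pontryagin M) : sC S a -> sL S a.
Proof. by move=> Ca; have [_ H _ _] := C_complement S; exact: H. Qed.

End ZeroSections.

Section LXTransfer.
Context {R : realType} (S S' : saturation R) (f : sM S -> sM S').
Hypothesis sf : smooth_map (@sX R S) f.
Hypothesis fX : forall x, sX S x -> sX S' (f x).
Hypothesis pf : forall x, sX S x -> pull_dirac (@sX R S) f (@L_X R S') x = @L_X R S x.

(** The identification of the pullback structures by f, expressed with representatives in [L] and
    [L']: these are matched only on vectors tangent to X. *)
Lemma L_X_transfer y w b : sX S y -> tangent (@sX R S) y w -> sL S (y, w, b) ->
  exists b', sL S' (f y, Tmap (@sX R S) f y w, b') /\
    forall u, tangent (@sX R S) y u -> dot b u = dot b' (Tmap (@sX R S) f y u).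
Proof.
move=> Xy tw Lb.
have : @L_X R S y (w, dot b) by apply/(pull_family_id _ _ Xy); split=> //; exists b.
rewrite -pf // => -[/= _ [be [/(pull_family_id _ _ (fX Xy))[_ [p [Lp Ep]]] H]]].
exists p; split=> // u tu; rewrite H // Ep //.
exact: (Tmap_tangent sf Xy fX).
Qed.

Lemma L_X_transfer_inv y w b' : sX S y -> tangent (@sX R S) y w ->
  sL S' (f y, Tmap (@sX R S) f y w, b') ->
  exists b, sL S (y, w, b) /\
    forall u, tangent (@sX R S) y u -> dot b u = dot b' (Tmap (@sX R S) f y u).
Proof.
move=> Xy tw Lb.
have : pull_dirac (@sX R S) f (@L_X R S') y (w, fun u => dot b' (Tmap (@sX R S) f y u)).
  split=> //; exists (dot b'); split=> //.
  apply/(pull_family_id _ _ (fX Xy)); split; first exact: (Tmap_tangent sf Xy fX).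
  by exists b'.
rewrite pf // => /(pull_family_id _ _ Xy)[_ [p [Lp Ep]]].
by exists p; split=> // u tu; rewrite -Ep.
Qed.

End LXTransfer.

(** F maps C to C' but may move points of C /\ Sigma out of Sigma'. Since C' lies in L' and Sigma'
    is open in L', the points of P for which this does not happen form an open subset. *)
Lemma glue_domain {R : realType} (S S' : saturation R)
    (F : pontryagin (sM S) -> pontryagin (sM S')) (g0 : sM S -> pontryagin (sM S)) :
  @smooth_map R _ _ (pontryagin (sM S)) (pontryagin (sM S')) (sC S) F ->
  (forall a, sC S a -> sC S' (F a)) ->
  @smooth_map R _ _ (sM S) (pontryagin (sM S)) (sP S) g0 ->
  (forall x, sP S x -> CSig S (g0 x)) ->
  exists U : set (sM S), mopen U /\ forall x, sP S x -> (U x <-> CSig S' (F (g0 x))).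
Proof.
move=> sF FC sg gP; have [U0 [oU0 SE]] := Sig_openP S'.
have PC x : sP S x -> sC S (g0 x) by move=> /gP[].
have sh : @smooth_map R _ _ (sM S) (pontryagin (sM S')) (sP S) (F \o g0).
  exact: (smooth_map_comp sg sF PC).
have [U [oU HU]] := smooth_map_preimage sh oU0.
exists U; split=> // x Px; have CF := FC _ (PC x Px); split=> [/(HU x Px) U0x|[_ Sx]].
  by split=> //; rewrite SE; split=> //; exact: C_L.
by apply/(HU x Px); move: Sx; rewrite SE => -[].
Qed.

(** * Comparison of two saturations *)

Section Glue.
Context {R : realType} (S S' : saturation R) (f : sM S -> sM S').
Context (F : pontryagin (sM S) -> pontryagin (sM S')).
Local Notation M := (sM S).
Local Notation M' := (sM S').
Local Notation L := (sL S).
Local Notation L' := (sL S').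
Local Notation P := (sP S).
Local Notation Sig := (sSig S).
Local Notation Sig' := (sSig S').
Local Notation e := (spray_exp (sphi S)).
Local Notation e' := (spray_exp (sphi S')).
Hypothesis sf : smooth_map (sX S) f.
Hypothesis fX : forall x, sX S x -> sX S' (f x).
Hypothesis pf : forall x, sX S x -> pull_dirac (sX S) f (L_X S') x = L_X S x.
Hypothesis sF : @smooth_map R _ _ (pontryagin M) (pontryagin M') (sC S) F.
Hypothesis FC : forall a, sC S a -> sC S' (F a).
Hypothesis bF : forall a, sC S a -> base (F a) = f (base a).
(* [g0] is the inverse of [e] on [P]. *)
Context (g0 : M -> pontryagin M) (U : set M).
Hypothesis sg0 : @smooth_map R _ _ M (pontryagin M) P g0.
Hypothesis g0P : forall x, P x -> CSig S (g0 x) /\ e (g0 x) = x.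
Hypothesis oU : mopen U.
Hypothesis UC : forall x, P x -> U x -> CSig S' (F (g0 x)).

Local Notation Y := (P `&` U).
Local Notation h := (F \o g0).
Local Notation Tg := (@Tmap R _ M _ (pontryagin M) Y g0).
Local Notation Th := (@Tmap R _ M _ (pontryagin M') Y h).
Local Notation Ts := (@Tmap R _ (pontryagin M) _ M Sig (@base R (sdim S) M)).
Local Notation Te := (@Tmap R _ (pontryagin M) _ M Sig e).
Local Notation Ts' := (@Tmap R _ (pontryagin M') _ M' Sig' (@base R (sdim S') M')).
Local Notation Te' := (@Tmap R _ (pontryagin M') _ M' Sig' e').

(** It undoes the gauge transformation of S and applies that of S', both forms being pulled back to
    P, by [g0] and by [h]. *)
Definition glue_form : @form2 R _ M := fun x u v =>
  opp_j_omega S' (h x) (Th x u) (Th x v) - opp_j_omega S (g0 x) (Tg x u) (Tg x v).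

Let YP : Y `<=` P. Proof. by move=> x []. Qed.

Let sgY : @smooth_map R _ _ M (pontryagin M) Y g0.
Proof. exact: smooth_map_sub YP sg0. Qed.

Let Yg x : Y x -> CSig S (g0 x). Proof. by move=> [/g0P[]]. Qed.

Let Yh x : Y x -> CSig S' (h x). Proof. by move=> [Px Ux]; exact: UC. Qed.

Let shY : @smooth_map R _ _ M (pontryagin M') Y h.
Proof. by apply: (smooth_map_comp sgY sF) => x /Yg[]. Qed.

Lemma glue_smooth : @smooth_map R _ _ M M' Y (e' \o h).
Proof.
by apply: (smooth_map_comp shY (@exp_smooth_map R S')) => x /Yh/CSig_Sig.
Qed.

Let tYg x u : Y x -> tangent Y x u -> tangent (CSig S) (g0 x) (Tg x u).
Proof. by move=> Yx tu; exact: (Tmap_tangent sgY Yx Yg). Qed.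

Let tYh x u : Y x -> tangent Y x u -> tangent (CSig S') (h x) (Th x u).
Proof. by move=> Yx tu; exact: (Tmap_tangent shY Yx Yh). Qed.

Let tS a u : tangent (CSig S) a u -> tangent Sig a u.
Proof. by apply: tangent_sub => b; exact: CSig_Sig. Qed.

Let tS' a u : tangent (CSig S') a u -> tangent Sig' a u.
Proof. by apply: tangent_sub => b; exact: CSig_Sig. Qed.

Let TeTg x u : Y x -> tangent Y x u -> Te (g0 x) (Tg x u) = u.
Proof.
move=> Yx tu; have se := @exp_smooth_map R S.
have gS y : Y y -> Sig (g0 y) by move=> /Yg/CSig_Sig.
rewrite -(Tmap_comp sgY se gS Yx tu).
have sid : @smooth_map R _ _ M M Y idfun by exact: smooth_map_id.
have sc : @smooth_map R _ _ M M Y (e \o g0) by exact: (smooth_map_comp sgY se gS).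
transitivity (@Tmap R _ M _ M Y idfun x u); last exact: Tmap_id.
case: tu => c cc; apply: (Tmap_val sc Yx cc); apply: (vel_near _ (Tmap_vel sid Yx cc)).
by case: cc => _ N _ _; apply: filterS N => t [Pt _]; rewrite /= (g0P Pt).2.
Qed.

Let TeTh x u : Y x -> tangent Y x u ->
  @Tmap R _ M _ M' Y (e' \o h) x u = Te' (h x) (Th x u).
Proof.
move=> Yx tu; apply: (Tmap_comp shY (@exp_smooth_map R S') _ Yx tu).
by move=> y /Yh/CSig_Sig.
Qed.

(** The vector tangent to X at which both sides meet: u lies over [xi x u] on the side of S and over
    its image under f on that of S'. *)
Let xi x u := Ts (g0 x) (Tg x u).

Let xi_tangent x u : Y x -> tangent Y x u -> tangent (sX S) (base (g0 x)) (xi x u).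
Proof.
move=> Yx tu; rewrite /xi -(Tmap_CSig (@base_smooth_map R S) (Yg Yx) (tYg Yx tu)).
apply: (Tmap_tangent _ (Yg Yx) _ (tYg Yx tu)); last exact: CSig_X.
by apply: smooth_map_sub (@base_smooth_map R S) => b; exact: CSig_Sig.
Qed.

Let TsTh x u : Y x -> tangent Y x u ->
  Ts' (h x) (Th x u) = @Tmap R _ M _ M' (sX S) f (base (g0 x)) (xi x u).
Proof.
move=> Yx tu.
have gS y : Y y -> Sig (g0 y) by move=> /Yg/CSig_Sig.
have gS' y : Y y -> Sig' (h y) by move=> /Yh/CSig_Sig.
have sb := @base_smooth_map R S; have sb' := @base_smooth_map R S'.
have sbg : @smooth_map R _ _ M M Y (@base R _ M \o g0) by exact: (smooth_map_comp sgY sb gS).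
have bX y : Y y -> sX S ((@base R _ M \o g0) y) by move=> /Yg/CSig_X.
pose proof (Tmap_comp shY sb' gS' Yx tu) as E1.
pose proof (Tmap_comp sgY sb gS Yx tu) as E2.
pose proof (Tmap_comp sbg sf bX Yx tu) as E3.
rewrite -E1 /xi -E2; apply: (etrans _ E3).
case: tu => c cc.
have s1 : @smooth_map R _ _ M M' Y (@base R _ M' \o h) by exact: (smooth_map_comp shY sb' gS').
have s2 : @smooth_map R _ _ M M' Y (f \o (@base R _ M \o g0)) by exact: (smooth_map_comp sbg sf
  bX).
apply: (Tmap_val s1 Yx cc); apply: (vel_near _ (Tmap_vel s2 Yx cc)).
case: cc => _ N _ _; apply: filterS N => t /Yg[Cg _].
by rewrite /= bF.
Qed.

Lemma glue_dirac x : Y x ->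
  pull_dirac Y (e' \o h) (L_P S') x = gauge Y (L_P S) glue_form x.
Proof.
move=> Yx; have [Px Ux] := Yx.
have Ca := Yg Yx; have Ca' := Yh Yx; have Sa := CSig_Sig Ca; have Sa' := CSig_Sig Ca'.
have P'g : sP S' (e' (h x)) by rewrite (P_image S'); exists (h x).
have Xa := CSig_X Ca; have ba : base (h x) = f (base (g0 x)) by rewrite /= bF //; case: Ca.
have eg : e (g0 x) = x by have [] := g0P Px.
have tP u : tangent Y x u -> tangent P x u by exact: tangent_sub YP.
have gfE u v : tangent Y x u -> tangent Y x v -> glue_form x u v =
    spray_form L Sig (sphi S) (g0 x) (Tg x u) (Tg x v) -
    spray_form L' Sig' (sphi S') (h x) (Th x u) (Th x v).
  move=> tu tv; rewrite /glue_form (opp_j_omegaE Ca (tYg Yx tu) (tYg Yx tv)).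
  by rewrite (opp_j_omegaE Ca' (tYh Yx tu) (tYh Yx tv)) opprK addrC.
apply/seteqP; split=> [[w al] [/= tw [be [/(pull_family_id _ _ P'g)[tw' [p [Lp Ep]]] H]]]|].
  rewrite TeTh // in Lp.
  (* Three moves: from P' to X' by the duality of S', from X' to X by f, from X to P by the duality
     of S. *)
  have [_ /(_ p Lp)[b [Lb Hb]]] := duality Sa' (tS' (tYh Yx tw)).
  rewrite TsTh // ba in Lb.
  have [b0 [Lb0 Hb0]] := L_X_transfer_inv sf fX pf Xa (xi_tangent Yx tw) Lb.
  have [/(_ b0 Lb0)[p0 [Lp0 Hp0]] _] := duality Sa (tS (tYg Yx tw)).
  rewrite eg TeTg // in Lp0.
  exists (dot p0); split.
    apply/(pull_family_id _ _ Px); split; first exact: tP.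
    by exists p0.
  move=> u tu; rewrite /= H // Ep; last first.
    apply: (Tmap_tangent glue_smooth Yx _ tu) => y /Yh Cy.
    by rewrite (P_image S'); exists (h y).
  rewrite TeTh // gfE //.
  (* The pairing over X is eliminated between the two dualities; the difference of the two omega
     terms remains, which is [glue_form]. *)
  have := Hb _ (tS' (tYh Yx tu)); have := Hp0 _ (tS (tYg Yx tu)).
  rewrite TsTh // -(Hb0 _ (xi_tangent Yx tu)) TeTg // => -> Hu.
  by rewrite addrA Hu addrK.
move=> [w al] [al0 [/(pull_family_id _ _ Px)[tw [p [Lp Ep]]] H]].
have tyw : tangent Y x w by exact: tangent_open.
have Lp1 : L (e (g0 x), Te (g0 x) (Tg x w), p) by rewrite eg TeTg.
have [_ /(_ p Lp1)[b [Lb Hb]]] := duality Sa (tS (tYg Yx tyw)).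
have [b' [Lb' Hb']] := L_X_transfer sf fX pf Xa (xi_tangent Yx tyw) Lb.
rewrite -TsTh // -ba in Lb'.
have [/(_ b' Lb')[p' [Lp' Hp']] _] := duality Sa' (tS' (tYh Yx tyw)).
split=> //; exists (dot p'); split.
  apply/(pull_family_id _ _ P'g); split; last first.
    by exists p'; split=> //; rewrite /= TeTh.
  apply: (Tmap_tangent glue_smooth Yx _ tyw) => y /Yh Cy.
  by rewrite (P_image S'); exists (h y).
move=> u tu; rewrite TeTh //=; move: (H u tu) => /= ->; rewrite Ep; last exact: tP.
rewrite gfE //.
have := Hp' _ (tS' (tYh Yx tu)); have := Hb _ (tS (tYg Yx tu)).
rewrite TsTh // -(Hb' _ (xi_tangent Yx tu)) TeTg // => -> Hu.
by rewrite addrA Hu addrK.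
Qed.

(** The primitive is the difference of the forms [spray_theta] pulled back by [h] and [g0]. Its
    linearity rests on the tangent vectors of P /\ U forming a vector space, which they do because P
    is a submanifold. *)
Lemma glue_exact : exact_form Y glue_form.
Proof.
have [k sub] : exists k, is_submanifold k P.
  by have [[k]] := exp_embedding S; rewrite -(P_image S); exists k.
pose th : @form1 R _ M := fun x u =>
  spray_theta L' Sig' (sphi S') (h x) (Th x u) - spray_theta L Sig (sphi S) (g0 x) (Tg x u).
(* A parametrization of P /\ U followed by [g0] or [h] is a smooth map into C /\ Sigma or C' /\
   Sigma', so the formula for the primitive applies to both. *)
have main k' W U1 (psi : 'rV[R]_k' -> M) rho : local_param Y W U1 psi rho ->
    let T q v := @Tmap R _ (flat 'rV[R]_k') _ M W psi q v in
    (forall v, @smooth R 'rV[R]_k' R^o W (fun q => th (psi q) (T q v))) /\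
    forall q v w, W q -> glue_form (psi q) (T q v) (T q w) =
      'd (fun q => th (psi q) (T q w) : R^o) q v - 'd (fun q => th (psi q) (T q v) : R^o) q w.
  move=> [[oW _] sp _ im _] T.
  have WY q : W q -> Y (psi q).
    by move=> Wq; have [] // : (Y `&` U1) (psi q) by rewrite -im; exists q.
  have sgp : @smooth_map R _ _ (flat 'rV[R]_k') (pontryagin M) W (g0 \o psi).
    exact: (smooth_map_comp (A := flat 'rV[R]_k') sp sgY WY).
  have shp : @smooth_map R _ _ (flat 'rV[R]_k') (pontryagin M') W (h \o psi).
    exact: (smooth_map_comp (A := flat 'rV[R]_k') sp shY WY).
  have [s1 H1] := opp_j_omega_along (S := S) oW sgp (fun q Wq => Yg (WY q Wq)).
  have [s2 H2] := opp_j_omega_along (S := S') oW shp (fun q Wq => Yh (WY q Wq)).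
  have TE (q v : 'rV[R]_k') : W q ->
      @Tmap R _ (flat 'rV[R]_k') _ (pontryagin M) W (g0 \o psi) q v = Tg (psi q) (T q v).
    move=> Wq; apply: (Tmap_comp (A := flat 'rV[R]_k') sp sgY WY Wq).
    by eexists; exact: (line_curve _ oW Wq).
  have TE' (q v : 'rV[R]_k') : W q ->
      @Tmap R _ (flat 'rV[R]_k') _ (pontryagin M') W (h \o psi) q v = Th (psi q) (T q v).
    move=> Wq; apply: (Tmap_comp (A := flat 'rV[R]_k') sp shY WY Wq).
    by eexists; exact: (line_curve _ oW Wq).
  pose t1 v q : R^o := spray_theta L Sig (sphi S) ((g0 \o psi) q)
    (@Tmap R _ (flat 'rV[R]_k') _ (pontryagin M) W (g0 \o psi) q v).
  pose t2 v q : R^o := spray_theta L' Sig' (sphi S') ((h \o psi) q)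
    (@Tmap R _ (flat 'rV[R]_k') _ (pontryagin M') W (h \o psi) q v).
  have thE v q : W q -> t2 v q - t1 v q = th (psi q) (T q v).
    move=> Wq; exact: (f_equal2 (fun a b => spray_theta L' Sig' (sphi S') (h (psi q)) a -
      spray_theta L Sig (sphi S) (g0 (psi q)) b) (TE' q v Wq) (TE q v Wq)).
  split=> [v|q v w Wq]; first exact: (eq_smooth oW (thE v) (smoothB oW (s2 v) (s1 v))).
  have dE a b : 'd (fun q => th (psi q) (T q a) : R^o) q b = 'd (t2 a) q b - 'd (t1 a) q b.
    have NW : \forall q' \near q, W q' by exact: open_nbhs_nbhs.
    have NE : \forall q' \near q, t2 a q' - t1 a q' = th (psi q') (T q' a) :> R^o.
      by apply: filterS NW => q'; exact: thE.
    have d1 := smooth_differentiable (s1 a) Wq; have d2 := smooth_differentiable (s2 a) Wq.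
    have [_ E1] := eq_diff NE (differentiableB d2 d1).
    exact: (etrans (congr1 (@^~ b) E1) (congr1 (@^~ b) (diffB d2 d1))).
  have E1 : opp_j_omega S (g0 (psi q)) (Tg (psi q) (T q v)) (Tg (psi q) (T q w)) =
      'd (t1 w) q v - 'd (t1 v) q w.
    apply: (etrans (f_equal2 (opp_j_omega S (g0 (psi q))) (esym (TE q v Wq)) (esym (TE q w Wq)))).
    exact: H1 q v w Wq.
  have E2 : opp_j_omega S' (h (psi q)) (Th (psi q) (T q v)) (Th (psi q) (T q w)) =
      'd (t2 w) q v - 'd (t2 v) q w.
    apply: (etrans (f_equal2 (opp_j_omega S' (h (psi q))) (esym (TE' q v Wq)) (esym (TE' q w
      Wq)))).
    exact: H2 q v w Wq.
  apply: (etrans (f_equal2 (fun a b : R => a - b) E2 E1)).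
  apply: (etrans _ (esym (f_equal2 (fun a b : R => a - b) (dE w v) (dE v w)))).
  have ring4 (a b c d : R) : (a - b) - (c - d) = (a - c) - (b - d) by ring.
  exact: ring4.
exists th; split; first split.
- move=> x c u v Yx tu tv.
  have tw : tangent Y x (c *: u + v).
    apply: tangent_open => //; first by case: Yx.
    by apply: (tangent_submanifold_linear c sub (YP Yx)); exact: tangent_sub YP _.
  pose proof (etrans (congr1 (spray_theta L' Sig' (sphi S') (h x)) (Tmap_linear shY Yx tu tv tw))
    (theta_linear c (CSig_Sig (Yh Yx)) (tS' (tYh Yx tu)) (tS' (tYh Yx tv)))) as A1.
  pose proof (etrans (congr1 (spray_theta L Sig (sphi S) (g0 x)) (Tmap_linear sgY Yx tu tv tw))
    (theta_linear c (CSig_Sig (Yg Yx)) (tS (tYg Yx tu)) (tS (tYg Yx tv)))) as A2.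
  apply: (etrans (f_equal2 (fun a b : R => a - b) A1 A2)).
  have ring5 (a b d z : R) : (c * a + b) - (c * d + z) = c * (a - d) + (b - z) by ring.
  exact: ring5.
- by move=> k' W U1 psi rho lp; exact: (main k' W U1 psi rho lp).1.
move=> k' W U1 psi rho lp T q v w Wq; have [sth H] := main k' W U1 psi rho lp.
have d1 := smooth_differentiable (sth w) Wq; have d2 := smooth_differentiable (sth v) Wq.
apply: (etrans (H q v w Wq)).
exact: (esym (f_equal2 (fun a b : R => a - b) (deriveE v d1) (deriveE w d2))).
Qed.

End Glue.

Theorem corollary6p7 (R : realType) (S : saturation R) :
  [/\ dirac_diffeomorphic (sP S) (L_P S)
        (CSig S) (gauge (CSig S) (pull_dirac (CSig S) (@base R _ (sM S)) (L_X S))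
                    (opp_j_omega S)),
      exact_form (CSig S) (opp_j_omega S)
    & forall (S' : saturation R) (f : sM S -> sM S')
        (F : pontryagin (sM S) -> pontryagin (sM S')),
        same_pullback f F -> germ_gauge_equivalent S S'].
Proof.
have [g0 [se sg0 eP gP]] := exp_inverse S.
split.
(* The diffeomorphism is to start from P, so it is the inverse of exp. *)
- exists g0; split.
    exists (spray_exp (sphi S)); split; [exact: sg0|exact: se|by move=> x /gP|by move=> a /eP].
  by move=> x Px; exact: pull_L_P.
- exact: exact_opp_j_omega.
move=> S' f F [[[f' [sf sf' fX f'X]] pf] [F' [sF sF' FC F'C]] bF Flin].
have [g0' [se' sg0' eP' gP']] := exp_inverse S'.
have FC1 a : sC S a -> sC S' (F a) by move=> /FC[].
have FC1' a : sC S' a -> sC S (F' a) by move=> /F'C[].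
have gC x : sP S x -> CSig S (g0 x) by move=> /gP[].
have gC' x : sP S' x -> CSig S' (g0' x) by move=> /gP'[].
have fX1 x : sX S x -> sX S' (f x) by move=> /fX[].
have [U [oU HU]] := glue_domain sF FC1 sg0 gC.
have [U' [oU' HU']] := glue_domain sF' FC1' sg0' gC'.
(* Fiberwise linearity with c = 1 and zero arguments reads z = z + z, so F preserves the zero
   section. *)
have F0 x : sX S x -> F (x, 0, 0) = (f x, 0, 0).
  move=> Xx; have C0 := C_zero Xx.
  have E (W : lmodType R) (z : W) : z = 1 *: z + z -> z = 0.
    by rewrite scale1r => e; apply: (@addrI _ z); rewrite addr0 -e.
  have := Flin x 0 0 1 C0 C0; rewrite scaler0 addr0 => /E.
  have := bF _ C0; rewrite /prT /base /=; case: (F _) => [[y v] p] /= -> [-> ->].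
  by [].
(* exp fixes the zero section, so its inverse sends x in X to the zero vector over x. *)
have gX x : sX S x -> g0 x = (x, 0, 0).
  move=> Xx; have C0 : CSig S (x, 0, 0) by split; [exact: C_zero|exact: Sig_zero].
  by have [_] := eP _ C0; rewrite exp_zero.
have gX' x : sX S' x -> g0' x = (x, 0, 0).
  move=> Xx; have C0 : CSig S' (x, 0, 0) by split; [exact: C_zero|exact: Sig_zero].
  by have [_] := eP' _ C0; rewrite exp_zero.
have UC x : sP S x -> U x -> CSig S' (F (g0 x)) by move=> Px /(HU x Px).
exists U, U', (glue_form F g0 U), (spray_exp (sphi S') \o (F \o g0)); split.
- by split.
- split=> x Xx.
    apply/(HU x (X_sub_P Xx)); rewrite gX // F0 //; split.
      exact/C_zero/fX1.
    exact: Sig_zero.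
  apply/(HU' x (X_sub_P Xx)); rewrite gX' //.
  have [Xf' ff'] := f'X x Xx.
  (* F' is given merely as an inverse map: its value at the zero vector over x is found from F at
     the zero vector over [f' x]. *)
  have <- : F (f' x, 0, 0) = (x, 0, 0) by rewrite F0 // ff'.
  have [_ ->] := FC _ (C_zero Xf').
  by split; [exact: C_zero|exact: Sig_zero].
- exact: (glue_exact sF sg0 gP oU UC).
split; last by move=> x Yx; exact: (glue_dirac sf fX1 pf sF bF sg0 gP oU UC Yx).
(* The inverse is built in the same way from F' and the inverse of exp'. *)
exists (spray_exp (sphi S) \o (F' \o g0')).
have UC' x : sP S' x -> U' x -> CSig S (F' (g0' x)) by move=> Px /(HU' x Px).
split.
- exact: (glue_smooth sF sg0 gP UC).
- exact: (glue_smooth sF' sg0' gP' UC').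
(* At the image point [g0'] undoes exp' and F' undoes F, which returns [g0 x] in C /\ Sigma; this is
   also the condition that defines [U']. *)
- move=> x [Px Ux]; have [Ca ex] := gP x Px; have Cb := UC x Px Ux.
  have [P'y gy] := eP' _ Cb; have [_ FF] := FC _ Ca.1.
  split; last by rewrite /= gy FF ex.
  by split=> //; apply/(HU' _ P'y); rewrite gy /= FF.
move=> y [Py Uy]; have [Ca ex] := gP' y Py; have Cb := UC' y Py Uy.
have [Px gx] := eP _ Cb; have [_ FF] := F'C _ Ca.1.
split; last by rewrite /= gx FF ex.
by split=> //; apply/(HU _ Px); rewrite gx /= FF.
Qed.
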